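(* (i) If $A$ and $B$ are pseudocompact C$^*$-algebras, then the direct sum $A\oplus B$ is pseudocompact (hence the class of pseudocompact C$^*$-algebras is closed under finite direct sums). (ii) If $A$ is a pseudocompact C$^*$-algebra and $n\ge 1$, then $M_n\otimes A\cong M_n(A)$ is pseudocompact. (iii) If $A$ is a pseudomatricial C$^*$-algebra and $n\ge 1$, then $M_n\otimes A\cong M_n(A)$ is pseudomatricial.
   Context: $M_n$ denotes the C$^*$-algebra of complex $n\times n$ matrices, $n\ge 1$. Finite-dimensional C$^*$-algebras are, up to isomorphism, the (nonempty) finite direct sums of matrix algebras $M_n$. Continuous logic for C$^*$-algebras: atomic formulae are norms $\|P(x_1,\dots,x_k)\|$ of $*$-polynomials with complex coefficients (a constant $I$ for the identity may be used when the algebras are unital); formulae are built from these by applying continuous real-valued functions to finitely many formulae and by taking $\sup$ or $\inf$ of a variable over the closed unit ball. A sentence is a formula without free variables; $\varphi^A\in\mathbb{R}$ is its value in $A$. $A$ and $B$ are elementarily equivalent, $A\equiv B$, if $\varphi^A=\varphi^B$ for every sentence $\varphi$. For an ultrafilter $\mathcal{U}$ on a set $I$, the ultraproduct $\prod_{\mathcal{U}}A_i$ is the C$^*$-algebra of bounded families $(a_i)_{i\in I}$ modulo those with $\lim_{\mathcal{U}}\|a_i\|=0$. A C$^*$-algebra is pseudocompact if it is elementarily equivalent to an ultraproduct of finite-dimensional C$^*$-algebras, and pseudomatricial if it is elementarily equivalent to an ultraproduct of matrix algebras. It is not required to be infinite-dimensional. *)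

(* Defs.v *)
From HB Require Import structures.
From mathcomp Require Import all_boot all_order all_algebra ring_quotient.
From mathcomp Require Import complex.
From mathcomp Require Import all_classical all_reals all_analysis.

Set Implicit Arguments.
Unset Strict Implicit.
Unset Printing Implicit Defensive.

Import Order.TTheory GRing.Theory Num.Theory.
Import numFieldNormedType.Exports.

Local Open Scope classical_set_scope.
Local Open Scope ring_scope.
Local Open Scope quotient_scope.

(* Data of a complex *-algebra with a norm; no axiom links the three fields to
   the vector space, [is_cstar] below does.  There is no unit, since
   C*-algebras need not be unital. *)
Record starAlg (R : realType) := StarAlg {
  starAlg_car :> lmodType R[i] ;
  smul : starAlg_car -> starAlg_car -> starAlg_car ;
  adj : starAlg_car -> starAlg_car ;
  cnorm : starAlg_car -> R }.

Arguments smul {R s} _ _.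
Arguments adj {R s} _.
Arguments cnorm {R s} _.

Notation "a ** b" := (smul a b) (at level 40, left associativity) : ring_scope.

(* [Re `|c|] is the modulus as an element of R: the library's norm on R[i]
   takes its values in R[i]. *)
Definition cmod (R : realType) (c : R[i]) : R := complex.Re `|c|.

Record is_cstar (R : realType) (A : starAlg R) : Prop := IsCstar {
  cs_mulA : forall a b c : A, a ** (b ** c) = (a ** b) ** c ;
  cs_mulDl : forall a b c : A, (a + b) ** c = a ** c + b ** c ;
  cs_mulDr : forall a b c : A, a ** (b + c) = a ** b + a ** c ;
  cs_scaleAl : forall (k : R[i]) (a b : A), (k *: a) ** b = k *: (a ** b) ;
  cs_scaleAr : forall (k : R[i]) (a b : A), a ** (k *: b) = k *: (a ** b) ;
  cs_adjK : forall a : A, adj (adj a) = a ;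
  cs_adjD : forall a b : A, adj (a + b) = adj a + adj b ;
  cs_adjZ : forall (k : R[i]) (a : A), adj (k *: a) = conjc k *: adj a ;
  cs_adjM : forall a b : A, adj (a ** b) = adj b ** adj a ;
  cs_norm0_eq0 : forall a : A, cnorm a = 0 -> a = 0 ;
  cs_normZ : forall (k : R[i]) (a : A), cnorm (k *: a) = cmod k * cnorm a ;
  cs_normD : forall a b : A, cnorm (a + b) <= cnorm a + cnorm b ;
  cs_normM : forall a b : A, cnorm (a ** b) <= cnorm a * cnorm b ;
  cs_normC : forall a : A, cnorm (adj a ** a) = cnorm a ^+ 2 ;
  cs_complete : forall u : nat -> A,
    (forall e : R, 0 < e -> exists N : nat, forall m n : nat,
       (N <= m)%N -> (N <= n)%N -> cnorm (u m - u n) < e) ->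
    exists l : A, (fun n => cnorm (u n - l)) @ \oo --> (0 : R) }.

Record cstarAlg (R : realType) := CstarAlg {
  cstarAlg_star :> starAlg R ;
  cstarAlgP : is_cstar cstarAlg_star }.

Definition star_iso (R : realType) (A B : starAlg R) : Prop :=
  exists f : A -> B,
    [/\ bijective f,
        (forall (k : R[i]) (a b : A), f (k *: a + b) = k *: f a + f b),
        (forall a b : A, f (a ** b) = f a ** f b),
        (forall a : A, f (adj a) = adj (f a)) &
        (forall a : A, cnorm (f a) = cnorm a)].

Definition cplx (R : realType) : starAlg R :=
  @StarAlg R (R[i]^o : lmodType R[i])
    (fun a b : R[i] => a * b) (fun a : R[i] => conjc a) (@cmod R).

Definition dsum (R : realType) (A B : starAlg R) : starAlg R :=
  @StarAlg R (A * B)%type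
    (fun x y => (x.1 ** y.1, x.2 ** y.2))
    (fun x => (adj x.1, adj x.2))
    (fun x => Num.max (cnorm x.1) (cnorm x.2)).

Section DepFamilies.
Variables (R : realType) (I : Type) (F : I -> starAlg R).

Definition fam : Type := forall i, F i.

HB.instance Definition _ := Choice.copy fam (forall i, F i).

Let fam_addA : associative (fun x y : fam => (fun i => x i + y i) : fam).
Proof. by move=> x y z; apply/functional_extensionality_dep => i; rewrite addrA. Qed.
Let fam_addC : commutative (fun x y : fam => (fun i => x i + y i) : fam).
Proof. by move=> x y; apply/functional_extensionality_dep => i; rewrite addrC. Qed.
Let fam_add0 : left_id ((fun i => 0) : fam)
  (fun x y : fam => (fun i => x i + y i) : fam).
Proof. by move=> x; apply/functional_extensionality_dep => i; rewrite add0r. Qed.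
Let fam_addN : left_inverse ((fun i => 0) : fam)
  (fun x : fam => (fun i => - x i) : fam)
  (fun x y : fam => (fun i => x i + y i) : fam).
Proof. by move=> x; apply/functional_extensionality_dep => i; rewrite addNr. Qed.
HB.instance Definition _ :=
  GRing.isZmodule.Build fam fam_addA fam_addC fam_add0 fam_addN.

Let fam_scale (k : R[i]) (x : fam) : fam := fun i => k *: x i.
Let fam_scaleA a b x : fam_scale a (fam_scale b x) = fam_scale (a * b) x.
Proof. by apply/functional_extensionality_dep => i; rewrite /fam_scale scalerA. Qed.
Let fam_scale1 : left_id 1 fam_scale.
Proof. by move=> x; apply/functional_extensionality_dep => i; rewrite /fam_scale scale1r. Qed.
Let fam_scaleDr : right_distributive fam_scale +%R.
Proof.
by move=> k x y; apply/functional_extensionality_dep => i; rewrite /fam_scale scalerDr.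
Qed.
Let fam_scaleDl x : {morph fam_scale^~ x : a b / a + b}.
Proof.
by move=> a b; apply/functional_extensionality_dep => i; rewrite /fam_scale scalerDl.
Qed.
HB.instance Definition _ := GRing.Zmodule_isLmodule.Build R[i] fam
  fam_scaleA fam_scale1 fam_scaleDr fam_scaleDl.

Lemma famD (x y : fam) i : (x + y) i = x i + y i. Proof. by []. Qed.
Lemma famN (x : fam) i : (- x) i = - x i. Proof. by []. Qed.
Lemma fam0 i : (0 : fam) i = 0. Proof. by []. Qed.
Lemma famZ (k : R[i]) (x : fam) i : (k *: x) i = k *: x i. Proof. by []. Qed.

End DepFamilies.

Definition big_dsum (R : realType) (m : nat) (F : 'I_m -> starAlg R) :
    starAlg R :=
  @StarAlg R (fam F)
    (fun x y i => x i ** y i) (fun x i => adj (x i))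
    (fun x => \big[Num.max/0]_(i < m) cnorm (x i)).

Section MatrixAlgebra.
Variables (R : realType) (n : nat) (A : starAlg R).

(* An alias of 'M[A]_n carrying the entrywise C-vector space structure. *)
Definition mat_over : Type := 'M[A]_n.
HB.instance Definition _ := GRing.Zmodule.copy mat_over 'M[A]_n.

Let mat_scale (k : R[i]) (M : mat_over) : mat_over := \matrix_(i, j) (k *: M i j).
Let mat_scaleA a b M : mat_scale a (mat_scale b M) = mat_scale (a * b) M.
Proof. by apply/matrixP => i j; rewrite !mxE scalerA. Qed.
Let mat_scale1 : left_id 1 mat_scale.
Proof. by move=> M; apply/matrixP => i j; rewrite !mxE scale1r. Qed.
Let mat_scaleDr : right_distributive mat_scale +%R.
Proof. by move=> k M N; apply/matrixP => i j; rewrite !mxE scalerDr. Qed.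
Let mat_scaleDl M : {morph mat_scale^~ M : a b / a + b}.
Proof. by move=> a b; apply/matrixP => i j; rewrite !mxE scalerDl. Qed.
HB.instance Definition _ := GRing.Zmodule_isLmodule.Build R[i] mat_over
  mat_scaleA mat_scale1 mat_scaleDr mat_scaleDl.

Definition col_norm (x : 'cV[A]_n) : R :=
  Num.sqrt (cnorm (\sum_i (adj (x i 0) ** x i 0))).

Definition mat_apply (M : mat_over) (x : 'cV[A]_n) : 'cV[A]_n :=
  \col_i \sum_j (M i j ** x j 0).

(* The C*-norm of M_n(A): the operator norm of the left action of M_n(A) on the
   Hilbert A-module A^n, normed by |x| = |sum_i x_i^* x_i|^(1/2).  For A = C
   this is the operator norm on the Hilbert space C^n. *)
Definition mat_norm (M : mat_over) : R :=
  sup [set col_norm (mat_apply M x) | x in [set x | col_norm x <= 1]].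

Definition matalg : starAlg R :=
  @StarAlg R mat_over
    (fun M N => \matrix_(i, j) \sum_k (M i k ** N k j))
    (fun M => \matrix_(i, j) adj (M j i))
    mat_norm.

End MatrixAlgebra.

Definition is_matrix_algebra (R : realType) (F : starAlg R) : Prop :=
  exists n : nat, (0 < n)%N /\ star_iso F (matalg n (cplx R)).

Definition finite_dimensional (R : realType) (F : starAlg R) : Prop :=
  exists (m : nat) (k : 'I_m -> nat),
    [/\ (0 < m)%N, (forall i, (0 < k i)%N) &
        star_iso F (big_dsum (fun i => matalg (k i) (cplx R)))].

Section CstarBasics.
Variables (R : realType) (A : starAlg R).
Hypothesis cA : is_cstar A.

Lemma cmod0 : cmod (0 : R[i]) = 0.
Proof. by rewrite /cmod normr0. Qed.

Lemma cmod_ge0 (c : R[i]) : 0 <= cmod c.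
Proof. by rewrite /cmod normc_def /= sqrtr_ge0. Qed.

Lemma cmodN1 : cmod (-1 : R[i]) = 1.
Proof. by rewrite /cmod normrN normr1. Qed.

Lemma cs_norm0 : cnorm (0 : A) = 0.
Proof. by rewrite -(scale0r (0 : A)) cs_normZ // cmod0 mul0r. Qed.

Lemma cs_normN (a : A) : cnorm (- a) = cnorm a.
Proof. by rewrite -scaleN1r cs_normZ // cmodN1 mul1r. Qed.

Lemma cs_norm_ge0 (a : A) : 0 <= cnorm a.
Proof.
have := cs_normD cA a (- a); rewrite subrr cs_norm0 cs_normN -mulr2n.
by rewrite pmulrn_lge0.
Qed.

Lemma cs_norm_adj (a : A) : cnorm (adj a) = cnorm a.
Proof.
have le (b : A) : cnorm b <= cnorm (adj b).
  have [->|b0] := eqVneq (cnorm b) 0; first exact: cs_norm_ge0.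
  have b_gt0 : 0 < cnorm b by rewrite lt_def b0 cs_norm_ge0.
  by rewrite -(ler_pM2r b_gt0) -expr2 -(cs_normC cA) cs_normM.
by apply/le_anti; rewrite le andbT -[X in _ <= cnorm X](cs_adjK cA a) le.
Qed.

Lemma cs_mul0 (a : A) : a ** 0 = 0.
Proof. by rewrite -(scale0r (0 : A)) cs_scaleAr // !scale0r. Qed.

Lemma cs_0mul (a : A) : (0 : A) ** a = 0.
Proof. by rewrite -(scale0r (0 : A)) cs_scaleAl // !scale0r. Qed.

Lemma cs_adj0 : adj (0 : A) = 0.
Proof. by rewrite -(scale0r (0 : A)) cs_adjZ // conjc0 !scale0r. Qed.

End CstarBasics.

Record ultrafilter (I : Type) := Ultrafilter {
  uf_sets :> set_system I ;
  uf_ultra : UltraFilter uf_sets }.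

#[global] Existing Instance uf_ultra.

Section Ultraproduct.
Variables (R : realType) (I : Type) (U : ultrafilter I) (F : I -> cstarAlg R).

Let G (i : I) : starAlg R := F i.
Let cG i : is_cstar (G i) := cstarAlgP (F i).

Definition bounded : {pred fam G} :=
  fun x => `[< exists M : R, forall i, cnorm (x i) <= M >].

Lemma boundedP (x : fam G) :
  reflect (exists M : R, forall i, cnorm (x i) <= M) (x \in bounded).
Proof. exact: asboolP. Qed.

Lemma bounded_submod : submod_closed bounded.
Proof.
split=> [|k x y /boundedP[M xM] /boundedP[N yN]]; apply/boundedP.
  by exists 0 => i; rewrite fam0 cs_norm0.
exists (cmod k * M + N) => i; rewrite famD famZ.
apply: le_trans (cs_normD (cG i) _ _) _.
by rewrite lerD// (cs_normZ (cG i)) ler_wpM2l// cmod_ge0.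
Qed.
HB.instance Definition _ :=
  GRing.isSubmodClosed.Build R[i] (fam G) bounded bounded_submod.

Record bfam := BFam { bfam_val : fam G ; bfamP : bfam_val \in bounded }.
Definition bfam_fun (x : bfam) : forall i, G i := bfam_val x.
Coercion bfam_fun : bfam >-> Funclass.
HB.instance Definition _ := [isSub for bfam_val].
HB.instance Definition _ := [Choice of bfam by <:].
HB.instance Definition _ := [SubChoice_isSubLmodule of bfam by <:].

Lemma bfam_bnd (x : bfam) : exists M : R, forall i, cnorm (x i) <= M.
Proof. exact/boundedP/bfamP. Qed.

Lemma bfamD (x y : bfam) i : (x + y : bfam) i = x i + y i. Proof. by []. Qed.
Lemma bfamN (x : bfam) i : (- x : bfam) i = - x i. Proof. by []. Qed.
Lemma bfamZ (k : R[i]) (x : bfam) i : (k *: x : bfam) i = k *: x i.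
Proof. by []. Qed.

Lemma bmul_subproof (x y : bfam) : ((fun i => x i ** y i) : fam G) \in bounded.
Proof.
have [M xM] := bfam_bnd x; have [N yN] := bfam_bnd y.
apply/boundedP; exists (M * N) => i.
apply: le_trans (cs_normM (cG i) _ _) _.
by rewrite ler_pM// ?(cs_norm_ge0 (cG i)).
Qed.
Definition bmul (x y : bfam) : bfam := BFam (bmul_subproof x y).

Lemma badj_subproof (x : bfam) : ((fun i => adj (x i)) : fam G) \in bounded.
Proof.
have [M xM] := bfam_bnd x.
by apply/boundedP; exists M => i; rewrite (cs_norm_adj (cG i)).
Qed.
Definition badj (x : bfam) : bfam := BFam (badj_subproof x).

Definition null : {pred bfam} :=
  fun x => `[< (fun i => cnorm (x i)) @ uf_sets U --> (0 : R) >].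

Lemma nullP (x : bfam) :
  reflect ((fun i => cnorm (x i)) @ uf_sets U --> (0 : R)) (x \in null).
Proof. exact: asboolP. Qed.

Lemma null_squeeze (x : bfam) (g : I -> R) :
  (forall i, cnorm (x i) <= g i) -> g @ uf_sets U --> (0 : R) -> x \in null.
Proof.
move=> xg g0; apply/nullP; apply: (@squeeze_cvgr _ _ _ _ (cst 0) g) => //.
  by apply: nearW => i; rewrite xg (cs_norm_ge0 (cG i)).
exact: cvg_cst.
Qed.

Lemma null_submod : submod_closed null.
Proof.
split=> [|k x y /nullP x0 /nullP y0].
  apply/nullP; rewrite (_ : (fun i => _) = cst 0); first exact: cvg_cst.
  by apply/funext => i; rewrite (cs_norm0 (cG i)).
apply: (@null_squeeze _ (fun i => cmod k * cnorm (x i) + cnorm (y i))).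
  move=> i; apply: le_trans (cs_normD (cG i) _ _) _.
  by rewrite (cs_normZ (cG i)).
rewrite -(addr0 0) -{1}(mulr0 (cmod k)).
by apply: cvgD => //; apply: cvgMr.
Qed.
HB.instance Definition _ := GRing.isSubmodClosed.Build R[i] bfam null null_submod.

Definition up_car : Type := Quotient.quot null.
HB.instance Definition _ := GRing.Zmodule.copy up_car (Quotient.quot null).

Definition up_class (x : bfam) : up_car := \pi_(Quotient.quot null) x.
Definition up_rep (p : up_car) : bfam := repr (p : Quotient.quot null).

Lemma up_repK p : up_class (up_rep p) = p.
Proof. exact: reprK. Qed.

Lemma up_classP (x y : bfam) : up_class x = up_class y <-> x - y \in null.
Proof.
split=> [/eqP|xy]; first by rewrite /up_class -Quotient.idealrBE.
by apply/eqP; rewrite /up_class -Quotient.idealrBE.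
Qed.

Lemma up_rep_null x : up_rep (up_class x) - x \in null.
Proof. by apply/up_classP; rewrite up_repK. Qed.

Lemma up_classD x y : up_class (x + y) = up_class x + up_class y.
Proof. by rewrite /up_class raddfD. Qed.

Let up_scale (k : R[i]) (p : up_car) : up_car := up_class (k *: up_rep p).

Lemma up_scaleE k x : up_scale k (up_class x) = up_class (k *: x).
Proof.
apply/up_classP; rewrite -scalerBr; apply: rpredZ; exact: up_rep_null.
Qed.

Let up_scaleA a b p : up_scale a (up_scale b p) = up_scale (a * b) p.
Proof. by rewrite -(up_repK p) !up_scaleE scalerA. Qed.
Let up_scale1 : left_id 1 up_scale.
Proof. by move=> p; rewrite -(up_repK p) up_scaleE scale1r. Qed.
Let up_scaleDr : right_distributive up_scale +%R.
Proof.
move=> k p q; rewrite -(up_repK p) -(up_repK q).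
by rewrite -up_classD !up_scaleE -up_classD scalerDr.
Qed.
Let up_scaleDl p : {morph up_scale^~ p : a b / a + b}.
Proof.
by move=> a b; rewrite -(up_repK p) !up_scaleE -up_classD scalerDl.
Qed.
HB.instance Definition _ := GRing.Zmodule_isLmodule.Build R[i] up_car
  up_scaleA up_scale1 up_scaleDr up_scaleDl.

Definition up_star : starAlg R :=
  @StarAlg R up_car
    (fun p q => up_class (bmul (up_rep p) (up_rep q)))
    (fun p => up_class (badj (up_rep p)))
    (fun p => lim ((fun i => cnorm (up_rep p i)) @ uf_sets U)).

Lemma up_classZ k x : up_class (k *: x) = k *: up_class x.
Proof. by rewrite -up_scaleE. Qed.

Lemma up_mulE x y : (up_class x : up_star) ** up_class y = up_class (bmul x y).
Proof.
have [M xM] := bfam_bnd (up_rep (up_class x)); have [N yN] := bfam_bnd y.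
have /nullP x0 := up_rep_null x; have /nullP y0 := up_rep_null y.
set x' := up_rep _ in xM x0 *; set y' := up_rep _ in y0 *.
apply/up_classP; apply: (@null_squeeze _
  (fun i => M * cnorm ((y' - y) i) + cnorm ((x' - x) i) * N)).
  move=> i; have -> : (bmul x' y' - bmul x y) i =
      x' i ** (y' - y) i + (x' - x) i ** y i.
    rewrite !bfamD !bfamN (cs_mulDr (cG i)) (cs_mulDl (cG i)) /=.
    rewrite -(scaleN1r (y i)) -(scaleN1r (x i)).
    by rewrite (cs_scaleAr (cG i)) (cs_scaleAl (cG i)) !scaleN1r addrA subrK.
  apply: le_trans (cs_normD (cG i) _ _) _; apply: lerD.
    apply: le_trans (cs_normM (cG i) _ _) _.
    by rewrite ler_wpM2r// (cs_norm_ge0 (cG i)).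
  apply: le_trans (cs_normM (cG i) _ _) _.
  by rewrite ler_wpM2l// (cs_norm_ge0 (cG i)).
rewrite -(addr0 0) -{1}(mulr0 M) -{2}(mul0r N).
by apply: cvgD; [apply: cvgMr|apply: cvgMl].
Qed.

Lemma up_adjE x : adj (up_class x : up_star) = up_class (badj x).
Proof.
have /nullP x0 := up_rep_null x; set x' := up_rep _ in x0.
apply/up_classP; apply: (@null_squeeze _ (fun i => cnorm ((x' - x) i))) => // i.
rewrite [X in cnorm X](_ : _ = adj ((x' - x) i)) ?(cs_norm_adj (cG i))//.
rewrite !bfamD !bfamN (cs_adjD (cG i)) -(scaleN1r (x i)) (cs_adjZ (cG i)).
by rewrite rmorphN rmorph1 scaleN1r.
Qed.


Lemma ultra_bounded_cvg (f : I -> R) (M : R) :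
  (forall i, 0 <= f i <= M) -> exists2 l : R, 0 <= l <= M & f @ uf_sets U --> l.
Proof.
move=> fM.
have [l [lM clusl]] : `[0, M] `&` cluster (f @ uf_sets U) !=set0.
  apply: (@segment_compact R 0 M).
  by apply: nearW => i /=; rewrite in_itv /= fM.
exists l; first by move: lM; rewrite /= in_itv.
move=> B lB; rewrite /nbhs /=.
have [//|UnB] := @in_ultra_setVsetC _ (uf_sets U) (f @^-1` B) (uf_ultra U).
have [z [nBz Bz]] := clusl (~` B) B UnB lB.
by case: nBz.
Qed.

Lemma up_norm_cvg (x : bfam) :
  (fun i => cnorm (x i)) @ uf_sets U --> cnorm (up_class x : up_star).
Proof.
have /nullP d0 := up_rep_null x.
rewrite /= ; set y := up_rep _ in d0 *.
have [M yM] := bfam_bnd y.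
have [l _ yl] : exists2 l : R, 0 <= l <= M &
    (fun i => cnorm (y i)) @ uf_sets U --> l.
  by apply: ultra_bounded_cvg => i; rewrite (cs_norm_ge0 (cG i)) yM.
rewrite (cvg_lim _ yl)//.
apply: (@squeeze_cvgr _ _ _ _ (fun i => cnorm (y i) - cnorm ((y - x) i))
  (fun i => cnorm (y i) + cnorm ((y - x) i))).
- apply: nearW => i; apply/andP; split.
    rewrite lerBlDr; apply: le_trans (cs_normD (cG i) _ _).
    by rewrite bfamD bfamN addrC subrK.
  have {1}-> : x i = y i + - (y - x) i.
    by rewrite bfamD bfamN opprD opprK addNKr.
  by apply: le_trans (cs_normD (cG i) _ _) _; rewrite (cs_normN (cG i)).
- by rewrite -(subr0 l); apply: cvgB.
- by rewrite -(addr0 l); apply: cvgD.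
Qed.

Lemma uf_le (f g : I -> R) (l l' : R) :
  f @ uf_sets U --> l -> g @ uf_sets U --> l' -> (forall i, f i <= g i) ->
  l <= l'.
Proof.
move=> fl gl fg; rewrite -subr_ge0; have h : (fun i => g i - f i) @ uf_sets U --> l' - l by exact: cvgB.
rewrite -(cvg_lim (@Rhausdorff R) h); apply: limr_ge; first exact: cvgP h.
by apply: nearW => i /=; rewrite subr_ge0.
Qed.

Lemma up_norm_le (x : bfam) (e : R) :
  (forall i, cnorm (x i) <= e) -> cnorm (up_class x : up_star) <= e.
Proof.
by move=> xe; apply: (uf_le (@up_norm_cvg x) _ xe); exact: cvg_cst.
Qed.

Lemma up_rep_small (p : up_star) (e : R) : cnorm p < e ->
  exists2 x : bfam, p = up_class x & forall i, cnorm (x i) <= e.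
Proof.
rewrite -(up_repK p); set y := up_rep p => pe.
have yp := @up_norm_cvg y.
have e0 : 0 <= e.
  apply: le_trans (ltW pe); apply: (uf_le (cvg_cst 0) yp) => i.
  exact: (cs_norm_ge0 (cG i)).
pose x i : G i := if cnorm (y i) <= e then y i else 0.
have xe i : cnorm (x i) <= e.
  by rewrite /x; case: ifPn => // _; rewrite (cs_norm0 (cG i)).
have xb : (x : fam G) \in bounded by apply/boundedP; exists e.
exists (BFam xb) => //; apply/up_classP/nullP.
have U1 : \forall i \near uf_sets U, cnorm (y i) < e by exact: cvgr_lt yp _ pe.
apply/cvgrPdist_lt => d d0; near=> i.
have -> : (y - BFam xb) i = 0.
  rewrite bfamD bfamN; apply/eqP; rewrite subr_eq0 eq_sym; apply/eqP.
  by rewrite /bfam_fun /= /x ltW//; near: i.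
by rewrite (cs_norm0 (cG i)) subr0 normr0.
Unshelve. all: by end_near. Qed.

Let up_adjD : {morph (fun p : up_star => adj p) : p q / p + q}.
Proof.
move=> p q; rewrite -(up_repK p) -(up_repK q) -up_classD !up_adjE -up_classD.
congr up_class; apply/val_inj/functional_extensionality_dep => i /=.
exact: (cs_adjD (cG i)).
Qed.

Let up_normD (p q : up_star) : cnorm (p + q) <= cnorm p + cnorm q.
Proof.
rewrite -(up_repK p) -(up_repK q) -up_classD.
set x := up_rep p; set y := up_rep q.
have xc := @up_norm_cvg x; have yc := @up_norm_cvg y.
have zc := @up_norm_cvg (x + y).
by apply: (uf_le zc (g := fun i => cnorm (x i) + cnorm (y i))) => [|i];
  [exact: cvgD|exact: (cs_normD (cG i))].
Qed.

Let up_norm_ge0 (p : up_star) : 0 <= cnorm p.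
Proof.
rewrite -(up_repK p); apply: (uf_le (f := fun=> 0) _ (@up_norm_cvg _)).
  exact: cvg_cst.
by move=> i; exact: (cs_norm_ge0 (cG i)).
Qed.

Let up_normZ k (p : up_star) : cnorm (k *: p) = cmod k * cnorm p.
Proof.
rewrite -(up_repK p) -up_classZ; set x := up_rep p.
have zc := @up_norm_cvg (k *: x).
apply: (cvg_unique (@Rhausdorff R) zc).
rewrite (_ : (fun i => _) = (fun i => cmod k * cnorm (x i))).
  by apply: cvgMr; exact: up_norm_cvg.
by apply/funext => i; rewrite (cs_normZ (cG i)).
Qed.

Let up_complete (u : nat -> up_star) :
  (forall e : R, 0 < e -> exists N : nat, forall m n : nat,
     (N <= m)%N -> (N <= n)%N -> cnorm (u m - u n) < e) ->
  exists l : up_star, (fun n => cnorm (u n - l)) @ \oo --> (0 : R).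
Proof.
move=> cu; pose h k : R := (2^-1) ^+ k.
have h0 k : 0 < h k by rewrite exprn_gt0// invr_gt0.
have [phi phiP] := choice (fun k => cu _ (h0 k)).
pose N k := (\sum_(j < k.+1) phi j)%N.
have phiN k : (phi k <= N k)%N by rewrite /N big_ord_recr /= leq_addl.
have NS k : (N k <= N k.+1)%N by rewrite /N [leqRHS]big_ord_recr /= leq_addr.
pose v k := u (N k).
have vS k : cnorm (v k.+1 - v k) < h k.
  by apply: phiP; rewrite ?phiN// (leq_trans (phiN k)).
have [d dP] : exists d : nat -> bfam, forall k,
    v k.+1 - v k = up_class (d k) /\ forall i, cnorm (d k i) <= h k.
  suff: forall k, exists x : bfam,
      v k.+1 - v k = up_class x /\ forall i, cnorm (x i) <= h k.
    by move=> /choice[d dP]; exists d.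
  by move=> k; have [x xv xh] := up_rep_small (vS k); exists x.
pose s k : bfam := \sum_(j < k) d j.
have sS k : s k.+1 = s k + d k by rewrite /s big_ord_recr.
have sE k : up_class (s k) = v k - v 0.
  elim: k => [|k IH].
    rewrite /s big_ord0 subrr; have := up_classD 0 0.
    by rewrite addr0 => /eqP; rewrite -subr_eq subrr => /eqP.
  by rewrite sS up_classD IH -(dP k).1 addrC subrKA.
have hS k : 2 * h k.+1 = h k by rewrite /h exprS mulrA mulfV ?mul1r.
have sd i k n : cnorm (s (k + n)%N i - s k i) <= 2 * h k - 2 * h (k + n)%N.
  elim: n => [|n IH]; first by rewrite addn0 !subrr (cs_norm0 (cG i)).
  rewrite addnS sS bfamD addrAC.
  apply: le_trans (cs_normD (cG i) _ _) _.
  apply: le_trans (lerD IH ((dP _).2 i)) _.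
  by rewrite hS -addrA lerD2l mulr_natl mulr2n opprD subrK.
have hsmall (e : R) : 0 < e -> exists k, 3 * h k < e.
  move=> e0; have e3 : 0 < e / 3 by rewrite divr_gt0.
  have hc : h @ \oo --> 0.
    by apply: cvg_expr; rewrite ger0_norm ?invr_ge0// invf_lt1// ltr1n.
  have [k _ hk] := cvgr_lt _ hc _ e3.
  exists k; have := hk k (leqnn k).
  by rewrite /= ltr_pdivlMr// mulrC.
have si_cauchy i (e : R) : 0 < e -> exists N : nat, forall m n : nat,
    (N <= m)%N -> (N <= n)%N -> cnorm ((s m i : G i) - s n i) < e.
  move=> e0; have e2 : 0 < e / 2 by rewrite divr_gt0.
  have [k hk] := hsmall _ e2; exists k => m n km kn.
  have sk j : (k <= j)%N -> cnorm (s j i - s k i) < e / 2.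
    move=> kj; apply: le_lt_trans hk; rewrite -(subnKC kj).
    apply: le_trans (sd _ _ _) _.
    rewrite lerBlDr; apply: (@le_trans _ _ (3 * h k)).
      by rewrite ler_wpM2r ?ler_nat// ltW.
    by rewrite lerDl mulr_ge0// ltW.
  have -> : s m i - s n i = (s m i - s k i) + - (s n i - s k i).
    by rewrite opprB addrA subrK.
  apply: le_lt_trans (cs_normD (cG i) _ _) _.
  by rewrite (cs_normN (cG i)) [ltRHS]splitr ltrD// sk.
pose L i : G i := sval (cid (cs_complete (cG i) (si_cauchy i))).
have LP i : (fun n => cnorm ((s n i : G i) - L i)) @ \oo --> (0 : R).
  by rewrite /L; case: cid.
have Ls i k : cnorm (L i - s k i) <= 2 * h k.
  apply/ler_addgt0Pr => e e0.
  have [n _ /(_ _ (leq_addl k n)) /= Ln] := cvgr_lt _ (LP i) e e0.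
  have -> : L i - s k i = (s (k + n)%N i - s k i) + - (s (k + n)%N i - L i).
    by rewrite opprB [RHS]addrC addrA subrK.
  apply: le_trans (cs_normD (cG i) _ _) _.
  rewrite (cs_normN (cG i)); apply: lerD; last exact: ltW.
  apply: le_trans (sd _ _ _) _.
  by rewrite lerBlDr lerDl mulr_ge0// ltW.
have Lb : (L : fam G) \in bounded.
  apply/boundedP; exists (2 * h 0) => i; have := Ls i 0.
  have -> : s 0 i = 0 by rewrite /s big_ord0.
  by rewrite subr0.
pose l : up_star := v 0 + up_class (BFam Lb).
have lv k : cnorm (v k - l) <= 2 * h k.
  have -> : v k - l = up_class (s k - BFam Lb).
    rewrite up_classD sE /l opprD addrA; congr (_ + _).
    rewrite -scaleN1r -[in RHS]scaleN1r up_classZ //.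
  apply: up_norm_le => i; rewrite bfamD bfamN.
  by rewrite -(cs_normN (cG i)) opprB; exact: Ls.
exists l; apply/cvgrPdist_lt => e e0.
have [k hk] := hsmall _ e0.
exists (N k) => // n /= Nn.
have -> : u n - l = (u n - v k) + (v k - l) by rewrite addrA subrK.
rewrite sub0r normrN ger0_norm ?up_norm_ge0//.
apply: le_lt_trans (up_normD _ _) _.
apply: le_lt_trans hk; rewrite (_ : 3 = 1 + 2)// mulrDl mul1r lerD//.
by apply/ltW/phiP; rewrite ?phiN// (leq_trans (phiN k)).
Qed.

Lemma up_is_cstar : is_cstar up_star.
Proof.
split.
- move=> p q r; rewrite -(up_repK p) -(up_repK q) -(up_repK r) !up_mulE.
  congr up_class; apply/val_inj/functional_extensionality_dep => i /=.
  exact: (cs_mulA (cG i)).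
- move=> p q r; rewrite -(up_repK p) -(up_repK q) -(up_repK r).
  rewrite -up_classD !up_mulE -up_classD.
  congr up_class; apply/val_inj/functional_extensionality_dep => i /=.
  exact: (cs_mulDl (cG i)).
- move=> p q r; rewrite -(up_repK p) -(up_repK q) -(up_repK r).
  rewrite -up_classD !up_mulE -up_classD.
  congr up_class; apply/val_inj/functional_extensionality_dep => i /=.
  exact: (cs_mulDr (cG i)).
- move=> k p q; rewrite -(up_repK p) -(up_repK q) up_mulE -!up_classZ up_mulE.
  congr up_class; apply/val_inj/functional_extensionality_dep => i /=.
  exact: (cs_scaleAl (cG i)).
- move=> k p q; rewrite -(up_repK p) -(up_repK q) up_mulE -!up_classZ up_mulE.
  congr up_class; apply/val_inj/functional_extensionality_dep => i /=.
  exact: (cs_scaleAr (cG i)).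
- move=> p; rewrite -(up_repK p) !up_adjE.
  congr up_class; apply/val_inj/functional_extensionality_dep => i /=.
  exact: (cs_adjK (cG i)).
- exact: up_adjD.
- move=> k p; rewrite -(up_repK p) up_adjE -!up_classZ up_adjE.
  congr up_class; apply/val_inj/functional_extensionality_dep => i /=.
  exact: (cs_adjZ (cG i)).
- move=> p q; rewrite -(up_repK p) -(up_repK q).
  set x := up_rep p; set y := up_rep q.
  rewrite (up_mulE x y) (up_adjE x) (up_adjE y) (up_mulE (badj y)) up_adjE.
  congr up_class; apply/val_inj/functional_extensionality_dep => i /=.
  exact: (cs_adjM (cG i)).
- move=> p; rewrite -(up_repK p) => p0.
  have := @up_norm_cvg (up_rep p); rewrite p0 => /nullP c0.
  rewrite -(scale0r (up_class 0 : up_star)) -up_classZ.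
  by apply/up_classP; rewrite scale0r subr0.
- exact: up_normZ.
- exact: up_normD.
- move=> p q; rewrite -(up_repK p) -(up_repK q) up_mulE.
  set x := up_rep p; set y := up_rep q.
  apply: (uf_le (@up_norm_cvg _) (g := fun i => cnorm (x i) * cnorm (y i))).
    by apply: cvgM; exact: up_norm_cvg.
  by move=> i; exact: (cs_normM (cG i)).
- move=> p; rewrite -(up_repK p) up_adjE up_mulE.
  set x := up_rep p; apply: (cvg_unique (@Rhausdorff R) (@up_norm_cvg _)).
  rewrite (_ : (fun i => _) = (fun i => cnorm (x i) * cnorm (x i))).
    by rewrite expr2; apply: cvgM; exact: up_norm_cvg.
  by apply/funext => i; rewrite (cs_normC (cG i)).
- exact: up_complete.
Qed.

Definition ultraproduct : cstarAlg R := CstarAlg up_is_cstar.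

End Ultraproduct.

Definition is_identity (R : realType) (A : starAlg R) (e : A) : Prop :=
  forall a : A, e ** a = a /\ a ** e = a.

Definition unital (R : realType) (A : starAlg R) : Prop :=
  exists e : A, is_identity e.

(* Interprets the constant I; the default value 0 is only a totality convention,
   since [elem_equiv] asks for units whenever I is in the language. *)
Definition cunit (R : realType) (A : starAlg R) : A :=
  xget (0 : A) (@is_identity R A).

(* *-polynomials in the n noncommuting variables indexed by 'I_n.  The flag [u]
   chooses the language: for u = false the plain one, interpreted in all
   C*-algebras; for u = true the one with the constant I, used for unital
   C*-algebras only. *)
Inductive star_poly (R : realType) (u : bool) (n : nat) : Type :=
| PVar of 'I_n
| PI of u
| PAdd of star_poly R u n & star_poly R u n
| PScale of R[i] & star_poly R u n
| PMul of star_poly R u n & star_poly R u n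
| PAdj of star_poly R u n.

(* Formulas whose free variables are indexed by 'I_n; [FSup] and [FInf] bind
   the variable of index 0. *)
Inductive formula (R : realType) (u : bool) : nat -> Type :=
| FNorm n : star_poly R u n -> formula R u n
| FConn n k (f : 'rV[R]_k -> R) :
    continuous f -> ('I_k -> formula R u n) -> formula R u n
| FSup n : formula R u n.+1 -> formula R u n
| FInf n : formula R u n.+1 -> formula R u n.

Definition sentence (R : realType) (u : bool) : Type := formula R u 0.

Section Semantics.
Variables (R : realType) (u : bool) (A : starAlg R).

Fixpoint poly_val n (P : star_poly R u n) (a : 'I_n -> A) : A :=
  match P with
  | PVar i => a i
  | PI _ => cunit A
  | PAdd P Q => poly_val P a + poly_val Q a
  | PScale k P => k *: poly_val P a
  | PMul P Q => poly_val P a ** poly_val Q a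
  | PAdj P => adj (poly_val P a)
  end.

Definition env_cons n (x : A) (a : 'I_n -> A) : 'I_n.+1 -> A :=
  fun i => oapp a x (unlift ord0 i).

Definition unit_ball : set A := [set x | cnorm x <= 1].

Fixpoint formula_val n (phi : formula R u n) : ('I_n -> A) -> R :=
  match phi in formula _ _ n return ('I_n -> A) -> R with
  | FNorm _ P => fun a => cnorm (poly_val P a)
  | FConn _ _ f _ phis => fun a => f (\row_i formula_val (phis i) a)
  | FSup _ phi => fun a => sup [set formula_val phi (env_cons x a) | x in unit_ball]
  | FInf _ phi => fun a => inf [set formula_val phi (env_cons x a) | x in unit_ball]
  end.

Definition sentence_val (phi : sentence R u) : R := formula_val phi (fun=> 0).

End Semantics.

Definition elem_equiv (R : realType) (u : bool) (A B : starAlg R) : Prop :=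
  (u -> unital A /\ unital B) /\
  forall phi : sentence R u, sentence_val A phi = sentence_val B phi.

Definition pseudocompact (R : realType) (u : bool) (A : starAlg R) : Prop :=
  is_cstar A /\
  exists (I : Type) (U : ultrafilter I) (F : I -> cstarAlg R),
    (forall i, finite_dimensional (F i)) /\ elem_equiv u A (ultraproduct U F).

Definition pseudomatricial (R : realType) (u : bool) (A : starAlg R) : Prop :=
  is_cstar A /\
  exists (I : Type) (U : ultrafilter I) (F : I -> cstarAlg R),
    (forall i, is_matrix_algebra (F i)) /\ elem_equiv u A (ultraproduct U F).

(* Main.v *)
From HB Require Import structures.
Require Import Defs.
From mathcomp Require Import all_boot all_order all_algebra complex.
From mathcomp Require Import all_classical all_reals all_analysis.
From mathcomp Require Import ring lra.

(** The two operations T(A, B) = A (+) B and T(A) = M_n(A) are continuous for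
    theories: up to any error, the value of a sentence in T(A) depends only on
    the values of finitely many sentences in A.  This settles the statement.  If
    A is elementarily equivalent to the ultraproduct of the F_i along U, then by
    Los's theorem ([los_sentence]) the value of each sentence in A is the limit
    along U of its values in the F_i ([theory_limit]); continuity gives the same
    for T(A) and the T(F_i), and a second use of Los's theorem says that T(A) is
    elementarily equivalent to the ultraproduct of the T(F_i).  For A (+) B the
    two index sets are merged by an ultrafilter on I x J above the product
    filter.  It remains that T preserves finite-dimensional algebras, and matrix
    algebras in the case of M_n.

    Continuity is proved by a back-and-forth argument ([back_and_forth]).  Its
    engine is [nclose_extend]: if sufficiently many formulas almost agree on a
    tuple of A and on a tuple of B, then each further element of the unit ball of
    A is matched by an element of the unit ball of B so that prescribed formulas
    still almost agree.  Indeed the values of these formulas can be rounded to a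
    finite net, and the existence of an element with given rounded values is the
    smallness of an infimum, which is again a formula.  The formulas in this
    argument come from a small language ([nform]) with named variables and only
    the connectives that the argument needs; its formulas are Lipschitz on unit
    balls and translate into formulas of the given logic.

    For M_n(A) a matrix is matched entry by entry.  The operator norm is
    recovered from norms of *-polynomials in the entries: |M| is within a factor
    n^2 of the largest entry norm, and the C*-identity
    |M|^(2^j) = |(M^* M)^(2^(j-1))| turns this factor into its 2^j-th root, so
    the error is as small as desired ([mx_norm_continuity]).  A matched matrix
    whose norm slightly exceeds 1 is scaled back into the unit ball, at a cost
    that the Lipschitz bounds control ([mx_step]).

    That M_n(A), normed by its action on the Hilbert module A^n, is a C*-algebra
    follows from the Cauchy-Schwarz inequality in A^n.  Instead of developing
    positivity in A, this inequality is carried along: it holds for C, passes to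
    M_k(A) and to direct sums, hence holds in finite-dimensional algebras, and,
    being a statement about norms of *-polynomials, it passes to limits of
    theories ([theory_limit_cauchy_schwarz]). *)

Set Implicit Arguments.
Unset Strict Implicit.
Unset Printing Implicit Defensive.

Import Order.TTheory GRing.Theory Num.Theory.
Import numFieldNormedType.Exports.

Local Open Scope classical_set_scope.
Local Open Scope ring_scope.

(** * Suprema, and continuous functions on boxes *)

Section SupInf.
Variable R : realType.
Implicit Types S T : set R.

Lemma sup_le_shift S T e : S !=set0 -> has_ubound T ->
  (forall s, S s -> exists2 t, T t & s <= t + e) -> sup S <= sup T + e.
Proof.
move=> S0 bT ST; apply: ge_sup => // s /ST[t Tt st].
by apply: le_trans st _; rewrite lerD2r; exact: ub_le_sup.
Qed.

Lemma inf_le_shift S T e : T !=set0 -> has_lbound S ->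
  (forall t, T t -> exists2 s, S s & s <= t + e) -> inf S <= inf T + e.
Proof.
move=> T0 bS TS; rewrite -lerBlDr; apply: lb_le_inf => // t /TS[s Ss st].
by rewrite lerBlDr; apply: le_trans st; exact: ge_inf.
Qed.

Lemma normr_sup_le S M : S !=set0 -> (forall s, S s -> `|s| <= M) ->
  `|sup S| <= M.
Proof.
move=> [s Ss] SM; rewrite ler_norml; apply/andP; split.
  apply: (@le_trans _ _ s); first by have := SM _ Ss; rewrite ler_norml => /andP[].
  by apply: ub_le_sup Ss; exists M => t /SM; rewrite ler_norml => /andP[].
by apply: ge_sup; [exists s|move=> t /SM; rewrite ler_norml => /andP[]].
Qed.

Lemma normr_inf_le S M : S !=set0 -> (forall s, S s -> `|s| <= M) ->
  `|inf S| <= M.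
Proof.
move=> S0 SM; rewrite /inf normrN; apply: normr_sup_le.
  by case: S0 => s Ss; exists (- s), s.
by move=> _ [s Ss <-]; rewrite normrN SM.
Qed.

End SupInf.

Section Boxes.
Variables (R : realType) (k : nat) (f : 'rV[R]_k -> R).
Hypothesis f_cont : continuous f.

Let box (M : R) := [set v : 'rV[R]_k | forall i, `[- M, M]%classic (v ord0 i)].

Let box_compact M : compact (box M).
Proof.
apply: (@rV_compact R k (fun=> `[- M, M]%classic)) => _.
exact: segment_compact.
Qed.

Let boxP M (v : 'rV[R]_k) : (forall i, `|v 0 i| <= M) -> box M v.
Proof. by move=> vM i; rewrite /= in_itv /= -ler_norml. Qed.

Lemma continuous_box_bounded (M : R) :
  exists C : R, forall v : 'rV[R]_k, (forall i, `|v 0 i| <= M) -> `|f v| <= C.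
Proof.
have /compact_near_coveringP cov := box_compact (M := M).
have : \forall C \near +oo, box M `<=` [set v | `|f v| <= C].
  apply: cov => v _.
  have fv := @f_cont v.
  have : \forall w \near v, `|f w| < `|f v| + 1.
    near=> w; rewrite -(subrK (f v) (f w)).
    apply: le_lt_trans (ler_normD _ _) _; rewrite addrC ltrD2l distrC.
    by near: w; move/cvgrPdist_lt: fv; apply.
  move=> fw; exists ([set w | `|f w| < `|f v| + 1], [set C | `|f v| + 1 <= C]).
    by split=> //=; apply: nbhs_pinfty_ge; rewrite num_real.
  by move=> [w C] /= [fwv vC]; apply: le_trans vC; exact: ltW.
move=> [C [_ CP]]; exists (C + 1) => v /boxP vM.
by apply: (CP (C + 1)) => //; rewrite ltrDl.
Unshelve. all: by end_near. Qed.

(** Heine-Cantor on boxes, in the asymmetric form where only [v] has to lie in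
    the box. *)
Lemma continuous_box_unif (M e : R) : 0 < e -> exists2 d : R, 0 < d &
  forall v w : 'rV[R]_k, (forall i, `|v 0 i| <= M) -> (forall i, `|v 0 i - w 0 i| < d) ->
    `|f v - f w| < e.
Proof.
move=> e0.
have /compact_near_coveringP cov := box_compact (M := M).
have : \forall d \near 0^'+, box M `<=`
    [set v : 'rV[R]_k | forall w : 'rV[R]_k, (forall i, `|v 0 i - w 0 i| < d) -> `|f v - f w| < e].
  apply: cov => v _.
  have e2 : 0 < e / 2 by rewrite divr_gt0.
  have /cvgrPdist_lt/(_ _ e2)/nbhs_ballP[r /= r0 rP] := @f_cont v.
  have r2 : 0 < r / 2 by rewrite divr_gt0.
  exists (ball v (r / 2), [set d | d <= r / 2]).
    by split=> /=; [exact: nbhsx_ballx|exact: nbhs_right_le].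
  move=> [v' d] /= [v'v dr] w v'w.
  have vv' : ball v r v'.
    by apply: le_ball v'v; rewrite ler_pdivrMr// ler_peMr ?ler1n// ltW.
  have vw : ball v r w.
    have -> : r = r / 2 + r / 2 by rewrite -splitr.
    apply: ball_triangle v'v _; split=> // i j; rewrite ord1.
    exact: lt_le_trans (v'w j) dr.
  rewrite (splitr e) -(subrKA (f v)); apply: le_lt_trans (ler_normD _ _) _.
  by apply: ltrD; [rewrite distrC|]; exact: rP.
move=> [d /= d0 dP]; exists (d / 2); first by rewrite divr_gt0.
move=> v w /boxP vM; apply: (dP (d / 2)) => //=; last by rewrite divr_gt0.
rewrite /ball_ sub0r normrN ger0_norm; last by rewrite ltW// divr_gt0.
by rewrite ltr_pdivrMr// ltr_pMr ?ltr1n.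
Qed.

End Boxes.

(** * Units, bounds for formulas, invariance under isomorphism *)

Definition in_ball (R : realType) (A : starAlg R) (V : Type) (a : V -> A) :=
  forall v, cnorm (a v) <= 1.

Section Units.
Variables (R : realType) (A : starAlg R).

Lemma identity_uniq (e f : A) : is_identity e -> is_identity f -> e = f.
Proof. by move=> eP fP; rewrite -(fP e).2 (eP f).1. Qed.

Lemma cunitP : unital A -> is_identity (cunit A).
Proof. by move=> uA; exact: xgetPex. Qed.

Lemma cunitE (e : A) : is_identity e -> cunit A = e.
Proof. by move=> eP; apply: identity_uniq => //; apply: cunitP; exists e. Qed.

Hypothesis cA : is_cstar A.

(** The C*-identity makes the norm of a unit idempotent, so it is 0 or 1. *)
Lemma identity_norm_le1 (e : A) : is_identity e -> cnorm e <= 1.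
Proof.
move=> eP; have := cs_normC cA e; rewrite (eP _).2 (cs_norm_adj cA) => /eqP.
have [->|e0] := eqVneq (cnorm e) 0; first by [].
by rewrite expr2 -[X in X == _]mulr1 (inj_eq (mulfI e0)) => /eqP <-.
Qed.

Lemma cunit_norm_le1 : cnorm (cunit A) <= 1.
Proof.
have [uA|nuA] := pselect (unital A); first exact/identity_norm_le1/cunitP.
rewrite /cunit xgetPN ?(cs_norm0 cA)// => e eP.
by apply: nuA; exists e.
Qed.

End Units.

Section PolyBound.
Variables (R : realType) (u : bool).

Fixpoint poly_bound (r : R) n (P : star_poly R u n) : R :=
  match P with
  | PVar _ => r
  | PI _ => 1
  | PAdd P Q => poly_bound r P + poly_bound r Q
  | PScale k P => cmod k * poly_bound r P
  | PMul P Q => poly_bound r P * poly_bound r Q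
  | PAdj P => poly_bound r P
  end.

Lemma poly_val_le (A : starAlg R) (r : R) n (P : star_poly R u n) a :
  is_cstar A -> (forall i, cnorm (a i) <= r) ->
  cnorm (poly_val (A := A) P a) <= poly_bound r P.
Proof.
move=> cA ar; elim: P => //= [_|P IP Q IQ|k P IP|P IP Q IQ|P IP].
- exact: cunit_norm_le1.
- exact: le_trans (cs_normD cA _ _) (lerD IP IQ).
- by rewrite (cs_normZ cA) ler_wpM2l ?cmod_ge0.
- by apply: le_trans (cs_normM cA _ _) _; rewrite ler_pM ?cs_norm_ge0.
- by rewrite (cs_norm_adj cA).
Qed.

End PolyBound.

Section EnvCons.
Variables (R : realType) (A : starAlg R) (n : nat).
Implicit Types (x : A) (a : 'I_n -> A).

Lemma env_cons0 x a : env_cons x a ord0 = x.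
Proof. by rewrite /env_cons unlift_none. Qed.

Lemma env_consS x a i : env_cons x a (lift ord0 i) = a i.
Proof. by rewrite /env_cons liftK. Qed.

Lemma env_cons_ball x a : cnorm x <= 1 -> in_ball a -> in_ball (env_cons x a).
Proof.
by move=> x1 a1 i; case: (unliftP ord0 i) => [j ->|->];
  rewrite ?env_consS ?env_cons0.
Qed.

End EnvCons.

Section FormulaBound.
Variables (R : realType) (u : bool).

Lemma unit_ball_nonempty (A : starAlg R) (g : A -> R) : is_cstar A ->
  [set g x | x in @unit_ball R A] !=set0.
Proof. by move=> cA; exists (g 0), 0; rewrite // /unit_ball /= (cs_norm0 cA). Qed.

(** The bound is uniform in the algebra.  It makes the suprema and infima of the
    semantics genuine, and confines the arguments of a connective to a box on
    which it is uniformly continuous. *)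
Lemma formula_bounded n (phi : formula R u n) : exists M : R,
  forall A : starAlg R, is_cstar A -> forall a : 'I_n -> A, in_ball a ->
  `|formula_val phi a| <= M.
Proof.
elim: phi => {n} [n P|n k f f_cont phis IH|n phi [M IH]|n phi [M IH]].
- exists (poly_bound 1 P) => A cA a a1 /=.
  by rewrite ger0_norm ?cs_norm_ge0// poly_val_le.
- have [M MP] := choice IH.
  pose B := \sum_(i < k) `|M i|.
  have [C CP] := continuous_box_bounded f_cont B.
  exists C => A cA a a1 /=; apply: CP => i; rewrite mxE.
  apply: le_trans (MP i A cA a a1) _; apply: le_trans (ler_norm _) _.
  by rewrite /B (bigD1 i)//= lerDl sumr_ge0.
- exists M => A cA a a1 /=; apply: normr_sup_le; first exact: unit_ball_nonempty.
  by move=> _ [x x1 <-]; apply: IH => //; exact: env_cons_ball.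
- exists M => A cA a a1 /=; apply: normr_inf_le; first exact: unit_ball_nonempty.
  by move=> _ [x x1 <-]; apply: IH => //; exact: env_cons_ball.
Qed.

Lemma formula_ubound n (phi : formula R u n.+1) (A : starAlg R)
    (a : 'I_n -> A) : is_cstar A -> in_ball a ->
  has_ubound [set formula_val phi (env_cons x a) | x in @unit_ball R A].
Proof.
move=> cA a1; have [M MP] := formula_bounded phi.
exists M => _ [x x1 <-]; apply: le_trans (ler_norm _) _.
by apply: MP => //; exact: env_cons_ball.
Qed.

Lemma formula_lbound n (phi : formula R u n.+1) (A : starAlg R)
    (a : 'I_n -> A) : is_cstar A -> in_ball a ->
  has_lbound [set formula_val phi (env_cons x a) | x in @unit_ball R A].
Proof.
move=> cA a1; have [M MP] := formula_bounded phi.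
exists (- M) => _ [x x1 <-]; rewrite lerNl; apply: le_trans (ler_norm _) _.
by rewrite normrN; apply: MP => //; exact: env_cons_ball.
Qed.

End FormulaBound.

Section Isomorphisms.
Variable R : realType.
Implicit Types A B C : starAlg R.

Lemma star_iso_refl A : star_iso A A.
Proof. by exists id; split=> //; exists id. Qed.

Lemma star_iso_sym A B : star_iso A B -> star_iso B A.
Proof.
move=> [f [[g fK gK] fL fM fA fN]]; exists g; split.
- by exists f.
- by move=> k a b; rewrite -{1}(gK a) -{1}(gK b) -fL fK.
- by move=> a b; rewrite -{1}(gK a) -{1}(gK b) -fM fK.
- by move=> a; rewrite -{1}(gK a) -fA fK.
- by move=> a; rewrite -{2}(gK a) fN.
Qed.

Lemma star_iso_trans A B C : star_iso A B -> star_iso B C -> star_iso A C.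
Proof.
move=> [f [fB fL fM fA fN]] [g [gB gL gM gA gN]]; exists (g \o f); split=> /=.
- exact: bij_comp.
- by move=> k a b; rewrite fL gL.
- by move=> a b; rewrite fM gM.
- by move=> a; rewrite fA gA.
- by move=> a; rewrite gN fN.
Qed.

Section Transport.
Variables (A B : starAlg R) (f : A -> B).
Hypothesis fL : forall (k : R[i]) (a b : A), f (k *: a + b) = k *: f a + f b.

Lemma lin_D a b : f (a + b) = f a + f b.
Proof. by have := fL 1 a b; rewrite !scale1r. Qed.

Lemma lin_0 : f 0 = 0.
Proof. by apply: (addIr (f 0)); rewrite -lin_D !add0r. Qed.

Lemma lin_Z k a : f (k *: a) = k *: f a.
Proof. by have := fL k a 0; rewrite !addr0 lin_0 addr0. Qed.

Lemma lin_B a b : f (a - b) = f a - f b.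
Proof. by rewrite lin_D -scaleN1r lin_Z scaleN1r. Qed.

Lemma lin_sum (I : Type) (r : seq I) (P : pred I) (F : I -> A) :
  f (\sum_(i <- r | P i) F i) = \sum_(i <- r | P i) f (F i).
Proof. exact: (big_morph f lin_D lin_0). Qed.

End Transport.

Lemma star_iso_unital A B : star_iso A B -> unital A -> unital B.
Proof.
move=> [f [[g fK gK] _ fM _ _]] [e eP]; exists (f e) => b.
by rewrite -(gK b) -!fM (eP _).1 (eP _).2.
Qed.

Lemma star_iso_cstar A B : star_iso A B -> is_cstar A -> is_cstar B.
Proof.
move=> /star_iso_sym[f [[g fK gK] fL fM fA fN]] cA.
have fD := lin_D fL; have fZ := lin_Z fL; have fB := lin_B fL.
have fI := can_inj fK.
split.
- by move=> a b c; apply: fI; rewrite !fM (cs_mulA cA).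
- by move=> a b c; apply: fI; rewrite !(fM, fD) (cs_mulDl cA).
- by move=> a b c; apply: fI; rewrite !(fM, fD) (cs_mulDr cA).
- by move=> k a b; apply: fI; rewrite !(fM, fZ) (cs_scaleAl cA).
- by move=> k a b; apply: fI; rewrite !(fM, fZ) (cs_scaleAr cA).
- by move=> a; apply: fI; rewrite !fA (cs_adjK cA).
- by move=> a b; apply: fI; rewrite !(fA, fD) (cs_adjD cA).
- by move=> k a; apply: fI; rewrite !(fA, fZ) (cs_adjZ cA).
- by move=> a b; apply: fI; rewrite !(fA, fM) (cs_adjM cA).
- by move=> a; rewrite -fN => /(cs_norm0_eq0 cA) fa; apply: fI; rewrite fa lin_0.
- by move=> k a; rewrite -!fN fZ (cs_normZ cA).
- by move=> a b; rewrite -!fN fD (cs_normD cA).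
- by move=> a b; rewrite -!fN fM (cs_normM cA).
- by move=> a; rewrite -!fN fM fA (cs_normC cA).
- move=> v cv; have [|l lP] := cs_complete cA (u := f \o v).
    move=> e /cv[N NP]; exists N => m n Nm Nn /=.
    by rewrite -fB fN NP.
  exists (g l); move: lP; rewrite (_ : (fun n => _) = fun n => cnorm (v n - g l))//.
  by apply/funext => n /=; rewrite -[in RHS]fN fB gK.
Qed.

(** Both sides are 0 when there is no unit. *)
Lemma iso_cunit A B (f : A -> B) : bijective f -> f 0 = 0 ->
  (forall a b, f (a ** b) = f a ** f b) -> f (cunit A) = cunit B.
Proof.
move=> [g fK gK] f0 fM.
have fI e : is_identity e -> is_identity (f e).
  by move=> eP b; rewrite -(gK b) -!fM (eP _).1 (eP _).2.
have [uA|nuA] := pselect (unital A); first exact/esym/cunitE/fI/cunitP.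
rewrite /cunit !xgetPN// => e eP; apply: nuA; last by exists e.
exists (g e) => a; split; apply: (can_inj fK); rewrite fM gK.
  exact: (eP _).1.
exact: (eP _).2.
Qed.

Lemma star_iso_sentence A B u (phi : sentence R u) : star_iso A B ->
  sentence_val A phi = sentence_val B phi.
Proof.
move=> [f [fB fL fM fA fN]].
have [g fK gK] := fB.
have fpoly n (P : star_poly R u n) (a : 'I_n -> A) :
    f (poly_val P a) = poly_val P (f \o a).
  elim: P => //= [_|P IP Q IQ|k P IP|P IP Q IQ|P IP].
  - exact: iso_cunit (lin_0 fL) _.
  - by rewrite (lin_D fL) IP IQ.
  - by rewrite (lin_Z fL) IP.
  - by rewrite fM IP IQ.
  - by rewrite fA IP.
have fcons n x (a : 'I_n -> A) : f \o env_cons x a = env_cons (f x) (f \o a).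
  apply/funext => i /=; case: (unliftP ord0 i) => [j ->|->].
    by rewrite !env_consS.
  by rewrite !env_cons0.
have fset (n : nat) (G : ('I_n.+1 -> B) -> R) (a : 'I_n -> A) :
    [set G (f \o env_cons x a) | x in @unit_ball R A] =
    [set G (env_cons x (f \o a)) | x in @unit_ball R B].
  apply/seteqP; split=> _ [x x1 <-].
    by exists (f x); rewrite /unit_ball /= ?fN// fcons.
  by exists (g x); rewrite /unit_ball /= -?fN ?gK// fcons gK.
suff main n (psi : formula R u n) (a : 'I_n -> A) :
    formula_val psi a = formula_val psi (f \o a).
  rewrite /sentence_val main; congr formula_val.
  by apply/funext => i /=; rewrite (lin_0 fL).
elim: psi a => {n} [n P|n k h h_cont phis IH|n psi IH|n psi IH] a /=.
- by rewrite -fpoly fN.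
- by congr h; apply/rowP => i; rewrite !mxE IH.
- rewrite -fset; congr sup.
  by apply/seteqP; split=> _ [x x1 <-]; exists x; rewrite // IH.
- rewrite -fset; congr inf.
  by apply/seteqP; split=> _ [x x1 <-]; exists x; rewrite // IH.
Qed.

End Isomorphisms.

(** * Los's theorem *)

Lemma fam_choice (I : Type) (T : I -> Type) (Q : forall i, T i -> Prop) :
  (forall i, exists x, Q i x) -> exists f : forall i, T i, forall i, Q i (f i).
Proof. by move=> QE; exists (fun i => sval (cid (QE i))) => i; exact: svalP. Qed.

Section RealScalars.
Variable R : realType.

Lemma cmod_real (r : R) : cmod (r%:C)%C = `|r|.
Proof. by rewrite /cmod normc_def /= expr0n /= addr0 sqrtr_sqr. Qed.

Variables (A : starAlg R) (cA : is_cstar A).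

Lemma cs_norm_realZ (r : R) (a : A) : 0 <= r ->
  cnorm ((r%:C)%C *: a) = r * cnorm a.
Proof. by move=> r0; rewrite (cs_normZ cA) cmod_real ger0_norm. Qed.

(** Scaling y down to norm 1 moves it by the excess of its norm only. *)
Lemma shrink_to_ball (y : A) : exists2 x : A, cnorm x <= 1 &
  forall e, 0 <= e -> cnorm y <= 1 + e -> cnorm (y - x) <= e.
Proof.
have [y1|y1] := leP (cnorm y) 1.
  by exists y => // e e0 _; rewrite subrr (cs_norm0 cA).
have y0 : 0 < cnorm y by apply: lt_trans y1.
have yV1 : (cnorm y)^-1 <= 1 by rewrite invf_le1 // ltW.
exists ((((cnorm y)^-1)%:C)%C *: y).
  by rewrite cs_norm_realZ ?invr_ge0 ?(ltW y0)// mulVf ?gt_eqF.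
move=> e e0 ye; rewrite -{1}(scale1r y) -scalerBl.
rewrite (_ : 1 - _ = ((1 - (cnorm y)^-1)%:C)%C); last by rewrite rmorphB.
rewrite cs_norm_realZ ?subr_ge0// mulrBl mul1r mulVf ?gt_eqF//.
by rewrite lerBlDl.
Qed.

End RealScalars.

Section Los.
Variables (R : realType) (u : bool) (I : Type) (U : ultrafilter I).
Variable F : I -> cstarAlg R.
Hypothesis uF : u -> forall i, unital (F i).

Let cF i : is_cstar (F i) := cstarAlgP (F i).
Let P : cstarAlg R := ultraproduct U F.
Let cl (x : bfam F) : P := up_class U x.

Lemma bfam_of (r : R) (x : forall i, F i) : (forall i, cnorm (x i) <= r) ->
  exists y : bfam F, forall i, y i = x i.
Proof.
move=> xr; have xb : (x : fam (fun i => F i : starAlg R)) \in @bounded R I F.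
  by apply/boundedP; exists r.
by exists (BFam xb).
Qed.

Lemma bfam_unit : exists y : bfam F, forall i, y i = cunit (F i).
Proof.
have [i|y yE] := @bfam_of 1 (fun i => cunit (F i)); last by exists y.
exact: cunit_norm_le1.
Qed.

Lemma bfam_ext (x y : bfam F) : (forall i, x i = y i) -> x = y.
Proof. by move=> xy; apply/val_inj/functional_extensionality_dep. Qed.

Lemma up_identity (y : bfam F) :
  (forall i, is_identity (y i)) -> is_identity (cl y).
Proof.
move=> yP p; rewrite -(up_repK p) /cl.
split; [rewrite (@up_mulE _ _ U F)|rewrite (@up_mulE _ _ U F)];
  by congr up_class; apply: bfam_ext => i; [exact: (yP i _).1 + exact: (yP i _).2].
Qed.

Lemma ultraproduct_unital : (forall i, unital (F i)) -> unital P.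
Proof.
move=> uFi; have [y yE] := bfam_unit.
by exists (cl y); apply: up_identity => i; rewrite yE; exact: cunitP.
Qed.

Lemma poly_val_up n (Q : star_poly R u n) (a : 'I_n -> bfam F) :
  exists2 y : bfam F, poly_val Q (fun j => cl (a j)) = cl y &
    forall i, y i = poly_val Q (fun j => a j i).
Proof.
elim: Q => [j|hu|Q1 [y1 e1 v1] Q2 [y2 e2 v2]|k Q1 [y1 e1 v1]|
            Q1 [y1 e1 v1] Q2 [y2 e2 v2]|Q1 [y1 e1 v1]] /=.
- by exists (a j).
- have [y yE] := bfam_unit; exists y => //.
  apply: (@cunitE _ P); apply: up_identity => i; rewrite yE; exact/cunitP/uF.
- by exists (y1 + y2) => [|i]; rewrite ?e1 ?e2 ?bfamD ?v1 ?v2 // -up_classD.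
- by exists (k *: y1) => [|i]; rewrite ?e1 ?bfamZ ?v1 // /cl up_classZ.
- exists (bmul y1 y2) => [|i]; first by rewrite e1 e2 [LHS](@up_mulE _ _ U F).
  by rewrite -v1 -v2.
- exists (badj y1) => [|i]; first by rewrite e1 [LHS](@up_adjE _ _ U F).
  by rewrite -v1.
Qed.

(** An element of norm at most 1 has representatives whose norms are only at
    most 1 in the limit; scaling them down coordinatewise changes them by a
    null family. *)
Lemma up_ball_lift (p : P) : cnorm p <= 1 ->
  exists2 x : bfam F, p = cl x & forall i, cnorm (x i) <= 1.
Proof.
move=> p1; pose y := up_rep p.
have /fam_choice[x xP] : forall i, exists x : F i, cnorm x <= 1 /\
    forall e, 0 <= e -> cnorm (y i) <= 1 + e -> cnorm (y i - x) <= e.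
  by move=> i; have [x x1 xP] := shrink_to_ball (cF i) (y i); exists x.
have x1 i := (xP i).1; have xy i := (xP i).2.
have [X XE] := bfam_of x1.
exists X => [|i]; last by rewrite XE.
rewrite -(up_repK p); apply/up_classP.
have yc := @up_norm_cvg _ _ U F y; rewrite up_repK in yc.
apply: (@null_squeeze _ _ U F _ (fun i => `|cnorm (y i) - cnorm p|)).
  move=> i; rewrite bfamD bfamN XE; apply: xy => //.
  rewrite -lerBlDl; apply: le_trans (ler_norm _).
  by rewrite lerD2l lerN2.
apply/norm_cvg0P.
by rewrite -(subrr (cnorm p)); apply: cvgB => //; exact: cvg_cst.
Qed.

Let env n (a : 'I_n -> bfam F) i : 'I_n -> F i := fun j => a j i.

Let env_cons_up n (x : bfam F) (a : 'I_n -> bfam F) :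
  env_cons (cl x) (fun j => cl (a j)) =
  (fun j => cl (oapp a x (unlift ord0 j))).
Proof. by apply/funext => j; rewrite /env_cons; case: unlift. Qed.

Let env_cons_env n (x : bfam F) (a : 'I_n -> bfam F) i :
  env (fun j => oapp a x (unlift ord0 j)) i = env_cons (x i) (env a i).
Proof. by apply/funext => j; rewrite /env /env_cons; case: unlift. Qed.

Let bcons_ball n (x : bfam F) (a : 'I_n -> bfam F) :
  (forall i, cnorm (x i) <= 1) -> (forall i, in_ball (env a i)) ->
  forall i, in_ball (env (fun j => oapp a x (unlift ord0 j)) i).
Proof. by move=> x1 a1 i; rewrite env_cons_env; apply: env_cons_ball. Qed.

Let bcls (x : bfam F) : (forall i, cnorm (x i) <= 1) -> cnorm (cl x) <= 1.
Proof. exact: (@up_norm_le _ _ U F). Qed.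

(** Otherwise choose, for almost all i, an x in the ball of F_i that no p
    approximates: the class of this family does approximate it for almost all i,
    by the hypothesis on phi. *)
Let los_forth n (phi : formula R u n.+1) (a : 'I_n -> bfam F) (e : R) :
  (forall b, (forall i, in_ball (env b i)) ->
    (fun i => formula_val phi (env b i)) @ uf_sets U -->
    formula_val phi (fun j => cl (b j))) ->
  (forall i, in_ball (env a i)) -> 0 < e ->
  uf_sets U [set i |
    forall x : F i, cnorm x <= 1 -> exists2 p : P, cnorm p <= 1 &
    `|formula_val phi (env_cons p (fun j => cl (a j))) -
      formula_val phi (env_cons x (env a i))| <= e].
Proof.
move=> IH a1 e0; set G := [set i | _].
have [//|nG] := @in_ultra_setVsetC _ (uf_sets U) G (uf_ultra U); exfalso.
have /fam_choice[x xP] : forall i, exists x : F i, cnorm x <= 1 /\ (~ G i ->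
    forall p : P, cnorm p <= 1 ->
    e < `|formula_val phi (env_cons p (fun j => cl (a j))) -
      formula_val phi (env_cons x (env a i))|).
  move=> i; have [Gi|nGi] := pselect (G i).
    by exists 0; split; [rewrite (cs_norm0 (cF i))|].
  move/existsNP: nGi => [x /not_implyP[x1 xP]]; exists x; split=> // _ p p1.
  by rewrite ltNge; apply/negP => pe; apply: xP; exists p.
have x1 i : cnorm (x i) <= 1 by case: (xP i).
have [X XE] := bfam_of x1.
have X1 i : cnorm (X i) <= 1 by rewrite XE.
have /cvgrPdist_le/(_ _ e0) := IH _ (bcons_ball X1 a1).
rewrite -env_cons_up => near_e.
have [i [nGi]] := filter_ex (filterI nG near_e).
rewrite env_cons_env XE; apply/negP; rewrite -ltNge.
by case: (xP i) => _; apply=> //; exact: bcls.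
Qed.

(** Parameters are restricted to the unit ball, where the values of a formula
    are bounded, hence have limits along U.  In the case of a supremum, one
    inequality is [los_forth] and the other follows by lifting a single element
    that almost attains the supremum in the ultraproduct. *)
Theorem los n (phi : formula R u n) (a : 'I_n -> bfam F) :
  (forall i, in_ball (env a i)) ->
  (fun i => formula_val phi (env a i)) @ uf_sets U -->
  formula_val phi (fun j => cl (a j)).
Proof.
have cP : is_cstar P := cstarAlgP P.
elim: phi a => {n} [n Q|n k f f_cont phis IH|n phi IH|n phi IH] a a1 /=.
- have [y -> yE] := poly_val_up Q a; have := @up_norm_cvg _ _ U F y.
  by under eq_fun do rewrite yE.
- suff : (fun i => \row_j formula_val (phis j) (env a i)) @ uf_sets U -->
      (\row_j formula_val (phis j) (fun l => cl (a l)) : 'rV[R]_k).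
    by move=> rc; exact: cvg_comp rc (f_cont _).
  apply/cvg_ballP => e e0.
  have : \forall i \near uf_sets U, forall j : 'I_k,
      ball (formula_val (phis j) (fun l => cl (a l))) e
           (formula_val (phis j) (env a i)).
    apply: filter_forall => j; have /cvg_ballP := IH j a a1; exact.
  by apply: filterS => i iP; split=> // ? j; rewrite !mxE.
all: have ca1 : in_ball (fun j => cl (a j)) by move=> j; apply: bcls => i; exact: a1.
- apply/cvgrPdist_le => e e0; have e2 : 0 < e / 2 by rewrite divr_gt0.
  have [s0 s1] : has_sup [set formula_val phi (env_cons p (fun j => cl (a j)))
      | p in @unit_ball R P].
    by split; [exact: unit_ball_nonempty|exact: formula_ubound].
  have [_ [p p1 <-] pP] := sup_adherent e2 (conj s0 s1).
  have [x px x1] := up_ball_lift p1.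
  have /cvgrPdist_le/(_ _ e2) := IH _ (bcons_ball x1 a1).
  rewrite -env_cons_up -px => near_p.
  have near_f := los_forth IH a1 e0; apply: filterS2 near_p near_f => i xi fi.
  rewrite env_cons_env in xi; rewrite ler_distl; apply/andP; split.
    rewrite lerBlDr; apply: sup_le_shift => //; first exact: unit_ball_nonempty.
    move=> _ [z z1 <-]; have [q q1 qz] := fi z z1.
    eexists; first by exists q.
    by move: qz; rewrite ler_distl => /andP[] *; lra.
  rewrite -lerBlDr; apply: (@le_trans _ _ (formula_val phi (env_cons (x i) (env a i)))).
    move: xi; rewrite ler_distl => /andP[_ xi]; lra.
  by apply: ub_le_sup; [exact: formula_ubound|exists (x i) => //; exact: x1].
- apply/cvgrPdist_le => e e0; have e2 : 0 < e / 2 by rewrite divr_gt0.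
  have [s0 s1] : has_inf [set formula_val phi (env_cons p (fun j => cl (a j)))
      | p in @unit_ball R P].
    by split; [exact: unit_ball_nonempty|exact: formula_lbound].
  have [_ [p p1 <-] pP] := inf_adherent e2 (conj s0 s1).
  have [x px x1] := up_ball_lift p1.
  have /cvgrPdist_le/(_ _ e2) := IH _ (bcons_ball x1 a1).
  rewrite -env_cons_up -px => near_p.
  have near_f := los_forth IH a1 e0; apply: filterS2 near_p near_f => i xi fi.
  rewrite env_cons_env in xi; rewrite ler_distl; apply/andP; split.
    rewrite lerBlDr; apply: (@le_trans _ _ (formula_val phi (env_cons (x i) (env a i)))).
      by apply: ge_inf; [exact: formula_lbound|exists (x i) => //; exact: x1].
    move: xi; rewrite ler_distl => /andP[xi _]; lra.
  apply: inf_le_shift => //; first exact: unit_ball_nonempty.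
  move=> _ [z z1 <-]; have [q q1 qz] := fi z z1.
  eexists; first by exists q.
  by move: qz; rewrite ler_distl => /andP[].
Qed.

Corollary los_sentence (phi : sentence R u) :
  (fun i => sentence_val (F i) phi) @ uf_sets U --> sentence_val P phi.
Proof.
have := @los 0 phi (fun=> 0) (fun i j => _).
rewrite /sentence_val; have -> : (fun j : 'I_0 => cl 0) = (fun=> 0).
  by apply/funext => -[].
have -> : (fun i => formula_val phi (env (fun _ : 'I_0 => 0) i)) =
          (fun i => formula_val phi (fun _ : 'I_0 => 0 : F i)).
  by apply/funext => i; congr formula_val; apply/funext => -[].
by apply=> i [].
Qed.

End Los.

(** * Back and forth *)

(** A point of T(k)^m is read off from an environment; the relations [rel j] say
    that two environments look alike to a certain extent.  Environments carry
    more information than the tuples that are read off: the entries of matrices,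
    or the components in a direct sum. *)
Section BackAndForth.
Variables (R : realType) (u : bool) (K : Type) (T : K -> starAlg R).
Hypothesis cT : forall k, is_cstar (T k).
Variables (Env : K -> Type) (ok : nat -> forall k, Env k -> Prop).
Variable read : forall m k, Env k -> 'I_m -> T k.
Hypothesis read_ball : forall m k (a : Env k), ok m a -> in_ball (@read m k a).
Variables (J : Type) (j0 : J) (rel : J -> forall k k', Env k -> Env k' -> Prop).
Hypothesis rel_sym : forall j k k' (a : Env k) (a' : Env k'),
  rel j a a' -> rel j a' a.
Hypothesis rel_meet : forall i j, exists l, forall k k' (a : Env k) (a' : Env k'),
  rel l a a' -> rel i a a' /\ rel j a a'.
Hypothesis rel_poly : forall m (P : star_poly R u m) (e : R), 0 < e ->
  exists j, forall k k' (a : Env k) (a' : Env k'), ok m a -> ok m a' ->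
  rel j a a' -> `|cnorm (poly_val P (read a)) - cnorm (poly_val P (read a'))| < e.
Hypothesis rel_step : forall m j, exists i, forall k k' (a : Env k) (a' : Env k'),
  ok m a -> ok m a' -> rel i a a' -> forall x : T k, cnorm x <= 1 ->
  exists (y : T k') (b : Env k) (b' : Env k'),
  [/\ cnorm y <= 1, ok m.+1 b /\ ok m.+1 b', read b = env_cons x (@read m k a),
      read b' = env_cons y (@read m k' a') & rel j b b'].

(** A connective has finitely many arguments, so one relation serves them
    all. *)
Let rel_forall p (Q : 'I_p -> J -> Prop) : (forall i, exists j, Q i j) ->
  (forall i j l, Q i j -> (forall k k' (a : Env k) (a' : Env k'),
     rel l a a' -> rel j a a') -> Q i l) ->
  exists j, forall i, Q i j.
Proof.
move=> QE Qmono.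
have [j jP] := choice QE.
suff [l lP] : exists l, forall i, i \in enum 'I_p ->
    forall k k' (a : Env k) (a' : Env k'), rel l a a' -> rel (j i) a a'.
  by exists l => i; apply: Qmono (jP i) _; apply: lP; rewrite mem_enum.
elim: (enum 'I_p) => [|i s [l lP]]; first by exists j0.
have [l' l'P] := rel_meet (j i) l; exists l' => i'.
rewrite inE => /orP[/eqP->|si'] k k' a a' /l'P[]//.
by move=> _; exact: lP.
Qed.

(** Uniform continuity, with respect to the relations, of the value of every
    formula.  At a quantifier, [rel_step] matches the elements of the two balls,
    so the two suprema (or infima) run over sets of almost equal values. *)
Theorem back_and_forth m (phi : formula R u m) (e : R) : 0 < e ->
  exists j, forall k k' (a : Env k) (a' : Env k'), ok m a -> ok m a' ->
  rel j a a' -> `|formula_val phi (read a) - formula_val phi (read a')| < e.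
Proof.
elim: phi e => {m} [m P|m p f f_cont phis IH|m phi IH|m phi IH] e e0.
- exact: rel_poly.
- have [M MP] := choice (fun i => formula_bounded (phis i)).
  have [d d0 dP] := continuous_box_unif f_cont (\sum_(i < p) `|M i|) e0.
  have [i j l jP lj|j jP] := rel_forall (fun i => IH i d d0).
    by move=> k k' a a' oa oa' /lj; exact: jP.
  exists j => k k' a a' oa oa' aa' /=.
  apply: dP => i; rewrite !mxE; last exact: jP.
  apply: le_trans (MP i _ (cT _) _ (read_ball oa)) _; apply: le_trans (ler_norm _) _.
  by rewrite (bigD1 i)//= lerDl sumr_ge0.
all: have e2 : 0 < e / 2 by rewrite divr_gt0.
all: have [j jP] := IH _ e2; have [i iP] := rel_step m j.
all: have near_step k k' (a : Env k) (a' : Env k') : ok m a -> ok m a' ->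
    rel i a a' -> forall x : T k, cnorm x <= 1 -> exists2 y : T k', cnorm y <= 1 &
    `|formula_val phi (env_cons x (read a)) -
      formula_val phi (env_cons y (read a'))| <= e / 2.
- move=> oa oa' aa' x x1.
  have [y [b [b' [y1 [ob ob'] bx b'y bb']]]] := iP k k' a a' oa oa' aa' x x1.
  by exists y => //; rewrite -bx -b'y; apply/ltW/jP.
- exists i => k k' a a' oa oa' aa' /=.
  apply: (@le_lt_trans _ _ (e / 2)); last by rewrite ltr_pdivrMr// ltr_pMr ?ltr1n.
  have := near_step _ _ _ _ oa' oa (rel_sym aa').
  have := near_step _ _ _ _ oa oa' aa' => st ts.
  rewrite ler_distl; apply/andP; split; rewrite ?lerBlDr;
    apply: sup_le_shift; try exact: unit_ball_nonempty (cT _);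
    try exact: formula_ubound (cT _) (read_ball _).
  + move=> _ [y y1 <-]; have [x x1] := ts y y1.
    by rewrite ler_distl => /andP[_ xy]; eexists; first by exists x.
  + move=> _ [x x1 <-]; have [y y1] := st x x1.
    by rewrite ler_distl => /andP[_ xy]; eexists; first by exists y.
- move=> oa oa' aa' x x1.
  have [y [b [b' [y1 [ob ob'] bx b'y bb']]]] := iP k k' a a' oa oa' aa' x x1.
  by exists y => //; rewrite -bx -b'y; apply/ltW/jP.
- exists i => k k' a a' oa oa' aa' /=.
  apply: (@le_lt_trans _ _ (e / 2)); last by rewrite ltr_pdivrMr// ltr_pMr ?ltr1n.
  have := near_step _ _ _ _ oa' oa (rel_sym aa').
  have := near_step _ _ _ _ oa oa' aa' => st ts.
  rewrite ler_distl; apply/andP; split; rewrite ?lerBlDr;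
    apply: inf_le_shift; try exact: unit_ball_nonempty (cT _);
    try exact: formula_lbound (cT _) (read_ball _).
  + move=> _ [x x1 <-]; have [y y1] := st x x1.
    rewrite ler_distl => /andP[xy _]; eexists; first by exists y.
    by rewrite -lerBlDr.
  + move=> _ [y y1 <-]; have [x x1] := ts y y1.
    rewrite ler_distl => /andP[xy _]; eexists; first by exists x.
    by rewrite -lerBlDr.
Qed.

End BackAndForth.

(** * Formulas with named variables *)

Definition upd (V : eqType) (T : Type) (a : V -> T) (v : V) (x : T) : V -> T :=
  fun w => if w == v then x else a w.

Section Language.
Variables (R : realType) (u : bool) (V : eqType).

(** *-polynomials with named variables and a zero; the zero makes entries of
    matrix products and of the identity matrix expressible without any
    variable. *)
Inductive npol : Type :=
| NVar of V
| NZero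
| NUnit of u
| NAdd of npol & npol
| NScale of R[i] & npol
| NMul of npol & npol
| NAdj of npol.

(** [NInf v psi] binds the variable v, so that environments are updated and never
    renumbered.  [NDist] and [NMax] are what is needed to express that finitely
    many formulas are close to given values. *)
Inductive nform : Type :=
| NNorm of npol
| NDist of nform & R
| NMax of nform & nform
| NInf of V & nform.

Section Semantics.
Variable A : starAlg R.

Fixpoint npval (P : npol) (a : V -> A) : A :=
  match P with
  | NVar v => a v
  | NZero => 0
  | NUnit _ => cunit A
  | NAdd P Q => npval P a + npval Q a
  | NScale k P => k *: npval P a
  | NMul P Q => npval P a ** npval Q a
  | NAdj P => adj (npval P a)
  end.

Fixpoint nval (psi : nform) (a : V -> A) : R :=
  match psi with
  | NNorm P => cnorm (npval P a)
  | NDist psi q => `|nval psi a - q|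
  | NMax psi1 psi2 => Num.max (nval psi1 a) (nval psi2 a)
  | NInf v psi => inf [set nval psi (upd a v x) | x in @unit_ball R A]
  end.

End Semantics.

Lemma upd_ball (A : starAlg R) (a : V -> A) v x :
  in_ball a -> cnorm x <= 1 -> in_ball (upd a v x).
Proof. by move=> a1 x1 w; rewrite /upd; case: eqP. Qed.

Lemma npval_bounded (P : npol) : exists2 B : R, 0 <= B &
  forall A : starAlg R, is_cstar A -> forall a : V -> A, in_ball a ->
  cnorm (npval P a) <= B.
Proof.
elim: P => [v||hu|P [B B0 BP] Q [C C0 CQ]|k P [B B0 BP]|P [B B0 BP] Q [C C0 CQ]|P [B B0 BP]].
- by exists 1 => // A cA a; exact.
- by exists 0 => // A cA a _; rewrite (cs_norm0 cA).
- by exists 1 => // A cA a _; exact: cunit_norm_le1.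
- exists (B + C); first by rewrite addr_ge0.
  by move=> A cA a a1; apply: le_trans (cs_normD cA _ _) _; rewrite lerD ?BP ?CQ.
- exists (cmod k * B); first by rewrite mulr_ge0 ?cmod_ge0.
  by move=> A cA a a1; rewrite /= (cs_normZ cA) ler_wpM2l ?cmod_ge0 ?BP.
- exists (B * C); first by rewrite mulr_ge0.
  move=> A cA a a1; apply: le_trans (cs_normM cA _ _) _.
  by rewrite ler_pM ?cs_norm_ge0 ?BP ?CQ.
- by exists B => // A cA a a1; rewrite /= (cs_norm_adj cA) BP.
Qed.

Lemma nval_bounded (psi : nform) : exists B : R,
  forall A : starAlg R, is_cstar A -> forall a : V -> A, in_ball a ->
  0 <= nval psi a <= B.
Proof.
elim: psi => [P|psi [B BP] q|psi [B BP] chi [C CP]|v psi [B BP]].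
- have [B _ BP] := npval_bounded P; exists B => A cA a a1.
  by rewrite /= cs_norm_ge0 ?BP.
- exists (B + `|q|) => A cA a a1; rewrite /= normr_ge0 /=.
  have /andP[psi0 psiB] := BP A cA a a1.
  by apply: le_trans (ler_normB _ _) _; rewrite lerD2r ger0_norm.
- exists (Num.max B C) => A cA a a1 /=.
  have /andP[psi0 psiB] := BP A cA a a1; have /andP[_ chiC] := CP A cA a a1.
  by rewrite le_max psi0 /= ge_max !le_max psiB chiC orbT.
- exists B => A cA a a1 /=; apply/andP; split.
    apply: lb_le_inf; first exact: unit_ball_nonempty.
    by move=> _ [x x1 <-]; have /andP[] := BP A cA _ (upd_ball v a1 x1).
  have x1 : cnorm (0 : A) <= 1 by rewrite (cs_norm0 cA).
  apply: (@le_trans _ _ (nval psi (upd a v 0))); last first.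
    by have /andP[] := BP A cA _ (upd_ball v a1 x1).
  apply: ge_inf; last by exists 0.
  by exists 0 => _ [x h <-]; have /andP[] := BP A cA (upd a v x) (upd_ball v a1 h).
Qed.

Lemma nval_lbound (psi : nform) (A : starAlg R) (a : V -> A) v :
  is_cstar A -> in_ball a ->
  has_lbound [set nval psi (upd a v x) | x in @unit_ball R A].
Proof.
move=> cA a1; have [B BP] := nval_bounded psi.
by exists 0 => _ [x h <-]; have /andP[] := BP A cA (upd a v x) (upd_ball v a1 h).
Qed.

Lemma npval_lipschitz (P : npol) : exists2 L : R, 0 <= L &
  forall A : starAlg R, is_cstar A -> forall (a b : V -> A) (e : R),
  in_ball a -> in_ball b -> 0 <= e -> (forall v, cnorm (a v - b v) <= e) ->
  cnorm (npval P a - npval P b) <= L * e.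
Proof.
elim: P => [v||hu|P [B B0 BP] Q [C C0 CQ]|k P [B B0 BP]|P [B B0 BP] Q [C C0 CQ]|P [B B0 BP]].
- by exists 1 => // A cA a b e _ _ _ ab; rewrite mul1r; exact: ab.
- by exists 0 => // A cA a b e _ _ _ _; rewrite mul0r /= subrr (cs_norm0 cA).
- by exists 0 => // A cA a b e _ _ _ _; rewrite mul0r /= subrr (cs_norm0 cA).
- exists (B + C); first by rewrite addr_ge0.
  move=> A cA a b e a1 b1 e0 ab /=; rewrite opprD addrACA mulrDl.
  by apply: le_trans (cs_normD cA _ _) _; rewrite lerD ?BP ?CQ.
- exists (cmod k * B); first by rewrite mulr_ge0 ?cmod_ge0.
  move=> A cA a b e a1 b1 e0 ab /=.
  by rewrite -scalerBr (cs_normZ cA) -mulrA ler_wpM2l ?cmod_ge0 ?BP.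
- have [M M0 MP] := npval_bounded P; have [N N0 NQ] := npval_bounded Q.
  exists (M * C + B * N); first by rewrite addr_ge0 ?mulr_ge0.
  move=> A cA a b e a1 b1 e0 ab /=.
  have -> : npval P a ** npval Q a - npval P b ** npval Q b =
      npval P a ** (npval Q a - npval Q b) + (npval P a - npval P b) ** npval Q b.
    rewrite (cs_mulDr cA) (cs_mulDl cA) -(scaleN1r (npval Q b)).
    by rewrite -(scaleN1r (npval P b)) (cs_scaleAr cA) (cs_scaleAl cA) !scaleN1r addrA subrK.
  apply: le_trans (cs_normD cA _ _) _; rewrite mulrDl; apply: lerD.
    apply: le_trans (cs_normM cA _ _) _; rewrite -mulrA.
    by rewrite ler_pM ?cs_norm_ge0 ?MP ?CQ.
  apply: le_trans (cs_normM cA _ _) _; rewrite mulrAC.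
  by rewrite ler_pM ?cs_norm_ge0 ?NQ ?BP.
- exists B => // A cA a b e a1 b1 e0 ab /=.
  have -> : adj (npval P a) - adj (npval P b) = adj (npval P a - npval P b).
    by rewrite (cs_adjD cA) -(scaleN1r (npval P b)) (cs_adjZ cA) rmorphN1 scaleN1r.
  by rewrite (cs_norm_adj cA) BP.
Qed.

Lemma cs_norm_dist (A : starAlg R) (a b : A) : is_cstar A ->
  `|cnorm a - cnorm b| <= cnorm (a - b).
Proof.
move=> cA; have le (x y : A) : cnorm x - cnorm y <= cnorm (x - y).
  by rewrite lerBlDr; apply: le_trans (cs_normD cA _ _); rewrite subrK.
rewrite ler_norml; apply/andP; split=> //.
by rewrite -(cs_normN cA) opprB lerNl opprB.
Qed.

(** Every connective of the language is 1-Lipschitz, so only the polynomials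
    contribute. *)
Lemma nval_lipschitz (psi : nform) : exists2 L : R, 0 <= L &
  forall A : starAlg R, is_cstar A -> forall (a b : V -> A) (e : R),
  in_ball a -> in_ball b -> 0 <= e -> (forall v, cnorm (a v - b v) <= e) ->
  `|nval psi a - nval psi b| <= L * e.
Proof.
elim: psi => [P|psi [L L0 LP] q|psi [L L0 LP] chi [N N0 NP]|v psi [L L0 LP]].
- have [L L0 LP] := npval_lipschitz P; exists L => // A cA a b e a1 b1 e0 ab /=.
  exact: le_trans (cs_norm_dist _ _ cA) (LP A cA a b e a1 b1 e0 ab).
- exists L => // A cA a b e a1 b1 e0 ab /=.
  apply: le_trans (ler_dist_dist _ _) _.
  by rewrite opprB addrA subrK; exact: LP.
- exists (L + N); first by rewrite addr_ge0.
  move=> A cA a b e a1 b1 e0 ab /=.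
  have := LP A cA a b e a1 b1 e0 ab; have := NP A cA a b e a1 b1 e0 ab.
  have Le : 0 <= L * e by rewrite mulr_ge0.
  have Ne : 0 <= N * e by rewrite mulr_ge0.
  rewrite mulrDl !ler_distl => /andP[h1 h2] /andP[h3 h4].
  apply/andP; split.
    rewrite le_max; have [_|_] := leP (nval psi b) (nval chi b); lra.
  rewrite ge_max; have [h|h] := leP (nval psi b) (nval chi b); apply/andP; split; lra.
- exists L => // A cA a b e a1 b1 e0 ab /=.
  have ab' x w : cnorm (upd a v x w - upd b v x w) <= e.
    by rewrite /upd; case: eqP => // _; rewrite subrr (cs_norm0 cA).
  rewrite ler_distl; apply/andP; split; rewrite ?lerBlDr;
    apply: inf_le_shift; try exact: unit_ball_nonempty;
    try exact: nval_lbound; move=> _ [x x1 <-].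
  + have := LP A cA (upd a v x) (upd b v x) e (upd_ball v a1 x1) (upd_ball v b1 x1) e0 (ab' x).
    rewrite ler_distl => /andP[? ?]; eexists; first by exists x.
    by rewrite -lerBlDr.
  + have := LP A cA (upd a v x) (upd b v x) e (upd_ball v a1 x1) (upd_ball v b1 x1) e0 (ab' x).
    rewrite ler_distl => /andP[? ?]; eexists; first by exists x.
    by [].
Qed.

End Language.

Arguments NZero {R u V}.
Arguments NUnit {R u V} _.
Arguments NVar {R u V} _.

HB.instance Definition _ (R : realType) (u : bool) (V : eqType) :=
  gen_eqMixin (nform R u V).

(** * Translation into the given logic, and extension of close tuples *)

Section Translation.
Variables (R : realType) (u : bool) (V : eqType).

(** [None] stands for the zero polynomial: with no free variable and no unit, the
    given logic has no polynomial at all. *)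
Fixpoint star_poly_of n (s : V -> option 'I_n) (P : npol R u V) : option (star_poly R u n) :=
  match P with
  | NVar v => omap (@PVar R u n) (s v)
  | NZero => None
  | NUnit hu => Some (PI R n hu)
  | NAdd P Q =>
      match star_poly_of s P, star_poly_of s Q with
      | Some P', Some Q' => Some (PAdd P' Q')
      | Some P', None => Some P'
      | None, Q' => Q'
      end
  | NScale k P => omap (PScale k) (star_poly_of s P)
  | NMul P Q =>
      match star_poly_of s P, star_poly_of s Q with
      | Some P', Some Q' => Some (PMul P' Q')
      | _, _ => None
      end
  | NAdj P => omap (@PAdj R u n) (star_poly_of s P)
  end.

Lemma cst_row_continuous k (c : R) : continuous (fun _ : 'rV[R]_k => c).
Proof. exact: cst_continuous. Qed.

Lemma dist_row_continuous (q : R) :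
  continuous (fun w : 'rV[R]_1 => `|w 0 0 - q|).
Proof.
move=> w; have := @coord_continuous R 1 1 0 0 w => cw.
have := cvg_norm (cvgB cw (cvg_cst q)); exact.
Qed.

Lemma max_row_continuous :
  continuous (fun w : 'rV[R]_2 => Num.max (w 0 0) (w 0 1)).
Proof.
move=> w; apply: continuous_max.
  exact: (@coord_continuous R 1 2 0 0).
exact: (@coord_continuous R 1 2 0 1).
Qed.

Definition slot_lift n (s : V -> option 'I_n) (v : V) : V -> option 'I_n.+1 :=
  upd (fun w => omap (lift ord0) (s w)) v (Some ord0).

Fixpoint formula_of n (s : V -> option 'I_n) (psi : nform R u V) : formula R u n :=
  match psi with
  | NNorm P =>
      if star_poly_of s P is Some Q then FNorm Q
      else FConn (@cst_row_continuous 0 0) (fun i => match notF (ltn_ord i) with end)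
  | NDist psi q => FConn (@dist_row_continuous q) (fun _ => formula_of s psi)
  | NMax psi chi =>
      FConn max_row_continuous (fun i => if i == 0 then formula_of s psi else formula_of s chi)
  | NInf v psi => FInf (formula_of (slot_lift s v) psi)
  end.

Section Values.
Variables (A : starAlg R) (cA : is_cstar A).

Definition slot_env n (s : V -> option 'I_n) (b : 'I_n -> A) : V -> A :=
  fun v => oapp b 0 (s v).

Lemma star_poly_ofP n (s : V -> option 'I_n) (b : 'I_n -> A) (P : npol R u V) :
  npval P (slot_env s b) = oapp (fun Q => poly_val Q b) 0 (star_poly_of s P).
Proof.
elim: P => //= [v|P -> Q ->|k P ->|P -> Q ->|P ->].
- by rewrite /slot_env; case: (s v).
- by case: (star_poly_of s P) => [P'|]; case: (star_poly_of s Q) => [Q'|] //=; rewrite ?addr0 ?add0r.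
- by case: (star_poly_of s P) => //=; rewrite scaler0.
- by case: (star_poly_of s P) => [P'|]; case: (star_poly_of s Q) => [Q'|] //=;
    rewrite ?(cs_0mul cA) ?(cs_mul0 cA).
- by case: (star_poly_of s P) => //=; rewrite (cs_adj0 cA).
Qed.

Lemma slot_env_lift n (s : V -> option 'I_n) (b : 'I_n -> A) v x :
  upd (slot_env s b) v x = slot_env (slot_lift s v) (env_cons x b).
Proof.
apply/funext => w; rewrite /upd /slot_env /slot_lift /upd.
case: eqP => _ /=; first by rewrite env_cons0.
by case: (s w) => //= i; rewrite env_consS.
Qed.

Lemma formula_ofP n (s : V -> option 'I_n) (b : 'I_n -> A) (psi : nform R u V) :
  nval psi (slot_env s b) = formula_val (formula_of s psi) b.
Proof.
elim: psi n s b => [P|psi IH q|psi IH chi IH'|v psi IH] n s b /=.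
- by rewrite star_poly_ofP; case: (star_poly_of s P) => //=; rewrite (cs_norm0 cA).
- by rewrite mxE IH.
- by rewrite !mxE IH IH'.
- by congr inf; apply/seteqP; split=> _ [x x1 <-]; exists x;
    rewrite // slot_env_lift IH.
Qed.

End Values.

Definition nsentence (psi : nform R u V) : sentence R u := formula_of (fun=> None) psi.

Lemma nsentenceP (A : starAlg R) (psi : nform R u V) : is_cstar A ->
  nval psi (fun=> 0 : A) = sentence_val A (nsentence psi).
Proof. by move=> cA; rewrite /sentence_val -formula_ofP. Qed.

End Translation.

Section Closeness.
Variables (R : realType) (u : bool) (V : eqType).
Implicit Types (D : seq (nform R u V)) (d : R) (A B : starAlg R).

Definition nclose D d A B (a : V -> A) (b : V -> B) :=
  forall psi, psi \in D -> `|nval psi a - nval psi b| <= d.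

Lemma nclose_sym D d A B (a : V -> A) (b : V -> B) :
  nclose D d a b -> nclose D d b a.
Proof. by move=> ab psi psiD; rewrite distrC ab. Qed.

Lemma nclose_sub D D' d d' A B (a : V -> A) (b : V -> B) :
  {subset D <= D'} -> d' <= d -> nclose D' d' a b -> nclose D d a b.
Proof. by move=> DD' dd' ab psi /DD' psiD; apply: le_trans (ab _ psiD) dd'. Qed.

(** A pattern is the maximum of the distances of the formulas of D to values
    taken from qs; its smallness at a tuple prescribes the values of D there. *)
Fixpoint patterns (qs : seq R) D : seq (nform R u V) :=
  if D is psi :: D' then
    [seq NMax (NDist psi q) g | q <- qs, g <- patterns qs D']
  else [:: NNorm NZero].

Lemma patterns_near qs D g A B (a : V -> A) (b : V -> B) e e' :
  g \in patterns qs D -> nval g a <= e -> nval g b <= e' ->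
  nclose D (e + e') a b.
Proof.
elim: D g => [|psi D IH] g //= /allpairsP[[q h] /= [_ hD ->]] /=.
rewrite !ge_max => /andP[aq ah] /andP[bq bh] chi; rewrite inE => /orP[/eqP->|chiD].
  by rewrite -(subrKA q); apply: le_trans (ler_normD _ _) _; rewrite lerD // distrC.
exact: IH hD ah bh _ chiD.
Qed.

Lemma real_net (B e : R) : 0 < e -> exists qs : seq R,
  forall t, 0 <= t <= B -> exists2 q, q \in qs & `|t - q| <= e.
Proof.
move=> e0; exists [seq k%:R * e | k <- iota 0 (Num.truncn (B / e)).+1].
move=> t /andP[t0 tB]; exists ((Num.truncn (t / e))%:R * e).
  apply/mapP; exists (Num.truncn (t / e)) => //.
  by rewrite mem_iota ltnS /= le_truncn// ler_pM2r ?invr_gt0.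
have te : 0 <= t / e by rewrite divr_ge0// ltW.
have /andP[h1 h2] := truncn_itv te.
move: h1 h2; rewrite ler_pdivlMr// ltr_pdivrMr// mulrSr mulrDl mul1r => h1 h2.
rewrite ger0_norm; lra.
Qed.

Lemma patterns_attained D e : 0 < e -> exists qs : seq R,
  forall A, is_cstar A -> forall a : V -> A, in_ball a ->
  exists2 g, g \in patterns qs D & nval g a <= e.
Proof.
move=> e0.
have [B BP] : exists B : R, forall psi, psi \in D -> forall A, is_cstar A ->
    forall a : V -> A, in_ball a -> 0 <= nval psi a <= B.
  elim: D => [|psi D [B BP]]; first by exists 0.
  have [C CP] := nval_bounded psi; exists (Num.max B C) => chi.
  rewrite inE => /orP[/eqP->|chiD] A cA a a1.
    by have /andP[-> /= h] := CP A cA a a1; rewrite le_max h orbT.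
  by have /andP[-> /= h] := BP chi chiD A cA a a1; rewrite le_max h.
have [qs qsP] := real_net B e0; exists qs => A cA a a1.
elim: D BP => [|psi D IH] BP.
  by exists (NNorm NZero); rewrite ?inE //= (cs_norm0 cA) ltW.
have [|g gD ge] := IH.
  by move=> chi chiD; apply: BP; rewrite inE chiD orbT.
have [q qqs qe] := qsP _ (BP psi (mem_head _ _) A cA a a1).
by exists (NMax (NDist psi q) g); [exact: allpairs_f|rewrite /= ge_max qe ge].
Qed.

(** D' consists of the formulas [NInf v g], for the patterns g over a net of
    values.  Some pattern g is small at (a, x), so [NInf v g] is small at a, hence
    at b, and an element y that almost attains this infimum is the answer. *)
Lemma nclose_extend1 D d v : 0 < d -> exists D' d', 0 < d' /\
  forall A B, is_cstar A -> is_cstar B ->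
  forall (a : V -> A) (b : V -> B), in_ball a -> in_ball b -> nclose D' d' a b ->
  forall x : A, cnorm x <= 1 ->
  exists2 y : B, cnorm y <= 1 & nclose D d (upd a v x) (upd b v y).
Proof.
(* g is at most e at (a, x) and at most 3 e at (b, y), which adds up to d. *)
move=> d0; pose e := d / 4; have e0 : 0 < e by rewrite divr_gt0.
have [qs qsP] := patterns_attained D e0.
exists [seq NInf v g | g <- patterns qs D], e; split=> //.
move=> A B cA cB a b a1 b1 ab x x1.
have [g gD ge] := qsP A cA _ (upd_ball v a1 x1).
have := ab _ (map_f (NInf v) gD); rewrite ler_distl => /andP[h _].
have ha : nval (NInf v g) a <= e.
  by apply: le_trans ge; apply: ge_inf; [exact: nval_lbound|exists x].
have [h0 h1] : has_inf [set nval g (upd b v y) | y in @unit_ball R B].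
  by split; [exact: unit_ball_nonempty|exact: nval_lbound].
have [_ [y y1 <-] yP] := inf_adherent e0 (conj h0 h1).
have {}yP : nval g (upd b v y) <= 3 * e.
  by move: h ha yP => /= ? ? ?; lra.
exists y => //; apply: nclose_sub (patterns_near gD ge yP) => //.
rewrite /e; lra.
Qed.

Lemma nclose_extend (vs : seq V) D d : 0 < d -> exists D' d', 0 < d' /\
  forall A B, is_cstar A -> is_cstar B ->
  forall (a : V -> A) (b : V -> B), in_ball a -> in_ball b -> nclose D' d' a b ->
  forall a' : V -> A, in_ball a' -> (forall v, v \notin vs -> a' v = a v) ->
  exists b' : V -> B, [/\ in_ball b', (forall v, v \notin vs -> b' v = b v) &
    nclose D d a' b'].
Proof.
elim: vs D d => [|v vs IH] D d d0.
  exists D, d; split=> // A B cA cB a b a1 b1 ab a' a'1 a'a.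
  by exists b; split=> //; rewrite (_ : a' = a)//; apply/funext => w; exact: a'a.
have [D1 [d1 [d10 ext]]] := IH D d d0.
have [D2 [d2 [d20 ext1]]] := nclose_extend1 D1 v d10.
exists D2, d2; split=> // A B cA cB a b a1 b1 ab a' a'1 a'a.
have [y y1 nclose_y] := ext1 A B cA cB a b a1 b1 ab (a' v) (a'1 v).
have [|b' [b'1 b'b cl]] := ext A B cA cB _ _ (upd_ball v a1 (a'1 v))
    (upd_ball v b1 y1) nclose_y a' a'1.
  move=> w wvs; rewrite /upd; case: eqP => [->//|/eqP wv].
  by rewrite a'a// inE negb_or wv.
exists b'; split=> // w; rewrite inE negb_or => /andP[/negPf wv wvs].
by rewrite b'b// /upd wv.
Qed.

End Closeness.

(** * Hilbert modules and the operator norm *)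

Section StarAlgebra.
Variables (R : realType) (A : starAlg R).
Hypothesis cA : is_cstar A.

Lemma cs_sumr (I : Type) (r : seq I) (P : pred I) (F : I -> A) (a : A) :
  a ** (\sum_(i <- r | P i) F i) = \sum_(i <- r | P i) (a ** F i).
Proof. exact: (big_morph (smul a) (cs_mulDr cA a) (cs_mul0 cA a)). Qed.

Lemma cs_suml (I : Type) (r : seq I) (P : pred I) (F : I -> A) (a : A) :
  (\sum_(i <- r | P i) F i) ** a = \sum_(i <- r | P i) (F i ** a).
Proof.
exact: (big_morph (fun b => smul b a) (fun x y => cs_mulDl cA x y a) (cs_0mul cA a)).
Qed.

Lemma cs_adj_sum (I : Type) (r : seq I) (P : pred I) (F : I -> A) :
  adj (\sum_(i <- r | P i) F i) = \sum_(i <- r | P i) adj (F i).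
Proof. exact: (big_morph (@adj R A) (cs_adjD cA) (cs_adj0 cA)). Qed.

Lemma cs_norm_sum (I : Type) (r : seq I) (P : pred I) (F : I -> A) :
  cnorm (\sum_(i <- r | P i) F i) <= \sum_(i <- r | P i) cnorm (F i).
Proof.
elim/big_rec2: _ => [|i y x _ IH]; first by rewrite (cs_norm0 cA).
by apply: le_trans (cs_normD cA _ _) _; rewrite lerD2l.
Qed.

Lemma cs_normCr (a : A) : cnorm (a ** adj a) = cnorm a ^+ 2.
Proof. by rewrite -{1}(cs_adjK cA a) (cs_normC cA) (cs_norm_adj cA). Qed.

End StarAlgebra.

Section HilbertModule.
Variables (R : realType) (A : starAlg R).

Definition ip (I : finType) (x y : I -> A) : A := \sum_i (adj (x i) ** y i).

Definition hnorm (I : finType) (x : I -> A) : R := Num.sqrt (cnorm (ip x x)).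

(** True in every C*-algebra by positivity; here it is a property that is
    propagated from the complex numbers. *)
Definition cauchy_schwarz := forall n (x y : 'I_n -> A),
  cnorm (ip x y) ^+ 2 <= cnorm (ip x x) * cnorm (ip y y).

Definition act (I J : finType) (M : I -> J -> A) (x : J -> A) : I -> A :=
  fun i => \sum_j (M i j ** x j).

Definition mconj (I J : finType) (M : I -> J -> A) : J -> I -> A :=
  fun j i => adj (M i j).

Hypothesis cA : is_cstar A.
Hypothesis csA : cauchy_schwarz.

Section Vectors.
Variable I : finType.
Implicit Types x y z : I -> A.

Lemma ip_conj x y : adj (ip x y) = ip y x.
Proof.
rewrite /ip (cs_adj_sum cA); apply: eq_bigr => i _.
by rewrite (cs_adjM cA) (cs_adjK cA).
Qed.

Lemma ipDr x y z : ip x (fun i => y i + z i) = ip x y + ip x z.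
Proof. by rewrite /ip -big_split; apply: eq_bigr => i _; rewrite (cs_mulDr cA). Qed.

Lemma ipDl x y z : ip (fun i => x i + y i) z = ip x z + ip y z.
Proof.
by rewrite /ip -big_split; apply: eq_bigr => i _; rewrite (cs_adjD cA) (cs_mulDl cA).
Qed.

Lemma ipZr (k : R[i]) x y : ip x (fun i => k *: y i) = k *: ip x y.
Proof. by rewrite /ip scaler_sumr; apply: eq_bigr => i _; rewrite (cs_scaleAr cA). Qed.

Lemma ipZl (k : R[i]) x y : ip (fun i => k *: x i) y = conjc k *: ip x y.
Proof.
rewrite /ip scaler_sumr; apply: eq_bigr => i _.
by rewrite (cs_adjZ cA) (cs_scaleAl cA).
Qed.

Lemma ipMr x y (a : A) : ip x (fun i => y i ** a) = ip x y ** a.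
Proof. by rewrite /ip (cs_suml cA); apply: eq_bigr => i _; rewrite (cs_mulA cA). Qed.

Lemma hnorm_ge0 x : 0 <= hnorm x. Proof. exact: sqrtr_ge0. Qed.

Lemma sqr_hnorm x : hnorm x ^+ 2 = cnorm (ip x x).
Proof. by rewrite sqr_sqrtr ?cs_norm_ge0. Qed.

Lemma hnorm_le x (c : R) : 0 <= c -> cnorm (ip x x) <= c ^+ 2 -> hnorm x <= c.
Proof. by move=> c0 xc; rewrite -ler_sqr ?nnegrE ?hnorm_ge0// sqr_hnorm. Qed.

Lemma ip_le x y : cnorm (ip x y) <= hnorm x * hnorm y.
Proof.
rewrite -ler_sqr ?nnegrE ?cs_norm_ge0 ?mulr_ge0 ?hnorm_ge0// exprMn !sqr_hnorm.
have ipE z w : ip z w = ip (fun j : 'I_#|I| => z (enum_val j)) (fun j => w (enum_val j)).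
  by rewrite /ip -(big_enum_val (fun i => adj (z i) ** w i)).
by rewrite (ipE x y) (ipE x x) (ipE y y); exact: csA.
Qed.

Lemma hnorm_add x y : hnorm (fun i => x i + y i) <= hnorm x + hnorm y.
Proof.
apply: hnorm_le; first by rewrite addr_ge0 ?hnorm_ge0.
rewrite ipDr !ipDl; apply: le_trans (cs_normD cA _ _) _.
apply: le_trans (lerD (cs_normD cA _ _) (cs_normD cA _ _)) _.
have h1 := ip_le x x; have h2 := ip_le y x; have h3 := ip_le x y; have h4 := ip_le y y.
by rewrite expr2; lra.
Qed.

Lemma hnorm_scale (k : R[i]) x : hnorm (fun i => k *: x i) = cmod k * hnorm x.
Proof.
rewrite /hnorm ipZl ipZr !(cs_normZ cA) mulrA.
have -> : cmod (conjc k) = cmod k by rewrite /cmod normcJ.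
by rewrite -expr2 sqrtrM ?sqr_ge0// sqrtr_sqr ger0_norm ?cmod_ge0.
Qed.

(** Cauchy-Schwarz against the vector whose only nonzero coordinate is
    [x i]. *)
Lemma hnorm_coord x i : cnorm (x i) <= hnorm x.
Proof.
have [->|xi0] := eqVneq (cnorm (x i)) 0; first exact: hnorm_ge0.
have xi_gt0 : 0 < cnorm (x i) by rewrite lt_def xi0 cs_norm_ge0.
pose y j := if j == i then x i else 0.
have yE z : ip z y = adj (z i) ** x i.
  rewrite /ip (bigD1 i)//= big1 => [|j /negPf ji].
    by rewrite /y eqxx addr0.
  by rewrite /y ji (cs_mul0 cA).
have := ip_le x y; rewrite yE (cs_normC cA) /hnorm yE /y eqxx (cs_normC cA).
by rewrite sqrtr_sqr ger0_norm ?cs_norm_ge0// expr2 ler_pM2r.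
Qed.

Lemma hnorm_le_sum x : hnorm x <= \sum_i cnorm (x i).
Proof.
apply: hnorm_le; first by rewrite sumr_ge0// => i _; exact: cs_norm_ge0.
apply: le_trans (cs_norm_sum cA _ _ _) _; rewrite expr2 mulr_suml.
apply: ler_sum => i _; rewrite (cs_normC cA) expr2 ler_wpM2l ?cs_norm_ge0//.
by rewrite (bigD1 i)//= lerDl sumr_ge0// => j _; exact: cs_norm_ge0.
Qed.

Lemma hnorm_zero : hnorm (fun _ : I => 0 : A) = 0.
Proof.
apply/le_anti; rewrite hnorm_ge0 andbT; apply: le_trans (hnorm_le_sum _) _.
by rewrite big1 => [|i _]; rewrite ?(cs_norm0 cA).
Qed.

Lemma hnorm0_eq0 x : hnorm x = 0 -> x = (fun=> 0).
Proof.
move=> x0; apply/funext => i; apply: (cs_norm0_eq0 cA); apply/le_anti.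
by rewrite cs_norm_ge0// andbT -x0 hnorm_coord.
Qed.

End Vectors.

Section Operators.
Variables I J : finType.
Implicit Types (M N : I -> J -> A) (x : J -> A).

Lemma ip_act M x (y : I -> A) : ip y (act M x) = ip (act (mconj M) y) x.
Proof.
rewrite /ip /act /mconj; under eq_bigr do rewrite (cs_sumr cA).
rewrite exchange_big /=; apply: eq_bigr => j _.
rewrite (cs_adj_sum cA) (cs_suml cA); apply: eq_bigr => i _.
by rewrite (cs_adjM cA) (cs_adjK cA) (cs_mulA cA).
Qed.

Lemma act_bounded M x :
  hnorm (act M x) <= (\sum_i \sum_j cnorm (M i j)) * hnorm x.
Proof.
apply: le_trans (hnorm_le_sum _) _; rewrite mulr_suml; apply: ler_sum => i _.
apply: le_trans (cs_norm_sum cA _ _ _) _; rewrite mulr_suml; apply: ler_sum => j _.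
apply: le_trans (cs_normM cA _ _) _.
by rewrite ler_wpM2l ?cs_norm_ge0// hnorm_coord.
Qed.

Lemma actZr M (k : R[i]) x : act M (fun j => k *: x j) = (fun i => k *: act M x i).
Proof.
apply/funext => i; rewrite /act scaler_sumr; apply: eq_bigr => j _.
by rewrite (cs_scaleAr cA).
Qed.

Lemma act0 M : act M (fun=> 0) = (fun=> 0).
Proof.
by apply/funext => i; rewrite /act big1// => j _; rewrite (cs_mul0 cA).
Qed.

(** Evaluate the form at y = M x. *)
Lemma act_le_form M (c : R) : 0 <= c ->
  (forall y x, cnorm (ip y (act M x)) <= c * hnorm y * hnorm x) ->
  forall x, hnorm (act M x) <= c * hnorm x.
Proof.
move=> c0 form x; have [->|h0] := eqVneq (hnorm (act M x)) 0.
  by rewrite mulr_ge0 ?hnorm_ge0.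
have h_gt0 : 0 < hnorm (act M x) by rewrite lt_def h0 hnorm_ge0.
have := form (act M x) x; rewrite -sqr_hnorm expr2 mulrAC.
by rewrite ler_pM2r.
Qed.

End Operators.

Lemma act_comp (I J K : finType) (M : I -> J -> A) (N : J -> K -> A) (x : K -> A) :
  act (fun i k => \sum_j (M i j ** N j k)) x = act M (act N x).
Proof.
apply/funext => i; rewrite /act; under eq_bigr do rewrite (cs_suml cA).
rewrite exchange_big /=; apply: eq_bigr => j _.
by rewrite (cs_sumr cA); apply: eq_bigr => k _; rewrite (cs_mulA cA).
Qed.

End HilbertModule.

Arguments act {R A I J} M x /.

Section MatrixNorm.
Variables (R : realType) (A : starAlg R) (n : nat).
Hypothesis cA : is_cstar A.
Hypothesis csA : cauchy_schwarz A.
Implicit Types (M N : matalg n A) (x : 'I_n -> A).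

(** Matrices as two-argument functions, for which [act] is defined over arbitrary
    finite index types. *)
Definition mx_fun (M : matalg n A) : 'I_n -> 'I_n -> A := fun i j => (M : 'M[A]_n) i j.

Let col_normE (x : 'cV[A]_n) : col_norm x = hnorm (fun i => x i 0).
Proof. by []. Qed.

Let applyE M (x : 'cV[A]_n) :
  col_norm (mat_apply M x) = hnorm (act (mx_fun M) (fun j => x j 0)).
Proof.
rewrite col_normE; congr hnorm; apply/funext => i; by rewrite mxE.
Qed.

Let norm_set M := [set col_norm (mat_apply M x) |
  x in [set x : 'cV[A]_n | col_norm x <= 1]].

Let norm_set_nonempty M : norm_set M !=set0.
Proof.
exists (col_norm (mat_apply M 0)), 0 => //=.
by rewrite col_normE (_ : (fun i => _) = fun=> 0) ?(hnorm_zero cA)//; apply/funext => i; rewrite mxE.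
Qed.

Let norm_set_bounded M : has_ubound (norm_set M).
Proof.
exists (\sum_i \sum_j cnorm (mx_fun M i j)) => _ [x /= x1 <-].
rewrite applyE; apply: le_trans (act_bounded cA csA _ _) _.
rewrite ler_piMr// sumr_ge0// => i _; rewrite sumr_ge0// => j _.
exact: cs_norm_ge0.
Qed.

Lemma mat_norm_act M x : hnorm (act (mx_fun M) x) <= cnorm M * hnorm x.
Proof.
have [x0|x0] := eqVneq (hnorm x) 0.
  by rewrite (hnorm0_eq0 cA csA x0) (act0 cA) !(hnorm_zero cA) mulr0.
have x_gt0 : 0 < hnorm x by rewrite lt_def x0 hnorm_ge0.
pose k : R[i] := ((hnorm x)^-1%:C)%C.
have kE : cmod k = (hnorm x)^-1 by rewrite cmod_real ger0_norm ?invr_ge0 ?hnorm_ge0.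
rewrite -ler_pdivrMr// mulrC -kE -(hnorm_scale cA) -(actZr cA).
have colE : (fun j => (\col_j (k *: x j)) j 0) = (fun j => k *: x j).
  by apply/funext => j; rewrite mxE.
rewrite -colE -applyE; apply: ub_le_sup; first exact: norm_set_bounded.
exists (\col_j (k *: x j)) => //=.
by rewrite col_normE colE (hnorm_scale cA) kE mulVf.
Qed.

Lemma mat_norm_le M (c : R) : 0 <= c ->
  (forall x, hnorm (act (mx_fun M) x) <= c * hnorm x) -> cnorm M <= c.
Proof.
move=> c0 Mc; apply: ge_sup; first exact: norm_set_nonempty.
move=> _ [x /= x1 <-]; rewrite applyE; apply: le_trans (Mc _) _.
by rewrite ler_piMr.
Qed.

Lemma mat_norm_ge0 M : 0 <= cnorm M.
Proof.
apply: le_trans (ub_le_sup (norm_set_bounded M) _); last first.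
  exists 0 => //=.
  by rewrite col_normE (_ : (fun i => _) = fun=> 0) ?(hnorm_zero cA)//; apply/funext => i; rewrite mxE.
exact: sqrtr_ge0.
Qed.

Lemma mat_norm_sum M : cnorm M <= \sum_i \sum_j cnorm (mx_fun M i j).
Proof.
apply: mat_norm_le; last exact: act_bounded.
by rewrite sumr_ge0// => i _; rewrite sumr_ge0// => j _; exact: cs_norm_ge0.
Qed.

(** Apply M to the vector with coordinate [adj (M i j)] at j: its i-th image is
    m m^*, of norm |m|^2. *)
Lemma mat_norm_entry M i j : cnorm (mx_fun M i j) <= cnorm M.
Proof.
set m := mx_fun M i j; have [->|m0] := eqVneq (cnorm m) 0; first exact: mat_norm_ge0.
have m_gt0 : 0 < cnorm m by rewrite lt_def m0 cs_norm_ge0.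
pose x k : A := if k == j then adj m else 0.
have x_le : hnorm x <= cnorm m.
  apply: le_trans (hnorm_le_sum cA _) _; rewrite (bigD1 j)//= big1 => [|k /negPf kj].
    by rewrite /x eqxx addr0 (cs_norm_adj cA).
  by rewrite /x kj (cs_norm0 cA).
have := le_trans (hnorm_coord cA csA (act (mx_fun M) x) i) (mat_norm_act M x).
rewrite {1}/act (bigD1 j)//= big1 => [|k /negPf kj]; last first.
  by rewrite /x kj (cs_mul0 cA).
rewrite addr0 /x eqxx (cs_normCr cA) expr2 => h.
rewrite -(ler_pM2r m_gt0); apply: le_trans h _.
by rewrite ler_wpM2l ?mat_norm_ge0.
Qed.

End MatrixNorm.

(** * Matrix algebras over a C*-algebra *)

Lemma cvg_sum0 (R : realType) (J : Type) (r : seq J) (f : J -> nat -> R) :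
  (forall j, f j @ \oo --> (0 : R)) ->
  (fun p => \sum_(j <- r) f j p) @ \oo --> (0 : R).
Proof.
move=> f0; elim: r => [|j r IH].
  have -> : (fun p => \sum_(j <- [::]) f j p) = cst 0.
    by apply/funext => p; rewrite big_nil.
  exact: cvg_cst.
have -> : (fun p => \sum_(i <- j :: r) f i p) =
    fun p => f j p + \sum_(i <- r) f i p.
  by apply/funext => p; rewrite big_cons.
by have := cvgD (f0 j) IH; rewrite addr0; apply.
Qed.

Section MatrixCstar.
Variables (R : realType) (A : starAlg R) (n : nat).
Hypothesis cA : is_cstar A.
Implicit Types (M N : matalg n A) (x : 'I_n -> A).

Lemma mx_funP M N : mx_fun M = mx_fun N -> M = N.
Proof. by move=> MN; apply/matrixP => i j; exact: (congr1 (fun f => f i j) MN). Qed.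

Lemma mx_funD M N i j : mx_fun (M + N) i j = mx_fun M i j + mx_fun N i j.
Proof. by rewrite /mx_fun mxE. Qed.

Lemma mx_funN M i j : mx_fun (- M) i j = - mx_fun M i j.
Proof. by rewrite /mx_fun mxE. Qed.

Lemma mx_fun0 i j : mx_fun (0 : matalg n A) i j = 0.
Proof. by rewrite /mx_fun mxE. Qed.

Lemma mx_funZ (k : R[i]) M i j : mx_fun (k *: M) i j = k *: mx_fun M i j.
Proof. by rewrite /mx_fun /GRing.scale /= mxE. Qed.

Lemma mx_funM M N i j : mx_fun (M ** N) i j = \sum_k (mx_fun M i k ** mx_fun N k j).
Proof. by rewrite /mx_fun /smul /= mxE. Qed.

Lemma mx_fun_adj M i j : mx_fun (adj M) i j = adj (mx_fun M j i).
Proof. by rewrite /mx_fun /adj /= mxE. Qed.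

Lemma mx_fun_sum (I : Type) (r : seq I) (P : pred I) (F : I -> matalg n A) i j :
  mx_fun (\sum_(k <- r | P k) F k) i j = \sum_(k <- r | P k) mx_fun (F k) i j.
Proof. exact: (big_morph (fun M => mx_fun M i j) (fun M N => mx_funD M N i j) (mx_fun0 i j)). Qed.

Lemma matalg_mulA M N (Q : matalg n A) : M ** (N ** Q) = (M ** N) ** Q.
Proof.
apply/matrixP => i j; rewrite -!/(mx_fun _ i j) !mx_funM.
under eq_bigr => k _ do rewrite mx_funM (cs_sumr cA).
under [RHS]eq_bigr => k _ do rewrite mx_funM (cs_suml cA).
rewrite exchange_big /=; apply: eq_bigr => k _; apply: eq_bigr => l _.
exact: (cs_mulA cA).
Qed.

Lemma act_mulmx M N x : act (mx_fun (M ** N)) x = act (mx_fun M) (act (mx_fun N) x).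
Proof.
rewrite -(act_comp cA); congr (act _ x); apply/funext => i; apply/funext => k.
by rewrite mx_funM.
Qed.

Lemma mx_fun_mconj M : mx_fun (adj M) = mconj (mx_fun M).
Proof. by apply/funext => i; apply/funext => j; rewrite mx_fun_adj. Qed.

Lemma act_addmx M N x :
  act (mx_fun (M + N)) x = fun i => act (mx_fun M) x i + act (mx_fun N) x i.
Proof.
apply/funext => i; rewrite /act -big_split; apply: eq_bigr => j _.
by rewrite mx_funD (cs_mulDl cA).
Qed.

Lemma act_scalemx (k : R[i]) M x :
  act (mx_fun (k *: M)) x = fun i => k *: act (mx_fun M) x i.
Proof.
apply/funext => i; rewrite /act scaler_sumr; apply: eq_bigr => j _.
by rewrite mx_funZ (cs_scaleAl cA).
Qed.

Lemma is_identity_diag (e : A) : is_identity e ->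
  is_identity (\matrix_(i, j) (if i == j then e else 0) : matalg n A).
Proof.
move=> eP M; split; apply/matrixP => i j; rewrite -!/(mx_fun _ i j) mx_funM.
  rewrite (bigD1 i)//= big1 => [|k /negPf ki].
    by rewrite {1}/mx_fun mxE eqxx addr0 (eP _).1.
  by rewrite {1}/mx_fun mxE eq_sym ki (cs_0mul cA).
rewrite (bigD1 j)//= big1 => [|k /negPf kj].
  by rewrite {2}/mx_fun mxE eqxx addr0 (eP _).2.
by rewrite {2}/mx_fun mxE kj (cs_mul0 cA).
Qed.

Lemma matalg_unital : unital A -> unital (matalg n A).
Proof. by move=> [e /is_identity_diag eP]; eexists; exact: eP. Qed.

Hypothesis csA : cauchy_schwarz A.

Let norm_ge0 := mat_norm_ge0 (n := n) cA csA.
Let norm_act := mat_norm_act (n := n) cA csA.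
Let norm_le := mat_norm_le (n := n) cA.

Lemma matalg_normZ_le (k : R[i]) M : cnorm (k *: M) <= cmod k * cnorm M.
Proof.
apply: norm_le => [|x]; first by rewrite mulr_ge0 ?cmod_ge0.
by rewrite act_scalemx (hnorm_scale cA) -mulrA ler_wpM2l ?cmod_ge0.
Qed.

Lemma matalg_normD M N : cnorm (M + N) <= cnorm M + cnorm N.
Proof.
apply: norm_le => [|x]; first by rewrite addr_ge0.
rewrite act_addmx mulrDl.
by apply: le_trans (hnorm_add cA csA (act (mx_fun M) x) _) _; rewrite lerD.
Qed.

Lemma matalg_normM M N : cnorm (M ** N) <= cnorm M * cnorm N.
Proof.
apply: norm_le => [|x]; first by rewrite mulr_ge0.
rewrite act_mulmx; apply: le_trans (norm_act _ _) _.
by rewrite -mulrA ler_wpM2l.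
Qed.

(** By Cauchy-Schwarz, |M x|^2 = |<x, M^* M x>| <= |M^* M| |x|^2. *)
Lemma matalg_sqr_norm_le M : cnorm M ^+ 2 <= cnorm (adj M ** M).
Proof.
have h : cnorm M <= Num.sqrt (cnorm (adj M ** M)).
  apply: norm_le => [|x]; first exact: sqrtr_ge0.
  apply: hnorm_le => //; first by rewrite mulr_ge0 ?sqrtr_ge0 ?hnorm_ge0.
  rewrite exprMn sqr_sqrtr//.
  rewrite -{1}[mx_fun M](_ : mconj (mx_fun (adj M)) = _); last first.
    by rewrite mx_fun_mconj; apply/funext => i; apply/funext => j; exact: (cs_adjK cA).
  rewrite -(ip_act cA) -act_mulmx; apply: le_trans (ip_le cA csA _ _) _.
  by rewrite mulrC expr2 mulrA ler_wpM2r ?hnorm_ge0.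
by rewrite -ler_sqrt ?norm_ge0// sqrtr_sqr ger0_norm.
Qed.

(** The previous lemma and submultiplicativity give |M| <= |M^*|, hence equality
    of the two, and then the identity. *)
Lemma matalg_normC M : cnorm (adj M ** M) = cnorm M ^+ 2.
Proof.
have le_adj N : cnorm N <= cnorm (adj N).
  have [->|N0] := eqVneq (cnorm N) 0; first exact: norm_ge0.
  have N_gt0 : 0 < cnorm N by rewrite lt_def N0 norm_ge0.
  rewrite -(ler_pM2r N_gt0) -expr2; apply: le_trans (matalg_sqr_norm_le N) _.
  exact: matalg_normM.
have adjK N : adj (adj N) = N.
  by apply/matrixP => i j; rewrite -!/(mx_fun _ i j) !mx_fun_adj (cs_adjK cA).
apply/le_anti; rewrite matalg_sqr_norm_le andbT.
apply: le_trans (matalg_normM _ _) _; rewrite expr2 ler_wpM2r//.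
by rewrite -{2}(adjK M) le_adj.
Qed.

Lemma matalg_complete (v : nat -> matalg n A) :
  (forall e : R, 0 < e -> exists N : nat, forall p q : nat,
     (N <= p)%N -> (N <= q)%N -> cnorm (v p - v q) < e) ->
  exists l : matalg n A, (fun p => cnorm (v p - l)) @ \oo --> (0 : R).
Proof.
move=> cv.
have entry i j : exists l : A,
    (fun p => cnorm (mx_fun (v p) i j - l)) @ \oo --> (0 : R).
  apply: (cs_complete cA) => e /cv[N NP]; exists N => p q Np Nq.
  apply: le_lt_trans (NP p q Np Nq).
  by rewrite -mx_funN -mx_funD; exact: mat_norm_entry.
have /choice[l lP] : forall ij : 'I_n * 'I_n, exists l : A,
    (fun p => cnorm (mx_fun (v p) ij.1 ij.2 - l)) @ \oo --> (0 : R).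
  by move=> [i j]; exact: entry.
pose L : matalg n A := \matrix_(i, j) l (i, j).
exists L.
apply: (@squeeze_cvgr _ _ _ _ (cst 0)
  (fun p => \sum_i \sum_j cnorm (mx_fun (v p) i j - l (i, j)))).
- apply: nearW => p; rewrite norm_ge0 /=.
  apply: le_trans (mat_norm_sum cA csA _) _.
  rewrite le_eqVlt; apply/orP; left; apply/eqP.
  apply: eq_bigr => i _; apply: eq_bigr => j _.
  by rewrite mx_funD mx_funN; congr (cnorm (_ - _)); rewrite /mx_fun mxE.
- exact: cvg_cst.
- by apply: cvg_sum0 => i; apply: cvg_sum0 => j; exact: (lP (i, j)).
Qed.

Theorem matalg_cstar : is_cstar (matalg n A).
Proof.
have ext M N : (forall i j, mx_fun M i j = mx_fun N i j) -> M = N.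
  by move=> MN; apply/matrixP => i j; exact: MN.
split.
- exact: matalg_mulA.
- move=> M N Q; apply: ext => i j; rewrite mx_funD !mx_funM -big_split.
  by apply: eq_bigr => k _; rewrite mx_funD (cs_mulDl cA).
- move=> M N Q; apply: ext => i j; rewrite mx_funD !mx_funM -big_split.
  by apply: eq_bigr => k _; rewrite mx_funD (cs_mulDr cA).
- move=> k M N; apply: ext => i j; rewrite mx_funZ !mx_funM scaler_sumr.
  by apply: eq_bigr => l _; rewrite mx_funZ (cs_scaleAl cA).
- move=> k M N; apply: ext => i j; rewrite mx_funZ !mx_funM scaler_sumr.
  by apply: eq_bigr => l _; rewrite mx_funZ (cs_scaleAr cA).
- by move=> M; apply: ext => i j; rewrite !mx_fun_adj (cs_adjK cA).
- by move=> M N; apply: ext => i j; rewrite mx_fun_adj !mx_funD !mx_fun_adj (cs_adjD cA).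
- by move=> k M; apply: ext => i j; rewrite mx_fun_adj !mx_funZ mx_fun_adj (cs_adjZ cA).
- move=> M N; apply: ext => i j; rewrite mx_fun_adj !mx_funM (cs_adj_sum cA).
  by apply: eq_bigr => k _; rewrite (cs_adjM cA) !mx_fun_adj.
- move=> M M0; apply: ext => i j; rewrite mx_fun0; apply: (cs_norm0_eq0 cA).
  by apply/le_anti; rewrite (cs_norm_ge0 cA) andbT -M0 mat_norm_entry.
- move=> k M; apply/le_anti; rewrite matalg_normZ_le /=.
  have [->|k0] := eqVneq k 0; first by rewrite cmod0 mul0r norm_ge0.
  have kV : k^-1 *: (k *: M) = M by rewrite scalerA mulVf// scale1r.
  have ck : cmod k * cmod k^-1 = 1.
    have cmodE (z : R[i]) : ((cmod z)%:C)%C = `|z| by rewrite /cmod normc_def.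
    by apply: (@complexI R); rewrite rmorphM /= !cmodE -normrM mulfV// normr1.
  rewrite -{1}kV; apply: le_trans (ler_wpM2l (cmod_ge0 _) (matalg_normZ_le _ _)) _.
  by rewrite mulrA ck mul1r.
- exact: matalg_normD.
- exact: matalg_normM.
- exact: matalg_normC.
- exact: matalg_complete.
Qed.

Section Columns.
Variable I : finType.
Implicit Types X Y : I -> matalg n A.

(** A column X of matrices as an operator from A^n to A^(I x n); its norm in the
    Hilbert module of columns is its operator norm, by [col_act_le] and
    [col_act_ge]. *)
Definition col_act X x : I * 'I_n -> A := fun p => act (mx_fun (X p.1)) x p.2.

(** <X x, Y y> = <x, <X, Y> y>, where <X, Y> is the matrix X^* Y. *)
Lemma ip_col_act X Y x y :
  ip (col_act X x) (col_act Y y) = ip x (act (mx_fun (ip X Y)) y).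
Proof.
have -> : act (mx_fun (ip X Y)) y =
    fun i => \sum_k act (mx_fun (adj (X k))) (act (mx_fun (Y k)) y) i.
  apply/funext => i; rewrite /act.
  under eq_bigr => j _ do rewrite mx_fun_sum (cs_suml cA).
  rewrite exchange_big; apply: eq_bigr => k _ /=.
  exact: (congr1 (@^~ i) (act_mulmx (adj (X k)) (Y k) y)).
transitivity (\sum_k ip x (act (mx_fun (adj (X k))) (act (mx_fun (Y k)) y))).
  have adjE k z : ip (act (mx_fun (X k)) x) z = ip x (act (mx_fun (adj (X k))) z).
    rewrite (ip_act cA (mx_fun (adj (X k)))) mx_fun_mconj; congr (ip (act _ x) z).
    by apply/funext => i; apply/funext => j; rewrite /mconj (cs_adjK cA).
  under eq_bigr do rewrite -adjE.
  by rewrite /ip -(pair_bigA _ (fun k i => adj (col_act X x (k, i)) ** col_act Y y (k, i))).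
rewrite /ip exchange_big; apply: eq_bigr => i _ /=.
by rewrite (cs_sumr cA).
Qed.

Lemma col_act_le X x : hnorm (col_act X x) <= hnorm X * hnorm x.
Proof.
apply: hnorm_le => //; first by rewrite mulr_ge0 ?hnorm_ge0.
rewrite exprMn sqr_sqrtr// ip_col_act; apply: le_trans (ip_le cA csA _ _) _.
by rewrite mulrC expr2 mulrA ler_wpM2r ?hnorm_ge0.
Qed.

Lemma col_act_form X Y (c d : R) : 0 <= c -> 0 <= d ->
  (forall x, hnorm (col_act X x) <= c * hnorm x) ->
  (forall x, hnorm (col_act Y x) <= d * hnorm x) -> cnorm (ip X Y) <= c * d.
Proof.
move=> c0 d0 Xc Yd; apply: norm_le => [|x]; first exact: mulr_ge0.
apply: act_le_form => // [|y {}x]; first exact: mulr_ge0.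
rewrite -ip_col_act; apply: le_trans (ip_le cA csA _ _) _.
by rewrite -[leRHS]mulrA mulrACA ler_pM ?hnorm_ge0.
Qed.

Lemma col_act_ge X (c : R) : 0 <= c ->
  (forall x, hnorm (col_act X x) <= c * hnorm x) -> hnorm X <= c.
Proof. by move=> c0 Xc; apply: (hnorm_le matalg_cstar) => //; rewrite expr2 col_act_form. Qed.

End Columns.

(** Cauchy-Schwarz in A^(m x n), applied to X x and Y y, bounds the form of the
    matrix <X, Y>, hence its norm. *)
Theorem matalg_cauchy_schwarz : cauchy_schwarz (matalg n A).
Proof.
move=> m X Y.
have le := col_act_form (hnorm_ge0 X) (hnorm_ge0 Y) (col_act_le X) (col_act_le Y).
rewrite -!(sqr_hnorm matalg_cstar) -exprMn.
by rewrite ler_sqr ?nnegrE ?mulr_ge0 ?hnorm_ge0// norm_ge0.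
Qed.

End MatrixCstar.

(** * The complex numbers and direct sums *)

Section ComplexNumbers.
Variable R : realType.
Implicit Types z w : R[i].

Lemma cmodE z : ((cmod z)%:C)%C = `|z|.
Proof. by rewrite /cmod normc_def. Qed.

Lemma cmodM z w : cmod (z * w) = cmod z * cmod w.
Proof. by apply: (@complexI R); rewrite rmorphM /= !cmodE normrM. Qed.

Lemma cmodD z w : cmod (z + w) <= cmod z + cmod w.
Proof. by rewrite -lecR rmorphD /= !cmodE ler_normD. Qed.

Lemma cmod_conj z : cmod (conjc z) = cmod z.
Proof. by rewrite /cmod normcJ. Qed.

Lemma cmod_sqr z : (cmod z) ^+ 2 = complex.Re z ^+ 2 + complex.Im z ^+ 2.
Proof. by apply: (@complexI R); rewrite rmorphXn /= cmodE -add_Re2_Im2. Qed.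

Lemma Re_le_cmod z : `|complex.Re z| <= cmod z.
Proof. by rewrite -ler_sqr ?nnegrE ?cmod_ge0// cmod_sqr real_normK ?num_real// lerDl sqr_ge0. Qed.

Lemma Im_le_cmod z : `|complex.Im z| <= cmod z.
Proof. by rewrite -ler_sqr ?nnegrE ?cmod_ge0// cmod_sqr real_normK ?num_real// lerDr sqr_ge0. Qed.

Lemma cmod_le_sum z : cmod z <= `|complex.Re z| + `|complex.Im z|.
Proof.
rewrite -ler_sqr ?nnegrE ?cmod_ge0 ?addr_ge0// cmod_sqr sqrrD !real_normK ?num_real//.
by rewrite addrAC lerDl mulrn_wge0// mulr_ge0.
Qed.

Lemma real_cauchy_cvg (x : nat -> R) :
  (forall e : R, 0 < e -> exists N : nat, forall m n : nat,
     (N <= m)%N -> (N <= n)%N -> `|x m - x n| < e) ->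
  exists l : R, (fun n => `|x n - l|) @ \oo --> (0 : R).
Proof.
move=> cx; have : cvg (x @ \oo).
  apply/cauchy_cvgP/cauchy_ballP => e e0; have [N NP] := cx _ e0.
  pose S := [set x n | n in [set n | (N <= n)%N]].
  exists (S, S); first by split; exists N => // n Nn; exists n.
  by move=> [_ _] /= [[m Nm <-] [n Nn <-]]; exact: NP.
move=> /cvg_ex[l xl]; exists l.
by have := cvg_norm (cvgB xl (cvg_cst l)); rewrite subrr normr0; apply.
Qed.

Lemma cplx_complete (v : nat -> cplx R) :
  (forall e : R, 0 < e -> exists N : nat, forall m n : nat,
     (N <= m)%N -> (N <= n)%N -> cnorm (v m - v n) < e) ->
  exists l : cplx R, (fun n => cnorm (v n - l)) @ \oo --> (0 : R).
Proof.
move=> cv; pose w n : R[i] := v n.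
have ReB (a b : R[i]) : complex.Re (a - b) = complex.Re a - complex.Re b.
  by case: a b => [? ?] [? ?].
have ImB (a b : R[i]) : complex.Im (a - b) = complex.Im a - complex.Im b.
  by case: a b => [? ?] [? ?].
have [|p pP] := @real_cauchy_cvg (fun n => complex.Re (w n)).
  move=> e /cv[N NP]; exists N => m n Nm Nn; apply: le_lt_trans (NP m n Nm Nn).
  by rewrite -ReB; exact: Re_le_cmod.
have [|q qP] := @real_cauchy_cvg (fun n => complex.Im (w n)).
  move=> e /cv[N NP]; exists N => m n Nm Nn; apply: le_lt_trans (NP m n Nm Nn).
  by rewrite -ImB; exact: Im_le_cmod.
pose l : R[i] := (p +i* q)%C; exists l.
apply: (@squeeze_cvgr _ _ _ _ (cst 0)
  (fun n => `|complex.Re (w n) - p| + `|complex.Im (w n) - q|)).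
- apply: nearW => n; rewrite cmod_ge0 /=.
  by apply: le_trans (cmod_le_sum _) _; rewrite ReB ImB.
- exact: cvg_cst.
- by have := cvgD pP qP; rewrite addr0; apply.
Qed.

Lemma cplx_cstar : is_cstar (cplx R).
Proof.
split=> /=.
- by move=> a b c; rewrite /smul /= mulrA.
- by move=> a b c; rewrite /smul /= mulrDl.
- by move=> a b c; rewrite /smul /= mulrDr.
- by move=> k a b; rewrite /smul /= /GRing.scale /= mulrA.
- by move=> k a b; rewrite /smul /= /GRing.scale /= mulrCA.
- by move=> a; exact: conjcK.
- by move=> a b; exact: rmorphD.
- by move=> k a; exact: rmorphM.
- by move=> a b; rewrite /adj /smul /= rmorphM /= mulrC.
- move=> a a0; apply: (@normr0_eq0 _ (R[i] : normedZmodType R[i])).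
  by rewrite -cmodE (a0 : cmod (a : R[i]) = 0).
- by move=> k a; exact: cmodM.
- by move=> a b; exact: cmodD.
- by move=> a b; rewrite -cmodM.
- by move=> a; rewrite /cnorm /smul /adj /= cmodM cmod_conj expr2.
- exact: cplx_complete.
Qed.

Lemma cplx_unital : unital (cplx R).
Proof. by exists (1 : R[i]) => a; rewrite /smul /= mul1r mulr1. Qed.

(** Lagrange's identity: twice the difference of the two sides is the sum of the
    squares (a i * b j - a j * b i)^2. *)
Lemma real_cauchy_schwarz n (a b : 'I_n -> R) :
  (\sum_i a i * b i) ^+ 2 <= (\sum_i a i ^+ 2) * (\sum_i b i ^+ 2).
Proof.
pose S : R := \sum_i \sum_j (a i * b j - a j * b i) ^+ 2.
have S0 : 0 <= S by apply: sumr_ge0 => i _; apply: sumr_ge0 => j _; exact: sqr_ge0.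
have AB : (\sum_i a i ^+ 2) * (\sum_i b i ^+ 2) = \sum_i \sum_j a i ^+ 2 * b j ^+ 2.
  by rewrite big_distrlr.
have BA : (\sum_i a i ^+ 2) * (\sum_i b i ^+ 2) = \sum_i \sum_j a j ^+ 2 * b i ^+ 2.
  by rewrite AB exchange_big.
have CC : (\sum_i a i * b i) ^+ 2 = \sum_i \sum_j (a i * b i) * (a j * b j).
  by rewrite expr2 big_distrlr.
suff : S = ((\sum_i a i ^+ 2) * (\sum_i b i ^+ 2)) *+ 2 - (\sum_i a i * b i) ^+ 2 *+ 2.
  by move=> SE; move: S0; rewrite SE subr_ge0 lerMn2r.
rewrite mulr2n {1}AB BA CC -sumrMnl -!big_split -sumrB.
apply: eq_bigr => i _; rewrite -sumrMnl -big_split -sumrB.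
by apply: eq_bigr => j _ /=; ring.
Qed.

Lemma cplx_cauchy_schwarz : cauchy_schwarz (cplx R).
Proof.
move=> n x y.
have diag (z : 'I_n -> cplx R) : cnorm (ip z z) = \sum_i cnorm (z i) ^+ 2.
  have -> : ip z z = ((\sum_i cnorm (z i) ^+ 2)%:C)%C.
    rewrite /ip rmorph_sum; apply: eq_bigr => i _.
    by rewrite rmorphXn /= cmodE sqr_normc mulrC.
  by rewrite /cnorm /= cmod_real ger0_norm// sumr_ge0// => i _; exact: sqr_ge0.
rewrite !diag; apply: le_trans (real_cauchy_schwarz _ _).
have le : cnorm (ip x y) <= \sum_i cnorm (x i) * cnorm (y i).
  apply: le_trans (cs_norm_sum cplx_cstar _ _ _) _; apply: ler_sum => i _.
  by rewrite /cnorm /smul /adj /= cmodM cmod_conj.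
by rewrite ler_sqr ?nnegrE ?(le_trans _ le) ?(cs_norm_ge0 cplx_cstar).
Qed.

End ComplexNumbers.

Section DirectSums.
Variables (R : realType) (A B : starAlg R).
Hypotheses (cA : is_cstar A) (cB : is_cstar B).

Lemma dsum_complete (v : nat -> dsum A B) :
  (forall e : R, 0 < e -> exists N : nat, forall m n : nat,
     (N <= m)%N -> (N <= n)%N -> cnorm (v m - v n) < e) ->
  exists l : dsum A B, (fun n => cnorm (v n - l)) @ \oo --> (0 : R).
Proof.
move=> cv.
have [|l1 l1P] := cs_complete cA (u := fun n => (v n).1).
  move=> e /cv[N NP]; exists N => m n Nm Nn; apply: le_lt_trans (NP m n Nm Nn).
  by rewrite [leRHS]/cnorm /= le_max lexx.
have [|l2 l2P] := cs_complete cB (u := fun n => (v n).2).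
  move=> e /cv[N NP]; exists N => m n Nm Nn; apply: le_lt_trans (NP m n Nm Nn).
  by rewrite [leRHS]/cnorm /= le_max lexx orbT.
exists (l1, l2).
apply: (@squeeze_cvgr _ _ _ _ (cst 0)
  (fun n => cnorm ((v n).1 - l1) + cnorm ((v n).2 - l2))).
- apply: nearW => n; rewrite /cnorm /= le_max ge_max !(cs_norm_ge0 cA) /=.
  by rewrite lerDl lerDr (cs_norm_ge0 cA) (cs_norm_ge0 cB).
- exact: cvg_cst.
- by have := cvgD l1P l2P; rewrite addr0; apply.
Qed.

Lemma dsum_cstar : is_cstar (dsum A B).
Proof.
split.
- by move=> [a1 a2] [b1 b2] [c1 c2]; rewrite /smul /= (cs_mulA cA) (cs_mulA cB).
- by move=> [a1 a2] [b1 b2] [c1 c2]; congr pair; [exact: cs_mulDl|exact: cs_mulDl].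
- by move=> [a1 a2] [b1 b2] [c1 c2]; congr pair; [exact: cs_mulDr|exact: cs_mulDr].
- by move=> k [a1 a2] [b1 b2]; congr pair; [exact: cs_scaleAl|exact: cs_scaleAl].
- by move=> k [a1 a2] [b1 b2]; congr pair; [exact: cs_scaleAr|exact: cs_scaleAr].
- by move=> [a1 a2]; congr pair; [exact: cs_adjK|exact: cs_adjK].
- by move=> [a1 a2] [b1 b2]; congr pair; [exact: cs_adjD|exact: cs_adjD].
- by move=> k [a1 a2]; congr pair; [exact: cs_adjZ|exact: cs_adjZ].
- by move=> [a1 a2] [b1 b2]; congr pair; [exact: cs_adjM|exact: cs_adjM].
- move=> [a1 a2]; rewrite /cnorm /= => a0.
  have /andP[h1 h2] : (cnorm a1 <= 0) && (cnorm a2 <= 0) by rewrite -ge_max a0.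
  congr pair; apply: cs_norm0_eq0 => //; apply/le_anti.
    by rewrite h1 (cs_norm_ge0 cA).
  by rewrite h2 (cs_norm_ge0 cB).
- move=> k [a1 a2]; rewrite /cnorm /= (cs_normZ cA) (cs_normZ cB).
  by rewrite maxr_pMr ?cmod_ge0.
- move=> [a1 a2] [b1 b2]; rewrite /cnorm /= ge_max; apply/andP; split.
    by apply: le_trans (cs_normD cA _ _) _; rewrite lerD// le_max lexx.
  by apply: le_trans (cs_normD cB _ _) _; rewrite lerD// le_max lexx orbT.
- move=> [a1 a2] [b1 b2]; rewrite /cnorm /= ge_max; apply/andP; split.
    apply: le_trans (cs_normM cA _ _) _.
    by rewrite ler_pM ?(cs_norm_ge0 cA)// le_max lexx.
  apply: le_trans (cs_normM cB _ _) _.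
  by rewrite ler_pM ?(cs_norm_ge0 cB)// le_max lexx orbT.
- move=> [a1 a2]; rewrite /cnorm /= (cs_normC cA) (cs_normC cB).
  have := cs_norm_ge0 cA a1; have := cs_norm_ge0 cB a2.
  have [h|/ltW h] := leP (cnorm a1) (cnorm a2) => b0 a0.
    by rewrite max_r// ler_sqr ?nnegrE.
  by rewrite max_l// ler_sqr ?nnegrE.
- exact: dsum_complete.
Qed.

Lemma dsum_unital : unital A -> unital B -> unital (dsum A B).
Proof.
move=> [e eP] [f fP]; exists (e, f) => -[a b]; rewrite /smul /=.
by rewrite (eP a).1 (eP a).2 (fP b).1 (fP b).2.
Qed.

Lemma dsum_ip (I : finType) (x y : I -> dsum A B) :
  ip x y = (ip (fun i => (x i).1) (fun i => (y i).1),
            ip (fun i => (x i).2) (fun i => (y i).2)).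
Proof.
rewrite /ip; elim/big_rec3: _ => // i p q r _ ->.
by [].
Qed.

Lemma dsum_cauchy_schwarz :
  cauchy_schwarz A -> cauchy_schwarz B -> cauchy_schwarz (dsum A B).
Proof.
move=> csA csB n x y; rewrite !dsum_ip /cnorm /=.
have le (p q r p' q' r' : R) : 0 <= q -> 0 <= r -> 0 <= p -> 0 <= p' -> 0 <= q' -> 0 <= r' ->
    p ^+ 2 <= q * r -> p' ^+ 2 <= q' * r' ->
    (Num.max p p') ^+ 2 <= Num.max q q' * Num.max r r'.
  move=> q0 r0 p0 p'0 q'0 r'0 h h'.
  have [_|_] := leP p p'; [apply: le_trans h' _|apply: le_trans h _];
    by rewrite ler_pM// le_max lexx ?orbT.
by apply: le; rewrite ?(cs_norm_ge0 cA) ?(cs_norm_ge0 cB).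
Qed.

End DirectSums.

Lemma star_iso_cauchy_schwarz (R : realType) (A B : starAlg R) :
  star_iso A B -> cauchy_schwarz A -> cauchy_schwarz B.
Proof.
move=> /star_iso_sym[f [_ fL fM fA fN]] csA n x y.
have ipE (z w : 'I_n -> B) : f (ip z w) = ip (f \o z) (f \o w).
  by rewrite /ip (lin_sum fL); apply: eq_bigr => i _; rewrite fM fA.
by rewrite -!fN !ipE; exact: csA.
Qed.

(** * Isomorphisms between matrix algebras *)

Section MatrixIso.
Variables (R : realType) (n : nat).
Implicit Types A B : starAlg R.

Lemma matalg_map_norm_le A B (f : A -> B) (g : B -> A) (M : matalg n A) (N : matalg n B) :
  is_cstar A -> cauchy_schwarz A -> is_cstar B -> cancel g f ->
  (forall (k : R[i]) (a b : A), f (k *: a + b) = k *: f a + f b) ->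
  (forall a b : A, f (a ** b) = f a ** f b) ->
  (forall a : A, f (adj a) = adj (f a)) ->
  (forall a : A, cnorm (f a) = cnorm a) ->
  (forall i j, mx_fun N i j = f (mx_fun M i j)) ->
  cnorm N <= cnorm M.
Proof.
move=> cA csA cB gK fL fM fA fN NM.
have hf (x : 'I_n -> A) : hnorm (f \o x) = hnorm x.
  rewrite /hnorm -fN; congr (Num.sqrt (cnorm _)).
  by rewrite /ip (lin_sum fL); apply: eq_bigr => i _; rewrite fM fA.
apply: (mat_norm_le cB) => [|y]; first exact: (mat_norm_ge0 cA csA).
have -> : y = f \o (g \o y) by apply/funext => i /=; rewrite gK.
have -> : act (mx_fun N) (f \o (g \o y)) = f \o act (mx_fun M) (g \o y).
  by apply/funext => i /=; rewrite (lin_sum fL); apply: eq_bigr => j _; rewrite NM fM.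
by rewrite !hf; exact: mat_norm_act.
Qed.

Lemma matalg_iso A B : is_cstar A -> cauchy_schwarz A -> star_iso A B ->
  star_iso (matalg n A) (matalg n B).
Proof.
move=> cA csA AB; have cB := star_iso_cstar AB cA.
have csB := star_iso_cauchy_schwarz AB csA.
move: AB => [f [[g fK gK] fL fM fA fN]].
pose F (h : A -> B) (M : matalg n A) : matalg n B := \matrix_(i, j) h (mx_fun M i j).
pose G (N : matalg n B) : matalg n A := \matrix_(i, j) g (mx_fun N i j).
have FE M i j : mx_fun (F f M) i j = f (mx_fun M i j) by rewrite /mx_fun mxE.
have GE N i j : mx_fun (G N) i j = g (mx_fun N i j) by rewrite /mx_fun mxE.
have ext C (M N : matalg n C) : (forall i j, mx_fun M i j = mx_fun N i j) -> M = N.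
  by move=> MN; apply/matrixP => i j; exact: MN.
exists (F f); split.
- by exists G => M; apply: ext => i j; [rewrite GE FE fK|rewrite FE GE gK].
- by move=> k M N; apply: ext => i j; rewrite !(mx_funD, mx_funZ, FE) fL.
- move=> M N; apply: ext => i j; rewrite FE !mx_funM (lin_sum fL).
  by apply: eq_bigr => k _; rewrite !FE fM.
- by move=> M; apply: ext => i j; rewrite !(FE, mx_fun_adj) fA.
- move=> M; apply/le_anti; rewrite (matalg_map_norm_le (f := f) (g := g) cA csA)//=.
  apply: (matalg_map_norm_le (f := g) (g := f)) => //.
  + by move=> k a b; rewrite -{1}(gK a) -{1}(gK b) -fL fK.
  + by move=> a b; rewrite -{1}(gK a) -{1}(gK b) -fM fK.
  + by move=> a; rewrite -{1}(gK a) -fA fK.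
  + by move=> a; rewrite -{2}(gK a) fN.
  + by move=> i j; rewrite FE fK.
Qed.

Lemma dsum_hnorm A B (I : finType) (x : I -> dsum A B) :
  hnorm x = Num.max (hnorm (fun i => (x i).1)) (hnorm (fun i => (x i).2)).
Proof.
rewrite /hnorm dsum_ip /=; have [h|h] := leP (cnorm (ip (fun i => (x i).1) _)) _.
  by rewrite max_r// ler_wsqrtr.
by rewrite max_l// ler_wsqrtr// ltW.
Qed.

(** The norm of x in (A (+) B)^n is the maximum of the norms of its components,
    so the supremum defining the operator norm splits. *)
Lemma matalg_dsum A B : is_cstar A -> cauchy_schwarz A -> is_cstar B ->
  cauchy_schwarz B ->
  star_iso (matalg n (dsum A B)) (dsum (matalg n A) (matalg n B)).
Proof.
move=> cA csA cB csB; have cD := dsum_cstar cA cB.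
have csD := dsum_cauchy_schwarz cA cB csA csB.
have ext C (M N : matalg n C) : (forall i j, mx_fun M i j = mx_fun N i j) -> M = N.
  by move=> MN; apply/matrixP => i j; exact: MN.
pose F1 (M : matalg n (dsum A B)) : matalg n A := \matrix_(i, j) (mx_fun M i j).1.
pose F2 (M : matalg n (dsum A B)) : matalg n B := \matrix_(i, j) (mx_fun M i j).2.
pose G (N : dsum (matalg n A) (matalg n B)) : matalg n (dsum A B) :=
  \matrix_(i, j) ((mx_fun N.1 i j, mx_fun N.2 i j) : dsum A B).
have F1E M i j : mx_fun (F1 M) i j = (mx_fun M i j).1 by rewrite /mx_fun mxE.
have F2E M i j : mx_fun (F2 M) i j = (mx_fun M i j).2 by rewrite /mx_fun mxE.
have GE N i j : mx_fun (G N) i j = (mx_fun N.1 i j, mx_fun N.2 i j).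
  by rewrite /mx_fun mxE.
have sum1 (I : finType) (h : I -> dsum A B) : (\sum_i h i).1 = \sum_i (h i).1.
  by elim/big_rec2: _ => // i p q _ <-.
have sum2 (I : finType) (h : I -> dsum A B) : (\sum_i h i).2 = \sum_i (h i).2.
  by elim/big_rec2: _ => // i p q _ <-.
have act1 M x : act (mx_fun (F1 M)) (fun j => (x j).1) = fun i => (act (mx_fun M) x i).1.
  by apply/funext => i; rewrite /act sum1; apply: eq_bigr => j _; rewrite F1E.
have act2 M x : act (mx_fun (F2 M)) (fun j => (x j).2) = fun i => (act (mx_fun M) x i).2.
  by apply/funext => i; rewrite /act sum2; apply: eq_bigr => j _; rewrite F2E.
exists (fun M => (F1 M, F2 M)); split.
- exists G => [M|[N1 N2]].
    by apply: ext => i j; rewrite GE /= F1E F2E; case: (mx_fun M i j).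
  by congr pair; apply: ext => i j; rewrite ?F1E ?F2E GE.
- by move=> k M N; congr pair; apply: ext => i j;
    rewrite !(mx_funD, mx_funZ, F1E, F2E).
- move=> M N; congr pair; apply: ext => i j; rewrite ?F1E ?F2E !mx_funM.
    by rewrite sum1; apply: eq_bigr => k _; rewrite !F1E.
  by rewrite sum2; apply: eq_bigr => k _; rewrite !F2E.
- by move=> M; congr pair; apply: ext => i j; rewrite !(F1E, F2E, mx_fun_adj).
- move=> M; apply/le_anti/andP; split.
    rewrite [leLHS]/cnorm /= ge_max; apply/andP; split.
      apply: (mat_norm_le cA) => [|x]; first exact: mat_norm_ge0.
      have := mat_norm_act cD csD M (fun j => (x j, 0)).
      rewrite !dsum_hnorm /= (hnorm_zero cB) (max_l (hnorm_ge0 _)) ge_max => /andP[h _].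
      apply: le_trans h.
      by rewrite -(act1 M (fun j => (x j, 0))).
    apply: (mat_norm_le cB) => [|x]; first exact: mat_norm_ge0.
    have := mat_norm_act cD csD M (fun j => (0, x j)).
    rewrite !dsum_hnorm /= (hnorm_zero cA) (max_r (hnorm_ge0 _)) ge_max => /andP[_ h].
    apply: le_trans h.
    by rewrite -(act2 M (fun j => (0, x j))).
  apply: (mat_norm_le cD) => [|x].
    by rewrite le_max (mat_norm_ge0 cA csA).
  rewrite [X in X <= _]dsum_hnorm -act1 -act2 ge_max; apply/andP; split.
    apply: le_trans (mat_norm_act cA csA _ _) _.
    by rewrite ler_pM ?hnorm_ge0 ?(mat_norm_ge0 cA csA)// ?dsum_hnorm le_max lexx.
  apply: le_trans (mat_norm_act cB csB _ _) _.
  by rewrite ler_pM ?hnorm_ge0 ?(mat_norm_ge0 cB csB)// ?dsum_hnorm le_max lexx orbT.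
Qed.

End MatrixIso.

Lemma ord_pair_bij n k : exists d : 'I_(n * k) -> 'I_n * 'I_k, bijective d.
Proof.
have e : (n * k)%N = #|{: 'I_n * 'I_k}| by rewrite card_prod !card_ord.
exists (fun i => enum_val (cast_ord e i)).
exists (fun p => cast_ord (esym e) (enum_rank p)) => [i|p].
  by rewrite enum_valK cast_ordK.
by rewrite cast_ordKV enum_rankK.
Qed.

Section MatrixOfMatrices.
Variables (R : realType) (A : starAlg R) (n k : nat).
Hypotheses (cA : is_cstar A) (csA : cauchy_schwarz A) (uA : unital A).
Hypothesis k_gt0 : (0 < k)%N.

Let I : finType := ('I_n * 'I_k)%type.
Let cK := matalg_cstar k cA csA.
Let csK := @matalg_cauchy_schwarz _ _ k cA csA.

Lemma hnorm_reindex (J J' : finType) (d : J -> J') (x : J' -> A) :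
  bijective d -> hnorm (x \o d) = hnorm x.
Proof.
move=> dB; rewrite /hnorm /ip; congr (Num.sqrt (cnorm _)).
by rewrite [RHS](reindex d)//; exact: onW_bij.
Qed.

(** <x a, x a> = a^* <x, x> a. *)
Lemma hnorm_mulr (J : finType) (x : J -> A) (a : A) :
  hnorm (fun i => x i ** a) <= hnorm x * cnorm a.
Proof.
apply: hnorm_le => //; first by rewrite mulr_ge0 ?hnorm_ge0 ?cs_norm_ge0.
rewrite (ipMr cA) -(cs_norm_adj cA) (cs_adjM cA) (ip_conj cA) (ipMr cA).
apply: le_trans (cs_normM cA _ _) _; rewrite (cs_norm_adj cA).
apply: le_trans (ler_wpM2l (cs_norm_ge0 cA _) (cs_normM cA _ _)) _.
by rewrite -sqr_hnorm// exprMn expr2 [in leRHS]expr2; lra.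
Qed.

(** The n k x n k matrix with blocks M i j, indexed by pairs. *)
Definition block_fun (M : matalg n (matalg k A)) : I -> I -> A :=
  fun p q => mx_fun (mx_fun M p.1 q.1) p.2 q.2.

Lemma col_act_block (M : matalg n (matalg k A)) (X : 'I_n -> matalg k A)
    (w : 'I_k -> A) :
  col_act (act (mx_fun M) X) w = act (block_fun M) (col_act X w).
Proof.
apply/funext => -[i p]; rewrite /col_act /act /=.
rewrite -(pair_bigA _ (fun j q => block_fun M (i, p) (j, q) **
   (\sum_r (mx_fun (X j) q r ** w r)))) /=.
under eq_bigr => r _ do rewrite mx_fun_sum (cs_suml cA).
rewrite exchange_big; apply: eq_bigr => j _ /=.
exact: (congr1 (@^~ p) (act_mulmx cA (mx_fun M i j) (X j) w)).
Qed.

(** If the block matrix is bounded by c on A^(n k), then so is its composition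
    with the operator X : A^k -> A^(n k) of any column X. *)
Lemma block_norm_le (M : matalg n (matalg k A)) (c : R) : 0 <= c ->
  (forall v, hnorm (act (block_fun M) v) <= c * hnorm v) -> cnorm M <= c.
Proof.
move=> c0 Mc; apply: (mat_norm_le cK) => // X.
apply: (col_act_ge cA csA) => [|w]; first by rewrite mulr_ge0 ?hnorm_ge0.
rewrite col_act_block; apply: le_trans (Mc _) _.
by rewrite -mulrA ler_wpM2l// col_act_le.
Qed.

(** The vector v becomes the column X with v as first columns and zero elsewhere;
    X is an operator of norm at most |v| that sends the first basis vector e to v,
    so M v is (M X) e. *)
Lemma block_norm_act (M : matalg n (matalg k A)) (v : I -> A) :
  hnorm (act (block_fun M) v) <= cnorm M * hnorm v.
Proof.
have [e eP] := uA; pose q0 := Ordinal k_gt0.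
pose X (i : 'I_n) : matalg k A := \matrix_(p, q) (if q == q0 then v (i, p) else 0).
pose w (q : 'I_k) : A := if q == q0 then e else 0.
have Xw z : col_act X z = fun p => v p ** z q0.
  apply/funext => -[i p]; rewrite /col_act /act (bigD1 q0)//= big1 => [|q /negPf qq0].
    by rewrite /mx_fun mxE eqxx addr0.
  by rewrite /mx_fun mxE qq0 (cs_0mul cA).
have Xw1 : col_act X w = v.
  by rewrite Xw; apply/funext => p; rewrite /w eqxx (eP _).2.
have w1 : hnorm w <= 1.
  apply: le_trans (hnorm_le_sum cA w) _; rewrite (bigD1 q0)//= big1 => [|q /negPf qq0].
    by rewrite /w eqxx addr0; exact: identity_norm_le1.
  by rewrite /w qq0 (cs_norm0 cA).
have Xv : hnorm X <= hnorm v.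
  apply: (col_act_ge cA csA) => [|z]; first exact: hnorm_ge0.
  rewrite Xw; apply: le_trans (hnorm_mulr _ _) _.
  by rewrite ler_wpM2l ?hnorm_ge0// hnorm_coord.
rewrite -{1}Xw1 -col_act_block.
apply: le_trans (col_act_le cA csA _ _) _; apply: le_trans (ler_piMr _ w1) _.
  exact: hnorm_ge0.
apply: le_trans (mat_norm_act cK csK _ _) _.
by rewrite ler_wpM2l// (mat_norm_ge0 cK csK).
Qed.

Theorem matalg_matalg : star_iso (matalg n (matalg k A)) (matalg (n * k) A).
Proof.
have [d dB] := ord_pair_bij n k; have [d' dK d'K] := dB.
pose F (M : matalg n (matalg k A)) : matalg (n * k) A :=
  \matrix_(i, j) block_fun M (d i) (d j).
pose G (N : matalg (n * k) A) : matalg n (matalg k A) :=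
  \matrix_(i, j) ((\matrix_(p, q) mx_fun N (d' (i, p)) (d' (j, q))) : matalg k A).
have FE M i j : mx_fun (F M) i j = block_fun M (d i) (d j) by rewrite /mx_fun mxE.
have GE N p q : block_fun (G N) p q = mx_fun N (d' p) (d' q).
  by case: p q => [i p] [j q]; rewrite /block_fun /mx_fun !mxE.
have ext (M N : matalg n (matalg k A)) : (forall p q, block_fun M p q = block_fun N p q) -> M = N.
  move=> MN; apply/matrixP => i j; apply/matrixP => p q.
  exact: (MN (i, p) (j, q)).
have ext' (M N : matalg (n * k) A) : (forall i j, mx_fun M i j = mx_fun N i j) -> M = N.
  by move=> MN; apply/matrixP => i j; exact: MN.
have actF M v : act (mx_fun (F M)) (v \o d) = act (block_fun M) v \o d.
  apply/funext => i; rewrite /act /= [RHS](reindex d); last exact: onW_bij.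
  by apply: eq_bigr => j _; rewrite FE.
exists F; split.
- exists G => [M|N]; first by apply: ext => p q; rewrite GE FE !d'K.
  by apply: ext' => i j; rewrite FE GE !dK.
- move=> c M N; apply: ext' => i j; rewrite mx_funD mx_funZ !FE /block_fun.
  by rewrite mx_funD mx_funZ mx_funD mx_funZ.
- move=> M N; apply: ext' => i j; rewrite mx_funM FE /block_fun mx_funM mx_fun_sum.
  rewrite [RHS](reindex d') /=; last by apply: onW_bij; exists d.
  under [RHS]eq_bigr do rewrite !FE d'K.
  rewrite -(pair_bigA _ (fun l r => block_fun M (d i) (l, r) ** block_fun N (l, r) (d j))) /=.
  by apply: eq_bigr => l _; rewrite mx_funM.
- by move=> M; apply: ext' => i j; rewrite mx_fun_adj !FE /block_fun !mx_fun_adj.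
- move=> M; apply/le_anti/andP; split.
    apply: (mat_norm_le cA) => [|v]; first exact: (mat_norm_ge0 cK csK).
    have -> : v = (v \o d') \o d by apply/funext => i /=; rewrite dK.
    by rewrite actF (hnorm_reindex (act _ _) dB) (hnorm_reindex (v \o d') dB) block_norm_act.
  apply: block_norm_le => [|v]; first exact: (mat_norm_ge0 cA csA).
  by rewrite -(hnorm_reindex v dB) -(hnorm_reindex (act _ v) dB) -actF mat_norm_act.
Qed.

End MatrixOfMatrices.

(** * Finite-dimensional algebras *)

Section DirectSumIso.
Variable R : realType.
Implicit Types A B C : starAlg R.

Lemma dsum_iso A A' B B' : star_iso A A' -> star_iso B B' ->
  star_iso (dsum A B) (dsum A' B').
Proof.
move=> [f [[f' fK f'K] fL fM fA fN]] [g [[g' gK g'K] gL gM gA gN]].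
exists (fun x => (f x.1, g x.2)); split.
- by exists (fun x => (f' x.1, g' x.2)) => -[x y] /=; rewrite ?fK ?gK ?f'K ?g'K.
- by move=> k [a b] [a' b']; congr pair; rewrite ?fL ?gL.
- by move=> [a b] [a' b']; congr pair; rewrite ?fM ?gM.
- by move=> [a b]; congr pair; rewrite ?fA ?gA.
- by move=> [a b]; rewrite /cnorm /= fN gN.
Qed.

Lemma dsumA A B C : star_iso (dsum (dsum A B) C) (dsum A (dsum B C)).
Proof.
exists (fun x => (x.1.1, (x.1.2, x.2))); split=> //.
- by exists (fun x => ((x.1, x.2.1), x.2.2)) => [[[a b] c]|[a [b c]]].
- by move=> [[a b] c]; rewrite /cnorm /= maxA.
Qed.

(** The value at i is chosen as the one that agrees with the data along every
    equation between i and 0 or a successor; this avoids a dependent case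
    analysis on i. *)
Lemma fam_recl m (F : 'I_m.+1 -> starAlg R) (y0 : F ord0)
    (y : forall j, F (lift ord0 j)) :
  exists2 x : fam F, x ord0 = y0 & forall j, x (lift ord0 j) = y j.
Proof.
have /fam_choice[x xP] : forall i, exists z : F i,
    (forall e : ord0 = i, z = eq_rect _ (fun i => F i : Type) y0 _ e) /\
    (forall j (e : lift ord0 j = i), z = eq_rect _ (fun i => F i : Type) (y j) _ e).
  move=> i; case: (unliftP ord0 i) => [j ->|->].
    exists (y j); split=> [e|j' e].
      by exfalso; have := neq_lift ord0 j; rewrite -e eqxx.
    by have /lift_inj ej := e; subst j'; rewrite (eq_axiomK e).
  exists y0; split=> [e|j e]; first by rewrite (eq_axiomK e).
  by exfalso; have := neq_lift ord0 j; rewrite e eqxx.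
by exists x => [|j]; [rewrite ((xP _).1 erefl)|rewrite ((xP _).2 _ erefl)].
Qed.

Lemma fam_ext m (F : 'I_m.+1 -> starAlg R) (x y : fam F) :
  x ord0 = y ord0 -> (forall j, x (lift ord0 j) = y (lift ord0 j)) -> x = y.
Proof.
move=> xy0 xy; apply/functional_extensionality_dep => i.
by case: (unliftP ord0 i) => [j ->|->].
Qed.

Lemma inj_surj_bijective (T T' : Type) (f : T -> T') :
  injective f -> (forall y, exists x, f x = y) -> bijective f.
Proof.
move=> fI /choice[g gP]; exists g => // x.
by apply: fI; rewrite gP.
Qed.

Lemma big_dsum_recl m (F : 'I_m.+1 -> starAlg R) :
  star_iso (big_dsum F) (dsum (F ord0) (big_dsum (fun j => F (lift ord0 j)))).
Proof.
exists (fun x : fam F => (x ord0, (fun j => x (lift ord0 j)) : fam _)).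
split=> //; last by move=> x; rewrite /cnorm /= big_ord_recl.
apply: inj_surj_bijective => [x y [xy0 xy]|[y0 y]].
  apply: fam_ext => // j.
  exact: (congr1 (fun h : forall j, F (lift ord0 j) => h j) xy).
have [x xy0 xy] := fam_recl y0 y; exists x; rewrite xy0; congr pair.
exact/functional_extensionality_dep.
Qed.

Lemma big_dsum1 (F : 'I_1 -> starAlg R) : is_cstar (F ord0) ->
  star_iso (big_dsum F) (F ord0).
Proof.
move=> cF; exists (fun x : fam F => x ord0); split=> //.
- apply: inj_surj_bijective => [x y xy0|y0]; first by apply: fam_ext => // -[].
  have [x xy0 _] := @fam_recl _ F y0 (fun j => 0).
  by exists x.
- by move=> x; rewrite /cnorm /= big_ord_recl big_ord0 max_l ?(cs_norm_ge0 cF).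
Qed.

End DirectSumIso.

Section FiniteDimensional.
Variable R : realType.
Implicit Types F G : starAlg R.
Let C := cplx R.

(** The properties of finite-dimensional algebras that are used in the sequel. *)
Definition unital_cs_cstar F := [/\ is_cstar F, cauchy_schwarz F & unital F].

Lemma unital_cs_cstar_iso F G : star_iso F G -> unital_cs_cstar F -> unital_cs_cstar G.
Proof.
move=> FG [cF csF uF]; split; first exact: star_iso_cstar FG cF.
  exact: star_iso_cauchy_schwarz FG csF.
exact: star_iso_unital FG uF.
Qed.

Lemma unital_cs_cstar_matalg n F : unital_cs_cstar F -> unital_cs_cstar (matalg n F).
Proof.
move=> [cF csF uF]; split; [exact: matalg_cstar|exact: matalg_cauchy_schwarz|].
exact: matalg_unital.
Qed.

Lemma unital_cs_cstar_cplx : unital_cs_cstar C.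
Proof. by split; [exact: cplx_cstar|exact: cplx_cauchy_schwarz|exact: cplx_unital]. Qed.

Lemma unital_cs_cstar_dsum F G : unital_cs_cstar F -> unital_cs_cstar G -> unital_cs_cstar (dsum F G).
Proof.
move=> [cF csF uF] [cG csG uG]; split; first exact: dsum_cstar.
  exact: dsum_cauchy_schwarz.
exact: dsum_unital.
Qed.

Let matC k := matalg k C.
Let unital_cs_cstar_matC k : unital_cs_cstar (matC k).
Proof. exact/unital_cs_cstar_matalg/unital_cs_cstar_cplx. Qed.

Lemma fd_iso F G : star_iso F G -> finite_dimensional F -> finite_dimensional G.
Proof.
move=> FG [m [k [m0 k0 Fk]]]; exists m, k; split=> //.
exact: star_iso_trans (star_iso_sym FG) Fk.
Qed.

Lemma fd_matalg_cplx k : (0 < k)%N -> finite_dimensional (matC k).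
Proof.
move=> k0; exists 1, (fun=> k); split=> //.
by apply/star_iso_sym/big_dsum1; case: (unital_cs_cstar_matC k).
Qed.

Lemma fd_dsum_matalg k F : (0 < k)%N -> finite_dimensional F ->
  finite_dimensional (dsum (matC k) F).
Proof.
move=> k0 [m [ks [m0 ks0 Fk]]].
pose k' (i : 'I_m.+1) := oapp ks k (unlift ord0 i).
exists m.+1, k'; split=> // [i|].
  by rewrite /k'; case: (unlift ord0 i) => [j /=|].
apply: star_iso_trans (star_iso_sym (big_dsum_recl _)).
have -> : k' ord0 = k by rewrite /k' unlift_none.
have -> : (fun j => matalg (k' (lift ord0 j)) (cplx R)) = (fun j => matC (ks j)).
  by apply/funext => j; rewrite /k' liftK.
exact/dsum_iso/Fk/star_iso_refl.
Qed.

(** Up to isomorphism, finite-dimensional algebras are generated from matrix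
    algebras by adding one summand at a time. *)
Lemma fd_ind (P : starAlg R -> Prop) :
  (forall F G, star_iso F G -> P F -> P G) ->
  (forall k, (0 < k)%N -> P (matC k)) ->
  (forall k F, (0 < k)%N -> P F -> P (dsum (matC k) F)) ->
  forall F, finite_dimensional F -> P F.
Proof.
move=> Piso P1 PS F [m [k [m0 k0 Fk]]]; apply: (Piso _ _ (star_iso_sym Fk)).
case: m m0 k k0 {F Fk} => // m _; elim: m => [|m IH] k k0.
  apply: (Piso _ _ (star_iso_sym (big_dsum1 _)) (P1 _ (k0 ord0))).
  by case: (unital_cs_cstar_matC (k ord0)).
apply: (Piso _ _ (star_iso_sym (big_dsum_recl _))); apply: PS => //.
exact: (IH (fun j => k (lift ord0 j))).
Qed.

Lemma fd_unital_cs_cstar F : finite_dimensional F -> unital_cs_cstar F.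
Proof.
apply: fd_ind => [{}F G|k k0|k {}F k0]; [exact: unital_cs_cstar_iso|exact: unital_cs_cstar_matC|].
exact: unital_cs_cstar_dsum.
Qed.

Lemma fd_dsum F G : finite_dimensional F -> finite_dimensional G ->
  finite_dimensional (dsum F G).
Proof.
move=> fdF fdG; move: F fdF; apply: fd_ind => [F F' FF' FG|k k0|k F k0 FG].
- exact/(fd_iso _ FG)/dsum_iso/star_iso_refl.
- exact: fd_dsum_matalg.
- by apply: fd_iso (star_iso_sym (dsumA _ _ _)) _; exact: fd_dsum_matalg.
Qed.

Lemma matalg_is_matrix_algebra n F : (0 < n)%N -> is_matrix_algebra F ->
  is_matrix_algebra (matalg n F).
Proof.
move=> n0 [k [k0 Fk]]; exists (n * k)%N; split; first by rewrite muln_gt0 n0.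
have [cK csK _] := unital_cs_cstar_matC k; have [cC csC uC] := unital_cs_cstar_cplx.
have [cF csF _] := unital_cs_cstar_iso (star_iso_sym Fk) (unital_cs_cstar_matC k).
exact: star_iso_trans (matalg_iso n cF csF Fk) (matalg_matalg n cC csC uC k0).
Qed.

Lemma is_matrix_algebra_unital_cs_cstar F : is_matrix_algebra F -> unital_cs_cstar F.
Proof. by move=> [k [k0 /star_iso_sym Fk]]; exact: unital_cs_cstar_iso Fk (unital_cs_cstar_matC k). Qed.

Lemma is_matrix_algebra_fd F : is_matrix_algebra F -> finite_dimensional F.
Proof.
by move=> [k [k0 /star_iso_sym Fk]]; exact: fd_iso Fk (fd_matalg_cplx k0).
Qed.

Lemma fd_matalg n F : (0 < n)%N -> finite_dimensional F ->
  finite_dimensional (matalg n F).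
Proof.
move=> n0 fdF; suff [] : unital_cs_cstar F /\ finite_dimensional (matalg n F) by [].
move: F fdF; apply: fd_ind => [F G FG [gF fdF]|k k0|k F k0 [gF fdF]].
- split; first exact: unital_cs_cstar_iso FG gF.
  by case: gF => cF csF _; apply: fd_iso fdF; exact: matalg_iso.
- split; first exact: unital_cs_cstar_matC.
  apply/is_matrix_algebra_fd/matalg_is_matrix_algebra => //.
  by exists k; split=> //; exact: star_iso_refl.
- split; first exact: unital_cs_cstar_dsum (unital_cs_cstar_matC k) gF.
  have [cK csK _] := unital_cs_cstar_matC k; have [cF csF _] := gF.
  apply: fd_iso (star_iso_sym (matalg_dsum n cK csK cF csF)) _.
  apply: fd_dsum fdF.
  apply/is_matrix_algebra_fd/matalg_is_matrix_algebra => //.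
  by exists k; split=> //; exact: star_iso_refl.
Qed.

End FiniteDimensional.

(** * Limits of theories *)

Section Relabel.
Variables (R : realType) (u : bool) (V : eqType).

Definition npsum (s : seq (npol R u V)) : npol R u V := foldr (@NAdd R u V) NZero s.

Lemma npval_sum (A : starAlg R) (a : V -> A) (s : seq (npol R u V)) :
  npval (npsum s) a = \sum_(P <- s) npval P a.
Proof. by elim: s => [|P s IH] /=; rewrite ?big_nil ?big_cons ?IH. Qed.

Fixpoint relabel m (c : 'I_m -> V) (P : star_poly R u m) : npol R u V :=
  match P with
  | PVar i => NVar (c i)
  | PI hu => NUnit hu
  | PAdd P Q => NAdd (relabel c P) (relabel c Q)
  | PScale k P => NScale k (relabel c P)
  | PMul P Q => NMul (relabel c P) (relabel c Q)
  | PAdj P => NAdj (relabel c P)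
  end.

End Relabel.

Definition theory_limit (R : realType) (u : bool) (I : Type) (U : ultrafilter I)
    (X : I -> starAlg R) (A : starAlg R) :=
  forall phi : sentence R u,
    (fun i => sentence_val (X i) phi) @ uf_sets U --> sentence_val A phi.

Section TheoryLimit.
Variables (R : realType) (u : bool) (I : Type) (U : ultrafilter I).
Variables (X : I -> starAlg R) (A : starAlg R).
Hypotheses (cX : forall i, is_cstar (X i)) (cA : is_cstar A).
Hypothesis XA : theory_limit u U X A.

Lemma theory_limit_nclose (V : eqType) (D : seq (nform R u V)) (d : R) : 0 < d ->
  uf_sets U [set i | nclose D d (fun=> 0 : A) (fun=> 0 : X i)].
Proof.
move=> d0; elim: D => [|psi D IH]; first by apply: filterE.
have /cvgrPdist_le/(_ _ d0) near_psi := @XA (nsentence psi).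
apply: filterS2 near_psi IH => i; rewrite -!nsentenceP// => psii cl chi.
by rewrite inE => /orP[/eqP->|/cl].
Qed.

Lemma cauchy_schwarz_ball (n : nat) (x y : 'I_n -> A) :
  (forall i, cauchy_schwarz (X i)) -> in_ball x -> in_ball y ->
  cnorm (ip x y) ^+ 2 <= cnorm (ip x x) * cnorm (ip y y).
Proof.
move=> csX x1 y1; pose V : eqType := (bool * 'I_n)%type.
pose ipP s t : npol R u V := npsum [seq NMul (NAdj (NVar (s, i))) (NVar (t, i)) | i <- enum 'I_n].
have ipE (B : starAlg R) (b : V -> B) s t :
    npval (ipP s t) b = ip (fun i => b (s, i)) (fun i => b (t, i)).
  by rewrite npval_sum big_map big_enum.
pose D := [:: NNorm (ipP true false); NNorm (ipP true true); NNorm (ipP false false)].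
apply/ler_addgt0Pr => e e0.
set p := cnorm _; set q := cnorm _; set r := cnorm _.
have p0 : 0 <= p by exact: cs_norm_ge0.
have q0 : 0 <= q by exact: cs_norm_ge0.
have r0 : 0 <= r by exact: cs_norm_ge0.
(* The error of the inequality is d * k when the three norms move by at most
   d <= 1. *)
pose k := q + r + 2 * p + 4; have k0 : 0 < k by rewrite /k; lra.
pose d := Num.min 1 (e / k).
have d0 : 0 < d by rewrite lt_min ltr01 divr_gt0.
have d1 : d <= 1 by rewrite ge_min lexx.
have dk : d * k <= e by rewrite -ler_pdivlMr// ge_min lexx orbT.
have [D' [d' [d'0 ext]]] := nclose_extend (enum V) D d0.
have [i ] := filter_ex (theory_limit_nclose D' d'0).
have z1 (B : starAlg R) (cB : is_cstar B) : in_ball (fun _ : V => 0 : B).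
  by move=> v; rewrite (cs_norm0 cB).
pose a (v : V) := if v.1 then x v.2 else y v.2.
have a1 : in_ball a by move=> [[] j]; [exact: x1|exact: y1].
move=> /(ext _ _ cA (cX i) _ _ (z1 _ cA) (z1 _ (cX i)))/(_ a a1)[|b [_ _ ab]].
  by move=> v; rewrite mem_enum.
move: (ab _ (mem_nth (NNorm NZero) (isT : (0 < size D)%N))) => /=.
move: (ab _ (mem_nth (NNorm NZero) (isT : (1 < size D)%N))) => /=.
move: (ab _ (mem_nth (NNorm NZero) (isT : (2 < size D)%N))) => /=.
rewrite !ipE /= -/p -/q -/r.
have := csX i n (fun i => b (true, i)) (fun i => b (false, i)).
set p' := cnorm _; set q' := cnorm _; set r' := cnorm _.
have p'0 : 0 <= p' by exact: cs_norm_ge0.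
have q'0 : 0 <= q' by exact: cs_norm_ge0.
have r'0 : 0 <= r' by exact: cs_norm_ge0.
rewrite !ler_distl => cs /andP[h1 h2] /andP[h3 h4] /andP[h5 h6].
have hq : q' <= q + d by lra.
have hr : r' <= r + d by lra.
have hp' : p' <= p + d by lra.
have hqr : q' * r' <= (q + d) * (r + d) by exact: ler_pM.
have hp : p ^+ 2 <= (p' + d) ^+ 2 by rewrite ler_sqr ?nnegrE// addr_ge0// ltW.
have hpd : p' * d <= (p + d) * d by rewrite ler_wpM2r// ltW.
have hdd : d * d <= d by rewrite ler_piMl// ltW.
apply: le_trans (_ : q * r + d * k <= _); last by rewrite lerD2l.
apply: le_trans hp _; rewrite /k; move: cs; rewrite expr2 => cs.
rewrite (_ : (p' + d) ^+ 2 = p' * p' + 2 * (p' * d) + d * d); last by ring.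
rewrite (_ : (q + d) * (r + d) = q * r + q * d + d * r + d * d) in hqr; last by ring.
rewrite (_ : (p + d) * d = p * d + d * d) in hpd; last by ring.
rewrite (_ : d * (q + r + 2 * p + 4) = q * d + d * r + 2 * (p * d) + 4 * d); last by ring.
by lra.
Qed.

(** After scaling, x and y lie in the unit ball; they are matched by vectors of
    some X i at which the three norms of the inequality are almost the same. *)
Lemma theory_limit_cauchy_schwarz :
  (forall i, cauchy_schwarz (X i)) -> cauchy_schwarz A.
Proof.
move=> csX n x y.
pose s : R := (1 + \sum_i cnorm (x i) + \sum_i cnorm (y i))^-1.
have sx0 : 0 <= \sum_i cnorm (x i) by apply: sumr_ge0 => i _; exact: cs_norm_ge0.
have sy0 : 0 <= \sum_i cnorm (y i) by apply: sumr_ge0 => i _; exact: cs_norm_ge0.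
have s0 : 0 < s by rewrite invr_gt0; lra.
have le_sum (z : 'I_n -> A) i : cnorm (z i) <= \sum_i cnorm (z i).
  by rewrite (bigD1 i)//= lerDl sumr_ge0// => j _; exact: cs_norm_ge0.
have ball (z : 'I_n -> A) : \sum_i cnorm (z i) <= s^-1 ->
    in_ball (fun i => (s%:C)%C *: z i).
  move=> zs i; rewrite (cs_norm_realZ cA _ (ltW s0)) -ler_pdivlMl// mulr1.
  exact: le_trans (le_sum z i) zs.
have ipS (z w : 'I_n -> A) : cnorm (ip (fun i => (s%:C)%C *: z i) (fun i => (s%:C)%C *: w i)) =
    s ^+ 2 * cnorm (ip z w).
  by rewrite (ipZl cA _ z) (ipZr cA _ z w) conjc_real !(cs_norm_realZ cA _ (ltW s0)) mulrA.
have xs : \sum_i cnorm (x i) <= s^-1 by rewrite /s invrK; lra.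
have ys : \sum_i cnorm (y i) <= s^-1 by rewrite /s invrK; lra.
have := cauchy_schwarz_ball csX (ball x xs) (ball y ys).
rewrite !ipS exprMn [leRHS]mulrACA -(expr2 (s ^+ 2)).
by rewrite ler_pM2l// !exprn_gt0.
Qed.

End TheoryLimit.

(** * Direct sums are continuous for theories *)

Lemma normr_max_dist (R : realType) (a a' b b' e : R) :
  `|a - b| <= e -> `|a' - b'| <= e -> `|Num.max a a' - Num.max b b'| <= e.
Proof.
rewrite !ler_distl => /andP[h1 h2] /andP[h3 h4].
by have [h|h] := leP a a'; have [h'|h'] := leP b b'; apply/andP; split; lra.
Qed.

(** The de Bruijn level of a variable: binding a new variable at index 0 gives it
    the name m and leaves the other names unchanged. *)
Definition var_name m (i : 'I_m) : nat := (m - i.+1)%N.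

Lemma var_name0 m : var_name (ord0 : 'I_m.+1) = m.
Proof. by rewrite /var_name subn1. Qed.

Lemma var_nameS m (i : 'I_m) : var_name (lift ord0 i) = var_name i.
Proof. by rewrite /var_name lift0 subSS. Qed.

Lemma var_name_neq m (i : 'I_m) : (var_name i == m) = false.
Proof.
apply/negbTE; rewrite neq_ltn /var_name; apply/orP; left.
by rewrite -subn_gt0 subKn// ltnW.
Qed.

Section DirectSumContinuity.
Variables (R : realType) (u : bool) (K : Type) (X Y : K -> starAlg R).
Hypotheses (cX : forall k, is_cstar (X k)) (cY : forall k, is_cstar (Y k)).
Hypothesis uXY : u -> forall k, unital (X k) /\ unital (Y k).

Let T k := dsum (X k) (Y k).
Let Env k := ((nat -> X k) * (nat -> Y k))%type.
Let ok (m : nat) k (e : Env k) := in_ball e.1 /\ in_ball e.2.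
Let read m k (e : Env k) : 'I_m -> T k := fun i => (e.1 (var_name i), e.2 (var_name i)).
Let J := (seq (nform R u nat) * {posnum R})%type.
Let rel (j : J) k k' (e : Env k) (e' : Env k') :=
  nclose j.1 j.2%:num e.1 e'.1 /\ nclose j.1 j.2%:num e.2 e'.2.

Lemma dsum_poly_val m (P : star_poly R u m) k (e : Env k) :
  poly_val P (read e) =
  (npval (relabel (@var_name m) P) e.1, npval (relabel (@var_name m) P) e.2) :> T k.
Proof.
elim: P => //= [hu|P -> Q ->|c P ->|P -> Q ->|P ->] //.
have [[x xP] [y yP]] := uXY hu k.
have xyP : is_identity ((x, y) : T k).
  by move=> -[a b]; rewrite /smul /= (xP a).1 (xP a).2 (yP b).1 (yP b).2.
by rewrite (cunitE xyP) (cunitE xP) (cunitE yP).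
Qed.

(** Environments are pairs of environments, and the two components of a new
    element are matched independently. *)
Theorem dsum_continuity (phi : sentence R u) (e : R) : 0 < e ->
  exists (D : seq (nform R u nat)) (d : R), 0 < d /\ forall k k',
  nclose D d (fun=> 0 : X k) (fun=> 0 : X k') ->
  nclose D d (fun=> 0 : Y k) (fun=> 0 : Y k') ->
  `|sentence_val (T k) phi - sentence_val (T k') phi| < e.
Proof.
move=> e0.
have read_cons m k (x : T k) (b : Env k) :
    read (upd b.1 m x.1, upd b.2 m x.2) = env_cons x (@read m k b).
  apply/funext => i; rewrite /read /upd /=; case: (unliftP ord0 i) => [j ->|->].
    by rewrite env_consS var_nameS var_name_neq.
  by rewrite env_cons0 var_name0 eqxx -surjective_pairing.
have [||||||[D d] jP] := @back_and_forth R u K T _ Env ok read _ J ([::], 1%:pos%R) rel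
  _ _ _ _ 0 phi e e0.
- by move=> k; exact: dsum_cstar.
- by move=> m k b [b1 b2] i; rewrite /cnorm /= ge_max b1 b2.
- by move=> j k k' b b' [h1 h2]; split; exact: nclose_sym.
- move=> [D1 d1] [D2 d2].
  have d0 : 0 < Num.min d1%:num d2%:num by rewrite lt_min !gt0.
  exists (D1 ++ D2, PosNum d0) => k k' b b' [/= h1 h2].
  have dd1 : Num.min d1%:num d2%:num <= d1%:num by rewrite ge_min lexx.
  have dd2 : Num.min d1%:num d2%:num <= d2%:num by rewrite ge_min lexx orbT.
  have s1 : {subset D1 <= D1 ++ D2} by move=> ? h; rewrite mem_cat h.
  have s2 : {subset D2 <= D1 ++ D2} by move=> ? h; rewrite mem_cat h orbT.
  split; split.
  + exact: nclose_sub s1 dd1 h1.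
  + exact: nclose_sub s1 dd1 h2.
  + exact: nclose_sub s2 dd2 h1.
  + exact: nclose_sub s2 dd2 h2.
- move=> m P r r0; have r2 : 0 < r / 2 by rewrite divr_gt0.
  exists ([:: NNorm (relabel (@var_name m) P)], PosNum r2) => k k' b b' _ _ [/= h1 h2].
  rewrite !dsum_poly_val /cnorm /=.
  have := h2 _ (mem_head _ _); have := h1 _ (mem_head _ _).
  move=> /= h3 h4; apply: le_lt_trans (normr_max_dist h3 h4) _.
  by rewrite ltr_pdivrMr// ltr_pMr ?ltr1n.
- move=> m [D d].
  have [D' [d' [d'0 ext]]] := nclose_extend1 D m (gt0 d).
  exists (D', PosNum d'0) => k k' b b' [b1 b2] [b'1 b'2] [/= h1 h2] x.
  rewrite {1}/cnorm /= ge_max => /andP[x1 x2].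
  have [y1 y1_1 cl1] := ext _ _ (cX k) (cX k') _ _ b1 b'1 h1 x.1 x1.
  have [y2 y2_1 cl2] := ext _ _ (cY k) (cY k') _ _ b2 b'2 h2 x.2 x2.
  exists (y1, y2), (upd b.1 m x.1, upd b.2 m x.2), (upd b'.1 m y1, upd b'.2 m y2).
  split=> //.
  + by rewrite /cnorm /= ge_max y1_1 y2_1.
  + by split; split; exact: upd_ball.
  + exact: read_cons.
  + exact: (read_cons m k' (y1, y2)).
- exists D, d%:num; split; first exact: gt0.
  move=> k k' h1 h2.
  have z1 (A : starAlg R) : is_cstar A -> in_ball (fun _ : nat => 0 : A).
    by move=> cA v; rewrite (cs_norm0 cA).
  have := jP k k' ((fun=> 0), (fun=> 0)) ((fun=> 0), (fun=> 0)).
  by apply; split=> //=; exact: z1.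
Qed.

End DirectSumContinuity.

(** * Matrix algebras are continuous for theories *)

(** The constant c disappears under 2^j-th roots: if y > x + e and x <= B, then
    x <= r (x + e) with r = B / (B + e) < 1, and c r^(2^j) < 1/2 for large j. *)
Lemma pow2_root_close (R : realType) (c B e : R) : 0 < e -> 0 <= c -> 0 <= B ->
  exists j (d : R), 0 < d /\ forall x y : R, 0 <= x -> x <= B -> 0 <= y ->
    y ^+ (2 ^ j) <= c * (x ^+ (2 ^ j) + d) -> y <= x + e.
Proof.
move=> e0 c0 B0; pose r := B / (B + e).
have Be0 : 0 < B + e by rewrite ltr_wpDl.
have r0 : 0 <= r by rewrite divr_ge0// ltW.
have r1 : r < 1 by rewrite ltr_pdivrMr// mul1r ltrDl.
have [N _ NP] : \forall N \near \oo, c * r ^+ N < 2^-1.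
  have : (fun N => c * r ^+ N) @ \oo --> c * 0.
    by apply: cvgMr; apply: cvg_expr; rewrite ger0_norm.
  by rewrite mulr0; move/cvgr_lt; apply; rewrite invr_gt0.
pose S := (2 ^ N)%N.
have S0 : (0 < S)%N by rewrite expn_gt0.
have cr : c * r ^+ S < 2^-1.
  by apply: NP; rewrite /= ltnW// ltn_expl.
pose d := e ^+ S / (2 * (c + 1)).
have eS0 : 0 < e ^+ S by rewrite exprn_gt0.
have c1 : 0 < c + 1 by rewrite ltr_wpDl.
have d0 : 0 < d by rewrite divr_gt0// mulr_gt0.
have cd : c * d <= e ^+ S / 2.
  rewrite /d invfM mulrCA !mulrA -!mulrA ler_wpM2l ?(ltW eS0)//.
  rewrite mulrCA ler_piMr ?invr_ge0// ler_pdivrMr// mul1r lerDl ler01 //.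
exists N, d; split=> // x y x0 xB y0 hy; rewrite leNgt; apply/negP => xy.
have t0 : 0 <= x + e by rewrite addr_ge0// ltW.
have xt : x <= r * (x + e).
  by rewrite mulrAC ler_pdivlMr// !mulrDr [x * B]mulrC lerD2l ler_wpM2r// ltW.
have h1 : (x + e) ^+ S < y ^+ S by rewrite ltrXn2r// -lt0n.
have h2 : x ^+ S <= r ^+ S * (x + e) ^+ S.
  by rewrite -exprMn lerXn2r ?nnegrE// mulr_ge0.
have h3 : e ^+ S <= (x + e) ^+ S.
  by rewrite lerXn2r ?nnegrE ?(ltW e0)// lerDr.
have h4 : c * x ^+ S <= 2^-1 * (x + e) ^+ S.
  apply: le_trans (ler_wpM2l c0 h2) _; rewrite mulrA ler_wpM2r ?exprn_ge0//.
  exact: ltW.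
move: hy; rewrite -/S mulrDr => hy; lra.
Qed.

Section MatrixContinuity.
Variables (R : realType) (u : bool) (K : Type) (X : K -> starAlg R) (n : nat).
Hypotheses (cX : forall k, is_cstar (X k)) (csX : forall k, cauchy_schwarz (X k)).
Hypothesis uX : u -> forall k, unital (X k).

Let V : eqType := (nat * ('I_n * 'I_n))%type.
Let T k := matalg n (X k).
Let Env k := V -> X k.
Let cT k : is_cstar (T k) := matalg_cstar n (@cX k) (@csX k).

Definition read_mx m k (a : Env k) : 'I_m -> T k :=
  fun i => \matrix_(p, q) a (var_name i, (p, q)).

Let readE m k (a : Env k) (i : 'I_m) p q : mx_fun (read_mx a i) p q = a (var_name i, (p, q)).
Proof. by rewrite /mx_fun mxE. Qed.

Fixpoint entry m (P : star_poly R u m) (p q : 'I_n) : npol R u V :=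
  match P with
  | PVar i => NVar (var_name i, (p, q))
  | PI hu => if p == q then NUnit hu else NZero
  | PAdd P Q => NAdd (entry P p q) (entry Q p q)
  | PScale c P => NScale c (entry P p q)
  | PMul P Q => npsum [seq NMul (entry P p r) (entry Q r q) | r <- enum 'I_n]
  | PAdj P => NAdj (entry P q p)
  end.

Lemma entryP m (P : star_poly R u m) k (a : Env k) p q :
  npval (entry P p q) a = mx_fun (poly_val P (read_mx a)) p q.
Proof.
elim: P p q => [i|hu|P IP Q IQ|c P IP|P IP Q IQ|P IP] p q /=.
- by rewrite readE.
- have [e eP] := uX hu k.
  rewrite (cunitE (is_identity_diag (@cX k) eP)) /mx_fun mxE.
  by case: eqP => _ //=; rewrite (cunitE eP).
- by rewrite mx_funD IP IQ.
- by rewrite mx_funZ IP.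
- rewrite npval_sum big_map big_enum mx_funM.
  by apply: eq_bigr => r _ /=; rewrite IP IQ.
- by rewrite mx_fun_adj IP.
Qed.

(** Iterating P |-> P^* P squares the norm each time, by the C*-identity. *)
Fixpoint square_iter m (P : star_poly R u m) j : star_poly R u m :=
  if j is j'.+1 then PMul (PAdj (square_iter P j')) (square_iter P j') else P.

Lemma square_iter_norm m (P : star_poly R u m) j k (x : 'I_m -> T k) :
  cnorm (poly_val (square_iter P j) x) = cnorm (poly_val P x) ^+ (2 ^ j).
Proof.
elim: j => [|j IH]; first by rewrite expr1.
set M := poly_val (square_iter P j) x in IH *.
by rewrite -[LHS]/(cnorm (adj M ** M)) (cs_normC (cT k)) IH -exprM expnSr.
Qed.

Let read_bound m k (a : Env k) : in_ball a ->
  forall i : 'I_m, cnorm (read_mx a i) <= (n * n)%:R.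
Proof.
move=> a1 i; apply: le_trans (mat_norm_sum (@cX k) (@csX k) _) _.
apply: (@le_trans _ _ (\sum_(p < n) \sum_(q < n) 1)).
  by apply: ler_sum => p _; apply: ler_sum => q _; rewrite readE.
by rewrite sumr_const card_ord sumr_const card_ord -mulrnA.
Qed.

(** The 2^j-th power of |P| is within the factor n^2 of the largest entry norm of
    [square_iter P j], and [pow2_root_close] absorbs this factor. *)
Lemma mx_norm_continuity m (P : star_poly R u m) (e : R) : 0 < e ->
  exists (D : seq (nform R u V)) (d : R), 0 < d /\
  forall k k' (a : Env k) (a' : Env k'), in_ball a -> in_ball a' -> nclose D d a a' ->
  cnorm (poly_val P (read_mx a')) <= cnorm (poly_val P (read_mx a)) + e.
Proof.
move=> e0.
pose c : R := (n * n)%:R; have c0 : 0 <= c by rewrite ler0n.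
have [j [d [d0 close_root]]] := pow2_root_close e0 c0 (normr_ge0 (poly_bound c P)).
pose D := [seq NNorm (entry (square_iter P j) pq.1 pq.2) | pq <- enum {: 'I_n * 'I_n}].
exists D, d; split=> // k k' a a' a1 a'1 aa'.
apply: close_root; rewrite ?cs_norm_ge0//.
  by apply: le_trans (poly_val_le _ (cT k) (read_bound a1)) (ler_norm _).
rewrite -!square_iter_norm.
set M := poly_val _ _; set M' := poly_val _ _.
apply: le_trans (mat_norm_sum (@cX k') (@csX k') _) _.
apply: (@le_trans _ _ (\sum_(p < n) \sum_(q < n) (cnorm M' + d))).
  apply: ler_sum => p _; apply: ler_sum => q _.
  apply: (@le_trans _ _ (cnorm (mx_fun M' p q) + d)); last first.
    by rewrite lerD2r; exact: mat_norm_entry.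
  have /aa' : NNorm (entry (square_iter P j) p q) \in D.
    apply/mapP; exists (p, q) => //; exact: mem_enum.
  by rewrite /= !entryP distrC ler_distl => /andP[].
by rewrite sumr_const card_ord sumr_const card_ord -mulrnA mulr_natl.
Qed.

(** The entries of x are matched by [nclose_extend].  The resulting matrix y0 has
    norm at most 1 + e by [mx_norm_continuity], so scaling it into the unit ball
    moves each entry by at most e. *)
Lemma mx_step m (D : seq (nform R u V)) (d : R) : 0 < d ->
  exists (D' : seq (nform R u V)) (d' : R), 0 < d' /\
  forall k k' (a : Env k) (a' : Env k'), in_ball a -> in_ball a' -> nclose D' d' a a' ->
  forall x : T k, cnorm x <= 1 ->
  exists (y : T k') (b : Env k) (b' : Env k'),
  [/\ cnorm y <= 1, in_ball b /\ in_ball b',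
      read_mx b = env_cons x (@read_mx m k a),
      read_mx b' = env_cons y (@read_mx m k' a') & nclose D d b b'].
Proof.
move=> d0; have d2 : 0 < d / 2 by rewrite divr_gt0.
have [L L0 LP] : exists2 L : R, 0 < L & forall psi, psi \in D ->
    forall A : starAlg R, is_cstar A -> forall (a b : V -> A) (e : R),
    in_ball a -> in_ball b -> 0 <= e -> (forall v, cnorm (a v - b v) <= e) ->
    `|nval psi a - nval psi b| <= L * e.
  elim: D => [|psi D [L L0 LP]]; first by exists 1.
  have [N N0 NP] := nval_lipschitz psi; exists (N + L); first by rewrite ltr_wpDl.
  move=> chi; rewrite inE => chiD A cA a b e a1 b1 e0 ab.
  rewrite mulrDl; case/orP: chiD => [/eqP->|chiD].
    apply: le_trans (NP A cA a b e a1 b1 e0 ab) _.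
    by rewrite lerDl mulr_ge0// ltW.
  apply: le_trans (LP chi chiD A cA a b e a1 b1 e0 ab) _.
  by rewrite lerDr mulr_ge0.
(* L is a Lipschitz constant for all of D, so moving the entries by e costs at
   most d / 2. *)
pose e := d / 2 / L; have e0 : 0 < e by rewrite divr_gt0.
have [D1 [d1 [d10 norm_close]]] := mx_norm_continuity (PVar R u (ord0 : 'I_m.+1)) e0.
pose vs : seq V := [seq (m, pq) | pq <- enum {: 'I_n * 'I_n}].
have vsP (v : V) : (v \in vs) = (v.1 == m).
  apply/mapP/eqP => [[pq _ ->//]|vm]; exists v.2; first exact: mem_enum.
  by rewrite -vm -surjective_pairing.
pose d3 := Num.min (d / 2) d1; have d30 : 0 < d3 by rewrite lt_min d2.
have [D' [d' [d'0 ext]]] := nclose_extend vs (D ++ D1) d30.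
exists D', d'; split=> // k k' a a' a1 a'1 aa' x x1.
have set_read l (a0 b0 : Env l) (z : T l) : (forall pq, b0 (m, pq) = mx_fun z pq.1 pq.2) ->
    (forall v : V, v.1 != m -> b0 v = a0 v) -> read_mx b0 = env_cons z (@read_mx m l a0).
  move=> bm ba; apply/funext => i; apply: mx_funP.
  apply/funext => p; apply/funext => q.
  rewrite readE; case: (unliftP ord0 i) => [i' ->|->].
    by rewrite env_consS readE var_nameS ba//= var_name_neq.
  by rewrite env_cons0 var_name0 bm.
pose b : Env k := fun v => if v.1 == m then mx_fun x v.2.1 v.2.2 else a v.
have b1 : in_ball b.
  move=> v; rewrite /b; case: eqP => _; last exact: a1.
  by apply: le_trans x1; exact: (mat_norm_entry (@cX k) (@csX k)).
have [|b' [b'1 b'a' bb']] := ext _ _ (cX k) (cX k') a a' a1 a'1 aa' b b1.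
  by move=> v; rewrite vsP /b => /negPf ->.
have bx : read_mx b = env_cons x (@read_mx m k a).
  by apply: set_read => [pq|v /negPf vm]; rewrite /b ?eqxx ?vm.
pose y0 : T k' := \matrix_(p, q) b' (m, (p, q)).
have y0E p q : mx_fun y0 p q = b' (m, (p, q)) by rewrite /mx_fun mxE.
have b'y0 : read_mx b' = env_cons y0 (@read_mx m k' a').
  by apply: set_read => [[p q]|v vm]; rewrite ?y0E// b'a'// vsP.
have y0e : cnorm y0 <= 1 + e.
  have /norm_close : nclose D1 d1 b b'.
    by apply: nclose_sub bb'; [move=> v h; rewrite mem_cat h orbT|rewrite ge_min lexx orbT].
  move=> /(_ b1 b'1); rewrite /= bx b'y0 !env_cons0 => h.
  by apply: le_trans h _; rewrite lerD2r.
have [y y1 yP] := shrink_to_ball (cT k') y0.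
have {}yP := yP e (ltW e0) y0e.
pose b'' : Env k' := fun v => if v.1 == m then mx_fun y v.2.1 v.2.2 else b' v.
have b''1 : in_ball b''.
  move=> v; rewrite /b''; case: eqP => _; last exact: b'1.
  by apply: le_trans y1; exact: (mat_norm_entry (@cX k') (@csX k')).
have b'b'' v : cnorm (b' v - b'' v) <= e.
  rewrite /b''; case: v => l [p q] /=; case: eqP => [->|_]; last first.
    by rewrite subrr (cs_norm0 (@cX k')) ltW.
  rewrite -y0E -mx_funN -mx_funD; apply: le_trans yP.
  exact: (mat_norm_entry (@cX k') (@csX k')).
exists y, b, b''; split=> //.
  apply: set_read => [pq|v vm]; rewrite /b'' ?eqxx// (negPf vm).
  by rewrite b'a'// vsP.
move=> psi psiD; rewrite -(subrKA (nval psi b')).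
apply: le_trans (ler_normD _ _) _; rewrite [leRHS]splitr; apply: lerD.
  have := bb' psi; rewrite mem_cat psiD => /(_ isT) h; apply: le_trans h _.
  by rewrite ge_min lexx.
apply: le_trans (LP psi psiD _ (cX k') _ _ e b'1 b''1 (ltW e0) b'b'') _.
by rewrite /e mulrC divfK// gt_eqF.
Qed.

Let ok m k (a : Env k) := in_ball a /\ in_ball (@read_mx m k a).
Let J := (seq (nform R u V) * {posnum R})%type.
Let rel (j : J) k k' (a : Env k) (a' : Env k') := nclose j.1 j.2%:num a a'.

Theorem matalg_continuity (phi : sentence R u) (e : R) : 0 < e ->
  exists (D : seq (nform R u V)) (d : R), 0 < d /\ forall k k',
  nclose D d (fun=> 0 : X k) (fun=> 0 : X k') ->
  `|sentence_val (T k) phi - sentence_val (T k') phi| < e.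
Proof.
move=> e0.
have [||||||[D d] jP] := @back_and_forth R u K T _ Env ok read_mx _ J ([::], 1%:pos%R) rel
  _ _ _ _ 0 phi e e0.
- exact: cT.
- by move=> m k b [].
- by move=> j k k' b b'; exact: nclose_sym.
- move=> [D1 d1] [D2 d2].
  have d0 : 0 < Num.min d1%:num d2%:num by rewrite lt_min !gt0.
  exists (D1 ++ D2, PosNum d0) => k k' b b' /= h.
  split; apply: nclose_sub h.
  + by move=> ? h; rewrite mem_cat h.
  + by rewrite ge_min lexx.
  + by move=> ? h; rewrite mem_cat h orbT.
  + by rewrite ge_min lexx orbT.
- move=> m P r r0; have r2 : 0 < r / 2 by rewrite divr_gt0.
  have [D [d [d0 DP]]] := mx_norm_continuity P r2.
  exists (D, PosNum d0) => k k' b b' [b1 _] [b'1 _] /= h.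
  apply: (@le_lt_trans _ _ (r / 2)); last by rewrite ltr_pdivrMr// ltr_pMr ?ltr1n.
  rewrite ler_distlC DP// andbT lerBlDr.
  by apply: DP => //; exact: nclose_sym.
- move=> m [D d]; have [D' [d' [d'0 step]]] := mx_step m D (gt0 d).
  exists (D', PosNum d'0) => k k' b b' [b1 rb] [b'1 rb'] /= h x x1.
  have [y [c [c' [y1 [c1 c'1] cx c'y cc']]]] := step k k' b b' b1 b'1 h x x1.
  exists y, c, c'; split=> //; split; split=> //.
    by rewrite cx; exact: env_cons_ball.
  by rewrite c'y; exact: env_cons_ball.
- exists D, d%:num; split; first exact: gt0.
  move=> k k' h.
  have z k0 : ok 0 (fun=> 0 : X k0).
    by split=> [v|[]//]; rewrite (cs_norm0 (cX k0)).
  have r0 k0 : @read_mx 0 k0 (fun=> 0) = (fun=> 0) by apply/funext => -[].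
  by have := jP k k' _ _ (z k) (z k') h; rewrite !r0.
Qed.

End MatrixContinuity.

(** * Pseudocompact and pseudomatricial algebras *)

Section Limits.
Variables (R : realType) (u : bool).

(** Continuity compares members of one family of algebras: here the X i together
    with their limit, at the index [None]. *)
Lemma theory_limit_dsum (I : Type) (U : ultrafilter I) (X Y : I -> starAlg R)
    (A B : starAlg R) :
  (forall i, is_cstar (X i)) -> (forall i, is_cstar (Y i)) ->
  is_cstar A -> is_cstar B ->
  (u -> unital A /\ unital B) -> (u -> forall i, unital (X i) /\ unital (Y i)) ->
  theory_limit u U X A -> theory_limit u U Y B ->
  theory_limit u U (fun i => dsum (X i) (Y i)) (dsum A B).
Proof.
move=> cX cY cA cB uAB uXY XA YB phi.
pose X' (k : option I) := oapp X A k; pose Y' (k : option I) := oapp Y B k.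
have cX' k : is_cstar (X' k) by case: k.
have cY' k : is_cstar (Y' k) by case: k.
have uXY' : u -> forall k, unital (X' k) /\ unital (Y' k).
  by move=> hu [i|]; [exact: uXY|exact: uAB].
apply/cvgrPdist_lt => e e0.
have [D [d [d0 DP]]] := dsum_continuity cX' cY' uXY' phi e0.
have near_A := theory_limit_nclose cX cA XA D d0.
have near_B := theory_limit_nclose cY cB YB D d0.
by apply: filterS2 near_A near_B => i hA hB; exact: (DP None (Some i)).
Qed.

Lemma theory_limit_matalg (I : Type) (U : ultrafilter I) (X : I -> starAlg R)
    (A : starAlg R) n :
  (forall i, is_cstar (X i)) -> (forall i, cauchy_schwarz (X i)) ->
  is_cstar A -> cauchy_schwarz A ->
  (u -> unital A) -> (u -> forall i, unital (X i)) ->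
  theory_limit u U X A ->
  theory_limit u U (fun i => matalg n (X i)) (matalg n A).
Proof.
move=> cX csX cA csA uA uX XA phi.
pose X' (k : option I) := oapp X A k.
have cX' k : is_cstar (X' k) by case: k.
have csX' k : cauchy_schwarz (X' k) by case: k.
have uX' : u -> forall k, unital (X' k).
  by move=> hu [i|]; [exact: uX|exact: uA].
apply/cvgrPdist_lt => e e0.
have [D [d [d0 DP]]] := matalg_continuity n cX' csX' uX' phi e0.
have near_A := theory_limit_nclose cX cA XA D d0.
by apply: filterS near_A => i hA; exact: (DP None (Some i)).
Qed.

Lemma elem_equiv_limit (I : Type) (U : ultrafilter I) (F : I -> cstarAlg R)
    (A : starAlg R) : (forall i, unital_cs_cstar (F i)) ->
  elem_equiv u A (ultraproduct U F) ->
  (u -> unital A) /\ theory_limit u U (fun i => F i) A.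
Proof.
move=> gF [uA AF]; split=> [/uA[]//|phi]; rewrite AF.
by apply: los_sentence => _ i; case: (gF i).
Qed.

Lemma limit_elem_equiv (I : Type) (U : ultrafilter I) (F : I -> cstarAlg R)
    (A : starAlg R) : (forall i, unital_cs_cstar (F i)) -> (u -> unital A) ->
  theory_limit u U (fun i => F i) A -> elem_equiv u A (ultraproduct U F).
Proof.
move=> gF uA FA; have uF i : unital (F i) by case: (gF i).
split=> [hu|phi]; first by split; [exact: uA|exact: ultraproduct_unital].
apply: (cvg_unique (@Rhausdorff R) (FA phi)).
by apply: los_sentence => _ i.
Qed.

Lemma theory_limit_pullback (I J : Type) (U : ultrafilter I) (W : ultrafilter J)
    (f : J -> I) (X : I -> starAlg R) (A : starAlg R) :
  f @ uf_sets W --> uf_sets U -> theory_limit u U X A ->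
  theory_limit u W (X \o f) A.
Proof. by move=> fWU XA phi; exact: cvg_comp fWU (@XA phi). Qed.

(** Any ultrafilter above the product filter. *)
Lemma product_ultrafilter (I J : Type) (U : ultrafilter I) (V : ultrafilter J) :
  exists W : ultrafilter (I * J),
    fst @ uf_sets W --> uf_sets U /\ snd @ uf_sets W --> uf_sets V.
Proof.
have UV_proper : ProperFilter (filter_prod (uf_sets U) (uf_sets V)) by exact: _.
have [W [WU UVW]] := ultraFilterLemma UV_proper.
exists (Ultrafilter WU); split=> S SU; apply: UVW.
  exact: (@cvg_fst _ _ (uf_sets U) (uf_sets V)).
exact: (@cvg_snd _ _ (uf_sets U) (uf_sets V)).
Qed.

Lemma pseudocompact_iso (A B : starAlg R) : star_iso A B ->
  pseudocompact u A -> pseudocompact u B.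
Proof.
move=> AB [cA [I [U [F [fdF [uA AF]]]]]]; split; first exact: star_iso_cstar AB cA.
exists I, U, F; split=> //; split=> [hu|phi]; last by rewrite -(star_iso_sentence _ AB).
by have [uA' uF] := uA hu; split=> //; exact: star_iso_unital AB uA'.
Qed.

Lemma pseudocompact_dsum (A B : starAlg R) :
  pseudocompact u A -> pseudocompact u B -> pseudocompact u (dsum A B).
Proof.
move=> [cA [I [U [F [fdF AF]]]]] [cB [J [V [G [fdG BG]]]]].
have gF i := fd_unital_cs_cstar (fdF i); have gG j := fd_unital_cs_cstar (fdG j).
have [uA FA] := elem_equiv_limit gF AF; have [uB GB] := elem_equiv_limit gG BG.
have [W [WU WV]] := product_ultrafilter U V.
pose H (p : I * J) := CstarAlg (dsum_cstar (cstarAlgP (F p.1)) (cstarAlgP (G p.2))).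
have fdH p : finite_dimensional (H p) by exact: fd_dsum.
split; first exact: dsum_cstar.
exists (I * J)%type, W, H; split=> //.
apply: limit_elem_equiv => [p|hu|]; first exact: fd_unital_cs_cstar.
  by apply: dsum_unital; [exact: uA|exact: uB].
apply: theory_limit_dsum (theory_limit_pullback WU FA) (theory_limit_pullback WV GB) => //.
- by move=> p; exact: cstarAlgP.
- by move=> p; exact: cstarAlgP.
- by move=> hu; split; [exact: uA|exact: uB].
- by move=> _ p; split; [case: (gF p.1)|case: (gG p.2)].
Qed.

Lemma pseudocompact_big_dsum m (A : 'I_m.+1 -> starAlg R) :
  (forall i, pseudocompact u (A i)) -> pseudocompact u (big_dsum A).
Proof.
elim: m A => [|m IH] A pA.
  apply: pseudocompact_iso (star_iso_sym (big_dsum1 _)) (pA ord0).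
  by case: (pA ord0).
apply: pseudocompact_iso (star_iso_sym (big_dsum_recl _)) _.
apply: pseudocompact_dsum (pA ord0) (IH _ _) => j; exact: pA.
Qed.

Lemma matalg_elem_equiv (A : starAlg R) n (I : Type) (U : ultrafilter I)
    (F : I -> cstarAlg R) :
  is_cstar A -> (forall i, unital_cs_cstar (F i)) -> elem_equiv u A (ultraproduct U F) ->
  is_cstar (matalg n A) /\ exists2 G : I -> cstarAlg R,
    (forall i, G i = matalg n (F i) :> starAlg R) &
    elem_equiv u (matalg n A) (ultraproduct U G).
Proof.
move=> cA gF AF; have [uA FA] := elem_equiv_limit gF AF.
have cF i : is_cstar (F i) by case: (gF i).
have csF i : cauchy_schwarz (F i) by case: (gF i).
have csA := theory_limit_cauchy_schwarz cF cA FA csF.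
split; first exact: matalg_cstar.
exists (fun i => CstarAlg (matalg_cstar n (cF i) (csF i))) => //.
apply: limit_elem_equiv => [i|hu|]; first exact: unital_cs_cstar_matalg.
  by apply: matalg_unital => //; exact: uA.
by apply: theory_limit_matalg => // _ i; case: (gF i).
Qed.

Lemma pseudocompact_matalg (A : starAlg R) n : (0 < n)%N ->
  pseudocompact u A -> pseudocompact u (matalg n A).
Proof.
move=> n0 [cA [I [U [F [fdF AF]]]]].
have [cM [G GE AG]] := matalg_elem_equiv n cA (fun i => fd_unital_cs_cstar (fdF i)) AF.
split=> //; exists I, U, G; split=> // i.
by rewrite GE; exact: fd_matalg.
Qed.

Lemma pseudomatricial_matalg (A : starAlg R) n : (0 < n)%N ->
  pseudomatricial u A -> pseudomatricial u (matalg n A).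
Proof.
move=> n0 [cA [I [U [F [mF AF]]]]].
have [cM [G GE AG]] := matalg_elem_equiv n cA (fun i => is_matrix_algebra_unital_cs_cstar (mF i)) AF.
split=> //; exists I, U, G; split=> // i.
by rewrite GE; exact: matalg_is_matrix_algebra.
Qed.

End Limits.

Theorem proposition3p1 (R : realType) (u : bool) :
  [/\ (forall A B : starAlg R,
         pseudocompact u A -> pseudocompact u B -> pseudocompact u (dsum A B)),
      (forall (m : nat) (A : 'I_m -> starAlg R), (0 < m)%N ->
         (forall i, pseudocompact u (A i)) -> pseudocompact u (big_dsum A)),
      (forall (A : starAlg R) (n : nat), (0 < n)%N ->
         pseudocompact u A -> pseudocompact u (matalg n A)) &
      (forall (A : starAlg R) (n : nat), (0 < n)%N ->
         pseudomatricial u A -> pseudomatricial u (matalg n A))].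
Proof.
split.
- exact: pseudocompact_dsum.
- by case=> // m A _; exact: pseudocompact_big_dsum.
- exact: pseudocompact_matalg.
- exact: pseudomatricial_matalg.
Qed.
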